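(* Let $d\ge2$ be an integer, $1\le p<\infty$, and $\lambda:=\frac dp$. Put $k:=k(\lambda)=\min\{n\in\mathbb N: n>\lambda\}$. There is a constant $c=c(\lambda,d)>0$ such that for every $f\in\dot B_p^{\lambda1}$ and $N\in\mathbb N$ there exist a covering $\Delta_N$ of $Q^d=[0,1)^d$ by at most $N$ dyadic subcubes of $Q^d$ and $g_N\in\mathcal P_{k-1}(\Delta_N)$ such that $$\|f-g_N\|_{L_\infty(Q^d)}\le c\,N^{-\lambda/d}|f|_{B_p^{\lambda1}}.$$
   Context: Dyadic subcubes of $Q^d:=[0,1)^d$ are the cubes $2^{-j}(Q^d+\alpha)\subset Q^d$, $j\in\{0,1,2,\dots\}$, $\alpha\in\mathbb Z^d$. $\mathcal P_{l}$ is the space of polynomials on $\mathbb R^d$ of degree at most $l$, and $\mathcal P_l(\Delta)$ is the set of functions $\sum_{K\in\Delta}P_K\cdot 1_K$ with $P_K\in\mathcal P_l$. The homogeneous Besov space $\dot B_p^{\lambda1}=\dot B_p^{\lambda1}(Q^d)$ consists of $f\in L_p(Q^d)$ with finite seminorm $$|f|_{B_p^{\lambda1}}:=\int_0^1\frac{\omega_k(t;f;L_p)}{t^\lambda}\frac{dt}t,\qquad k=k(\lambda),$$ where $\omega_k(t;f;L_p)=\sup_{|h|\le t}\|\Delta_h^kf\|_{L_p(\{x:\,x+jh\in Q^d,\ j=0,\dots,k\})}$ is the $k$-th modulus of continuity, $\Delta_h^kf(x)=\sum_{j=0}^k(-1)^{k-j}\binom kj f(x+jh)$. *)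

(* Defs.v *)
From HB Require Import structures.
From mathcomp Require Import all_boot all_order all_algebra finmap.
(* The notations of mpoly clash with those of MathComp-Analysis. *)
From mathcomp Require mpoly.
Import -(notations) mpoly.
From mathcomp Require Import all_classical all_reals all_analysis.

Set Implicit Arguments.
Unset Strict Implicit.
Unset Printing Implicit Defensive.

Import Order.TTheory GRing.Theory Num.Theory.
Import numFieldNormedType.Exports.

Local Open Scope classical_set_scope.
Local Open Scope ring_scope.

(* R^d with the product sigma-algebra of the Borel sigma-algebra of R. *)
Notation euclid R d := (d.-tuple (measurableTypeR R)).

Section lebesgue_measure_on_tuples.
Context {R : realType}.

Definition cons_tuple n (x : measurableTypeR R * euclid R n) : euclid R n.+1 :=
  [tuple of x.1 :: x.2].

Definition uncons_tuple n (x : euclid R n.+1) : measurableTypeR R * euclid R n :=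
  (thead x, [tuple of behead x]).

Lemma cons_tupleK n : cancel (@cons_tuple n) (@uncons_tuple n).
Proof. by case=> a x; congr pair; apply/val_inj. Qed.

Lemma measurable_cons_tuple n : measurable_fun setT (@cons_tuple n).
Proof. exact: measurable_cons. Qed.

Lemma measurable_uncons_tuple n : measurable_fun setT (@uncons_tuple n).
Proof.
apply: measurable_fun_pair => /=; last exact: measurable_behead.
exact: (@measurable_tnth _ _ n.+1 ord0).
Qed.

Lemma sigma_finite_cons_tuple n
    (m : {sigma_finite_measure set (euclid R n) -> \bar R}) :
  sigma_finite setT (pushforward (lebesgue_measure \x m)%E (@cons_tuple n)).
Proof.
have /sigma_finiteP[F [TF ndF Foo]] := sigma_finiteT (@lebesgue_measure R).
have /sigma_finiteP[G [TG ndG Goo]] := sigma_finiteT m.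
exists (fun i => @uncons_tuple n @^-1` (F i `*` G i)).
  rewrite -preimage_bigcup; apply/esym/seteqP; split => // x _ /=.
  have [i _ Fi] : (\bigcup_i F i) (uncons_tuple x).1 by rewrite -TF.
  have [j _ Gj] : (\bigcup_i G i) (uncons_tuple x).2 by rewrite -TG.
  exists (maxn i j) => //; split.
    by move: Fi; exact/subsetPset/ndF/leq_maxl.
  by move: Gj; exact/subsetPset/ndG/leq_maxr.
move=> i; have [mF Fi] := Foo i; have [mG Gi] := Goo i; split.
  rewrite -[_ @^-1` _]setTI; apply: measurable_uncons_tuple => //.
  exact: measurableX.
rewrite /pushforward -comp_preimage (_ : _ \o _ = id); last first.
  by apply/funext => x /=; rewrite cons_tupleK.
by rewrite preimage_id product_measure1E // lte_mul_pinfty // ge0_fin_numE.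
Qed.

Section step.
Variables (n : nat) (m : {sigma_finite_measure set (euclid R n) -> \bar R}).

Definition lebesgue_cons : set (euclid R n.+1) -> \bar R :=
  pushforward (lebesgue_measure \x m)%E (@cons_tuple n).

Let lebesgue_cons0 : lebesgue_cons set0 = 0%E.
Proof. by rewrite /lebesgue_cons /pushforward preimage_set0 measure0. Qed.

Let lebesgue_cons_ge0 A : (0 <= lebesgue_cons A)%E.
Proof. exact: (measure_ge0 (lebesgue_measure \x m)%E). Qed.

Let lebesgue_cons_sigma_additive : semi_sigma_additive lebesgue_cons.
Proof.
move=> F mF tF mUF; rewrite /lebesgue_cons /pushforward preimage_bigcup.
apply: measure_semi_sigma_additive.
- by move=> i; rewrite -[_ @^-1` _]setTI; exact: measurable_cons_tuple.
- apply/trivIsetP => i j _ _ ij; rewrite -preimage_setI.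
  by move/trivIsetP : tF => /(_ _ _ _ _ ij) ->//; rewrite preimage_set0.
- rewrite -preimage_bigcup -[_ @^-1` _]setTI.
  exact: measurable_cons_tuple.
Qed.

HB.instance Definition _ := isMeasure.Build _ _ _ lebesgue_cons
  lebesgue_cons0 lebesgue_cons_ge0 lebesgue_cons_sigma_additive.

HB.instance Definition _ := Measure_isSigmaFinite.Build _ _ _ lebesgue_cons
  (sigma_finite_cons_tuple m).

End step.

(* R^0 is a single point; R^(n+1) carries the product of the Lebesgue measures
   of R and R^n. *)
Fixpoint lebesgue n : {sigma_finite_measure set (euclid R n) -> \bar R} :=
  match n with
  | 0 => dirac ([tuple] : euclid R 0)
  | n'.+1 => lebesgue_cons (lebesgue n')
  end.

Lemma lebesgue_box n (A : 'I_n -> set (measurableTypeR R)) :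
  (forall i, measurable (A i)) ->
  lebesgue n [set x | forall i, A i (tnth x i)] =
  (\prod_(i < n) lebesgue_measure (A i))%E.
Proof.
elim: n => [|n IH] in A * => mA.
  rewrite big_ord0 /= diracE mem_set //; by case.
rewrite big_ord_recl -IH; last by move=> i; exact: mA.
rewrite /= /lebesgue_cons /pushforward -product_measure1E //; last first.
  have -> : [set x : euclid R n | forall i, A (lift ord0 i) (tnth x i)] =
      \bigcap_(i in [set: 'I_n]) ((@tnth _ _)^~ i @^-1` A (lift ord0 i)).
    by apply/seteqP; split => x /= xA i; [move=> _; exact: xA|exact: xA].
  apply: fin_bigcap_measurable; first exact: finite_finset.
  by move=> i _; rewrite -[_ @^-1` _]setTI; exact: measurable_tnth.
congr ((_ \x _)%E _); apply/seteqP; split=> -[a x] /=.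
  move=> H; split; first exact: (H ord0).
  by move=> i; move: (H (lift ord0 i)); rewrite tnthS.
move=> [Aa Ax] i; case: (unliftP ord0 i) => [j ->|-> //].
by rewrite tnthS; move: (Ax j); congr (A _ (tnth _ _)); apply: val_inj.
Qed.

End lebesgue_measure_on_tuples.

Section besov.
Context {R : realType} {d : nat}.
Implicit Types (f g : euclid R d -> R) (x h : euclid R d) (D : set (euclid R d)).

Definition unit_cube : set (euclid R d) :=
  [set x | forall i, 0 <= (tnth x i : R) < 1].

(* Only the values of f on D matter. *)
Definition Lnorm_on D (p : \bar R) f : \bar R :=
  Lnorm (lebesgue d) p (EFin \o (f \_ D)).

(* Elements of L_p are given by Borel representatives; every notion below is
   invariant under almost everywhere equality on the cube. *)
Definition in_Lp (p : R) f : Prop :=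
  measurable_fun unit_cube f /\ (Lnorm_on unit_cube p%:E f < +oo)%E.

Definition translate x (j : nat) h : euclid R d :=
  [tuple (tnth x i : R) + j%:R * tnth h i | i < d].

Definition difference (k : nat) h f x : R :=
  \sum_(j < k.+1) (-1) ^+ (k - j) * 'C(k, j)%:R * f (translate x j h).

Definition difference_dom (k : nat) h : set (euclid R d) :=
  [set x | forall j, (j <= k)%N -> unit_cube (translate x j h)].

Definition enorm h : R := Num.sqrt (\sum_(i < d) (tnth h i : R) ^+ 2).

Definition modulus_of_continuity (k : nat) (p t : R) f : \bar R :=
  ereal_sup [set Lnorm_on (difference_dom k h) p%:E (difference k h f)
            | h in [set h | enorm h <= t]].

Lemma exists_nat_gt (lambda : R) : exists n : nat, lambda < n%:R.
Proof.
by exists (Num.bound `|lambda|); apply: le_lt_trans (ler_norm _) (archi_boundP _).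
Qed.

Definition smoothness_order (lambda : R) : nat := ex_minn (exists_nat_gt lambda).

Definition besov_seminorm (p lambda : R) f : \bar R :=
  (\int[lebesgue_measure]_(t in `]0%R, 1%R[%classic)
    (modulus_of_continuity (smoothness_order lambda) p t f
     * ((t `^ lambda)^-1 * t^-1)%:E))%E.

Definition besov (p lambda : R) : set (euclid R d -> R) :=
  [set f | in_Lp p f /\ (besov_seminorm p lambda f < +oo)%E].

(* The code (j, a) stands for the cube 2^-j (Q^d + a). For d > 0 distinct codes
   stand for distinct cubes, so finite families of cubes are counted by their
   codes. *)
Definition dyadic_code := (nat * d.-tuple int)%type.

Definition dyadic_cube (K : dyadic_code) : set (euclid R d) :=
  [set [tuple 2 ^- K.1 * ((tnth x i : R) + (tnth K.2 i)%:~R) | i < d]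
  | x in unit_cube].

Definition dyadic_covering (Delta : {fset dyadic_code}) : Prop :=
  (forall K, K \in Delta -> dyadic_cube K `<=` unit_cube) /\
  unit_cube `<=` \bigcup_(K in [set` Delta]) dyadic_cube K.

(* msize is the total degree plus one, and 0 for the zero polynomial. *)
Definition polynomials (l : nat) : set (euclid R d -> R) :=
  [set P | exists2 q : mpoly.mpoly d R,
     (mpoly.msize q <= l.+1)%N & P = fun x => mpoly.meval (tnth x) q].

Definition piecewise_polynomials (l : nat) (Delta : {fset dyadic_code}) :
    set (euclid R d -> R) :=
  [set g | exists2 P : dyadic_code -> euclid R d -> R,
     forall K, K \in Delta -> polynomials l (P K) &
     g = fun x => \sum_(K <- Delta) P K x * \1_(dyadic_cube K) x].

End besov.

(* Main.v *)
From HB Require Import structures.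
Require Import Defs.
From mathcomp Require Import all_boot all_order all_algebra finmap.
From mathcomp Require mpoly.
Import -(notations) mpoly.
From mathcomp Require Import all_classical all_reals all_analysis.
From mathcomp Require Import measurable_realfun ess_sup_inf.
From mathcomp Require Import ring lra zify.

(* Each dyadic cube [K] carries the polynomial [P K] of degree less than [k]
   interpolating the means of [f] over subcells of [K]. Interpolation reproduces
   polynomials, so [P] changes from [K] to a child by at most the size [w K] of the
   mixed differences of order [k] of the means near [K]. Kemperman's identity turns
   mixed differences into pure ones, and Hoelder's inequality gives, for any set [S]
   of cubes of generation [j], that [w] sums over [S] to at most
   [#|S| ^ (1 - 1/p) * a j] with
   [a j = C * 2 ^ (j * lambda) * omega_k (2 ^- j.+1)], because [lambda = d / p].
   The sum over [j] of [a j] is bounded by the Besov seminorm; call the bound [A].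

   For a threshold [theta], going up from a deep generation [n] to the root, mark
   a cube, and forget its accumulated weight, when the largest weight of a
   descending path not crossing a marked cube exceeds [theta]. Following from each
   marked cube a heaviest such path gives disjoint paths of weight above [theta],
   with at most as many cubes in each generation as there are marked cubes. If [m]
   cubes are marked, then [theta * m < m ^ (1 - 1/p) * A], hence
   [m < (A / theta) ^ p]. The root and the children of the marked cubes are the
   required covering, and on each cube the approximant is the polynomial of the
   smallest one of these cubes containing it, up to an error [theta] and the tail
   of the sum of the [a j] over [j >= n], small for [n] large. *)

(** Functions of [L_p] have no point values, so the data are means over cells: by translation, a
    difference of means is an integral of a difference of [f]. The modulus only sees pure
    differences all of whose arguments stay in the unit cube. The steps produced by Kemperman's
    identity point towards the origin and have a bounded length in cell sides; placing the cells at
    an offset [b] inside their cube keeps every argument inside, so that [f] may be extended by zero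
    at no cost. The exponents fit as follows. A mean over a cell of generation about [j] carries the
    factor [2 ^ (j d)]; Hoelder's inequality on a union of [#|S|] such cells leaves [2 ^ (j d / p)],
    which is the weight of the Besov seminorm, and a power of [#|S|] with exponent below 1, which is
    what bounds the number of marked cubes. The cubes of the covering are nested, so the approximant
    is a telescoping sum of corrections. The local polynomials are controlled at every point, but
    they approach [f] only in the mean, whence the detour through an integral at the end. *)

Set Implicit Arguments.
Unset Strict Implicit.
Unset Printing Implicit Defensive.

Import Order.TTheory GRing.Theory Num.Theory.
Import numFieldNormedType.Exports.

Local Open Scope classical_set_scope.
Local Open Scope ring_scope.

(** * Newton interpolation of cell means *)

Section newton_univariate.
Context {R : realFieldType}.
Implicit Types (u : nat -> R) (p q : {poly R}).

Definition dif u : nat -> R := fun c => u c.+1 - u c.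

Lemma dif_iterS g u c : iter g.+1 dif u c = iter g dif u c.+1 - iter g dif u c.
Proof. by []. Qed.

Lemma newton_shift u c x :
  u (x + c)%N = \sum_(g < c.+1) 'C(c, g)%:R * iter g dif u x.
Proof.
elim: c x => [|c IH] x; first by rewrite big_ord1 bin0 mul1r addn0.
rewrite addnS -addSn IH.
have E (g : nat) : iter g dif u x.+1 = iter g dif u x + iter g.+1 dif u x.
  by rewrite dif_iterS addrC subrK.
under eq_bigr => g _ do rewrite E mulrDr.
rewrite big_split /= [in RHS]big_ord_recl bin0.
under [in RHS]eq_bigr => g _ do rewrite lift0 binS natrD mulrDl.
rewrite big_split /= addrA; congr (_ + _).
rewrite [in LHS]big_ord_recl bin0 [X in _ = _ + X]big_ord_recr /= bin_small // mul0r addr0.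
by [].
Qed.

Lemma newton_nat u M c : (c <= M)%N ->
  u c = \sum_(g < M.+1) 'C(c, g)%:R * iter g dif u 0%N.
Proof.
move=> cM; rewrite -[c in LHS]add0n newton_shift.
rewrite (big_ord_widen M.+1 (fun g => 'C(c, g)%:R * iter g dif u 0%N)) //.
rewrite big_mkcond /=; apply: eq_bigr => g _.
by case: ltnP => // cg; rewrite bin_small ?mul0r.
Qed.

(** The binomial coefficient of [X] over [g] as a polynomial, [X (X - 1) ... (X - g + 1) / g!]. The
    lock keeps simplification from unfolding the product. *)
Definition binp (g : nat) : {poly R} :=
  locked ((g`!%:R)^-1 *: \prod_(i < g) ('X - i%:R%:P)).

Lemma binp0 : binp 0 = 1.
Proof. by rewrite /binp -lock big_ord0 fact0 invr1 scale1r. Qed.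

Lemma size_binp g : (size (binp g) <= g.+1)%N.
Proof.
rewrite /binp -lock; apply: leq_trans (size_scale_leq _ _) _.
by rewrite size_prod_XsubC /index_enum -enumT size_enum_ord.
Qed.

Lemma binp_nat g c : (binp g).[c%:R] = 'C(c, g)%:R.
Proof.
rewrite /binp -lock hornerZ horner_prod.
apply: (mulfI (x := g`!%:R)); first by rewrite pnatr_eq0 -lt0n fact_gt0.
rewrite mulrA mulfV ?mul1r ?pnatr_eq0 -?lt0n ?fact_gt0 //.
rewrite -natrM mulnC bin_ffact.
elim: g => [|g IH]; first by rewrite big_ord0 ffactn0.
rewrite big_ord_recr /= IH ffactnSr natrM hornerXsubC.
case: (leqP g c) => gc; first by rewrite natrB.
by rewrite ffact_small // !mul0r.
Qed.

Lemma poly_eq_nat n p q : (size p <= n)%N -> (size q <= n)%N ->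
  (forall c, (c < n)%N -> p.[c%:R] = q.[c%:R]) -> p = q.
Proof.
move=> sp sq pq; apply/eqP; rewrite -subr_eq0; apply/eqP.
apply: (@roots_geq_poly_eq0 _ _ [seq (i%:R : R) | i <- iota 0 n]).
- apply/allP => _ /mapP[c + ->]; rewrite mem_iota /= add0n => cn.
  by rewrite /root hornerD hornerN pq // subrr.
- rewrite map_inj_uniq ?iota_uniq // => i j /eqP.
  by rewrite eqr_nat => /eqP.
- rewrite size_map size_iota; apply: leq_trans (size_polyD _ _) _.
  by rewrite size_polyN geq_max sp sq.
Qed.

Lemma newton_poly n p : (size p <= n)%N ->
  p = \sum_(g < n) iter g dif (fun c => p.[c%:R]) 0%N *: binp g.
Proof.
case: n => [|n] sp.
  by rewrite big_ord0; apply/eqP; rewrite -size_poly_eq0 -leqn0.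
apply: (@poly_eq_nat n.+1) => // [|c cn].
  apply: leq_trans (size_sum _ _ _) _; apply/bigmax_leqP => g _.
  exact: leq_trans (size_scale_leq _ _) (leq_trans (size_binp _) (ltn_ord g)).
rewrite horner_sum (newton_nat (fun c => p.[c%:R]) (M := n)) //.
by apply: eq_bigr => g _; rewrite hornerZ binp_nat mulrC.
Qed.

Lemma iter_dif_poly0 g p : (size p <= g)%N ->
  iter g dif (fun c => p.[c%:R]) 0%N = 0.
Proof.
move=> sp; have := newton_poly (leqW sp); rewrite big_ord_recr /=.
rewrite -newton_poly // -[X in X = _]addr0 => /addrI /esym /(congr1 (horner^~ g%:R)).
by rewrite hornerZ binp_nat binn mulr1 horner0.
Qed.

(** By Pascal's rule the integral of [phi g] over [[c, c + 1]] is ['C(c, g)]: for cell means, the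
    [phi g] play the role of the Newton basis. *)
Definition phi g := (binp g.+1)^`().

Lemma size_phi g : (size (phi g) <= g.+1)%N.
Proof.
rewrite /phi; have [->|b0] := eqVneq (binp g.+1) 0.
  by rewrite deriv0 size_poly0.
by rewrite -ltnS (leq_trans (lt_size_deriv b0)) // size_binp.
Qed.

Definition block_mean r o u : nat -> R :=
  fun c => r%:R^-1 * \sum_(s < r) u (o + r * c + s)%N.

(** Hockey-stick summation: the sum of ['C(n + s, e)] over [s < r] telescopes to a difference of
    binomial coefficients of order [e + 1]. *)
Lemma block_mean_bin r o e c : (0 < r)%N ->
  block_mean r o (fun c => 'C(c, e)%:R) c =
  r%:R^-1 * dif (fun c => ((binp e.+1) \Po (o%:R%:P + r%:R *: 'X)).[c%:R]) c.
Proof.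
move=> r0; rewrite /block_mean /dif !horner_comp.
have E n : (o%:R%:P + r%:R *: 'X).[n%:R] = (o + r * n)%:R :> R.
  by rewrite hornerD hornerC hornerZ hornerX natrD natrM.
rewrite !E !binp_nat mulnSr addnA; congr (_ * _).
elim: r {r0 E} (_ + _)%N => [|r IH] n; first by rewrite big_ord0 addn0 subrr.
rewrite big_ord_recr /= IH addnS binS natrD; ring.
Qed.

Lemma size_comp_affine e r o :
  (size ((binp e.+1) \Po (o%:R%:P + r%:R *: 'X))%R <= e.+2)%N.
Proof.
apply: leq_trans (size_comp_poly_leq _ _) _.
have sa : (size (o%:R%:P + r%:R *: 'X : {poly R})%R <= 2)%N.
  apply: leq_trans (size_polyD _ _) _; rewrite geq_max.
  rewrite (leq_trans (size_polyC_leq1 _)) //.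
  by rewrite (leq_trans (size_scale_leq _ _)) // size_polyX.
rewrite ltnS; apply: leq_trans (leq_mul (leqnn _) (_ : _ <= 1)%N) _.
  by rewrite -ltnS; case: (size _) sa.
by rewrite muln1; have := size_binp e.+1; case: (size _).
Qed.

Lemma iter_dif_block_mean r o e g : (0 < r)%N ->
  iter g dif (block_mean r o (fun c => 'C(c, e)%:R)) 0%N =
  r%:R^-1 * iter g.+1 dif
    (fun c => ((binp e.+1) \Po (o%:R%:P + r%:R *: 'X)).[c%:R]) 0%N.
Proof.
move=> r0; rewrite iterSr; set v := dif _.
elim: g 0%N => [|g IH] c /=; first by rewrite block_mean_bin.
by rewrite /dif -/dif !IH mulrBr.
Qed.

Lemma iter_dif_block_mean0 r o e g : (0 < r)%N -> (e < g)%N ->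
  iter g dif (block_mean r o (fun c => 'C(c, e)%:R)) 0%N = 0.
Proof.
move=> r0 eg; rewrite iter_dif_block_mean // iter_dif_poly0 ?mulr0 //.
exact: leq_trans (size_comp_affine _ _ _) _.
Qed.

(** The Newton expansion of [q], whose derivative divided by [r] is the rescaled [phi e], is
    differentiated: the constant term disappears, and the term of order [g + 1] becomes [phi g]
    times the [g]-th difference of the block means. *)
Lemma block_mean_reproduction r o e k (xi : R) : (0 < r)%N -> (e < k)%N ->
  \sum_(g < k) iter g dif (block_mean r o (fun c => 'C(c, e)%:R)) 0%N *
     (phi g).[xi] = (phi e).[o%:R + r%:R * xi].
Proof.
move=> r0 ek.
set q := (binp e.+1) \Po (o%:R%:P + r%:R *: 'X).
have sq : (size q <= k.+1)%N by exact: leq_trans (size_comp_affine _ _ _) _.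
have := congr1 (fun p => r%:R^-1 * p^`().[xi]) (newton_poly sq).
rewrite {1}/q deriv_comp derivD derivC add0r derivZ derivX alg_polyC.
have E : (o%:R%:P + r%:R *: 'X).[xi] = o%:R + r%:R * xi.
  by rewrite hornerD hornerC hornerZ hornerX.
rewrite hornerM hornerC horner_comp E mulrC mulfK ?pnatr_eq0 -?lt0n // => ->.
rewrite big_ord_recl derivD hornerD derivZ binp0 -[X in X^`()]/(1%:P) derivC scaler0.
rewrite horner0 add0r linear_sum horner_sum mulr_sumr; apply: eq_bigr => g _.
by rewrite /= derivZ hornerZ mulrA iter_dif_block_mean.
Qed.

End newton_univariate.

Section newton_multivariate.
Context {R : realFieldType} {I : finType}.
Implicit Types (F G : (I -> nat) -> R) (c : I -> nat) (w : seq I).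

Definition step (i : I) c : I -> nat := fun j => (c j + (j == i))%N.

(** Iterated forward difference in the directions listed by a word. Unlike a multi-index, a word can
    be cut anywhere, which isolates a difference of order [k] inside one of higher order. *)
Fixpoint wdif w F : (I -> nat) -> R :=
  if w is i :: w' then fun c => wdif w' F (step i c) - wdif w' F c else F.

Lemma wdif_cat w1 w2 F : wdif (w1 ++ w2) F = wdif w1 (wdif w2 F).
Proof. by elim: w1 => //= i w1 ->. Qed.

Lemma wdif_sum (T : Type) (s : seq T) (a : T -> R) (G : T -> (I -> nat) -> R) w c :
  wdif w (fun c => \sum_(t <- s) a t * G t c) c = \sum_(t <- s) a t * wdif w (G t) c.
Proof.
elim: w c => [|i w IH] c //=; rewrite !IH -sumrB.
by apply: eq_bigr => t _; rewrite mulrBr.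
Qed.

Lemma wdifB w F G c : wdif w (fun c => F c - G c) c = wdif w F c - wdif w G c.
Proof. by elim: w c => [|i w IH] c //=; rewrite !IH; ring. Qed.

Lemma wdif_prod (u : I -> nat -> R) w c :
  wdif w (fun c => \prod_i u i (c i)) c =
  \prod_i iter (count_mem i w) dif (u i) (c i).
Proof.
elim: w c => [|i w IH] c //=; rewrite !IH.
rewrite (bigD1 i) //= [X in _ - X](bigD1 i) //= [RHS](bigD1 i) //=.
rewrite /step eqxx addn1 /= {1}/dif mulrBl; congr (_ * _ - _ * _).
  by apply: eq_bigr => j /negPf ji; rewrite ji addn0 eq_sym ji.
by apply: eq_bigr => j /negPf ji; rewrite eq_sym ji.
Qed.

Lemma wdif_le w F c (B : R) :
  (forall c', (forall i, c i <= c' i <= c i + count_mem i w)%N -> `|F c'| <= B) ->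
  `|wdif w F c| <= 2 ^+ size w * B.
Proof.
elim: w c => [|i w IH] c FB /=.
  by rewrite expr0 mul1r FB // => i; rewrite leqnn leq_addr.
apply: le_trans (ler_normB _ _) _.
rewrite exprS -mulrA mulr_natl mulr2n; apply: lerD; apply: IH => c' c'P; apply: FB => j.
  by move: (c'P j); rewrite /step /= (eq_sym i); lia.
by move: (c'P j); rewrite /=; lia.
Qed.

Definition word (g : I -> nat) : seq I := flatten [seq nseq (g i) i | i <- enum I].

Lemma count_word g i : count_mem i (word g) = g i.
Proof.
rewrite /word count_flatten -map_comp sumnE big_map big_enum /= (bigD1 i) //=.
rewrite count_nseq /= eqxx mul1n big1 ?addn0 // => j /negPf ji.
by rewrite count_nseq /= ji.
Qed.

Lemma size_word g : size (word g) = (\sum_i g i)%N.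
Proof.
rewrite /word size_flatten /shape -map_comp sumnE big_map big_enum /=.
by apply: eq_bigr => i _; rewrite size_nseq.
Qed.

Definition ncoord n (g : {ffun I -> 'I_n}) : I -> nat := fun i => g i.

Definition mdif (g : I -> nat) F : R := wdif (word g) F (fun=> 0%N).

Lemma mdif_prod g (u : I -> nat -> R) :
  mdif g (fun c => \prod_i u i (c i)) = \prod_i iter (g i) dif (u i) 0%N.
Proof. by rewrite /mdif wdif_prod; apply: eq_bigr => i _; rewrite count_word. Qed.

Lemma mdif_le g F (B : R) : (forall c, (forall i, c i <= g i)%N -> `|F c| <= B) ->
  `|mdif g F| <= 2 ^+ (\sum_i g i)%N * B.
Proof.
move=> FB; rewrite -size_word; apply: wdif_le => c cg; apply: FB => i.
by move: (cg i); rewrite add0n count_word => /andP[].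
Qed.

Lemma mdif_eq M g F G : (forall i, g i <= M)%N ->
  (forall c, (forall i, c i <= M)%N -> F c = G c) -> mdif g F = mdif g G.
Proof.
move=> gM FG; apply/eqP; rewrite -subr_eq0 -normr_le0 /mdif -wdifB.
rewrite -[X in _ <= X](mulr0 (2 ^+ (\sum_i g i)%N)); apply: mdif_le => c cg.
by rewrite FG ?subrr ?normr0 // => i; apply: leq_trans (cg i) (gM i).
Qed.

(** Both sides are linear in [F], and on the box [F] is a combination of products of Kronecker
    deltas; for such a product the univariate Newton formulas multiply out. *)
Lemma newton_expansion M F c : (forall i, c i <= M)%N ->
  F c = \sum_(g : {ffun I -> 'I_M.+1})
    mdif (ncoord g) F * \prod_i 'C(c i, g i)%:R.
Proof.
move=> cM.
pose delta (b : nat) : nat -> R := fun n => (n == b)%:R.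
have FE c' : (forall i, c' i <= M)%N ->
    F c' = \sum_(b : {ffun I -> 'I_M.+1}) F (ncoord b) * \prod_i delta (b i) (c' i).
  move=> c'M; pose b0 : {ffun I -> 'I_M.+1} := [ffun i => inord (c' i)].
  have b0E i : b0 i = c' i :> nat by rewrite ffunE inordK // ltnS.
  have nb0 : ncoord b0 = c' by apply/funext => i; rewrite /ncoord b0E.
  rewrite (bigD1 b0) //= nb0.
  rewrite big1 ?mulr1; last by move=> i _; rewrite /delta b0E eqxx.
  rewrite big1 ?addr0 // => b bb0.
  have [i bi] : exists i, b i != b0 i.
    apply/existsP; rewrite -negb_forall; apply: contra bb0 => /forallP bb.
    by apply/eqP/ffunP => i; apply/eqP.
  by rewrite (bigD1 i) //= /delta -b0E (inj_eq val_inj) eq_sym (negPf bi) mul0r mulr0.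
have mE g : (forall i, g i <= M)%N -> mdif g F =
    \sum_(b : {ffun I -> 'I_M.+1}) F (ncoord b) * \prod_i iter (g i) dif (delta (b i)) 0%N.
  move=> gM; rewrite (mdif_eq gM FE) /mdif wdif_sum; apply: eq_bigr => b _.
  by congr (_ * _); apply: mdif_prod.
rewrite {1}FE //.
have gM (g : {ffun I -> 'I_M.+1}) i : (ncoord g i <= M)%N by exact: (ltn_ord (g i)).
transitivity (\sum_(g : {ffun I -> 'I_M.+1}) \sum_(b : {ffun I -> 'I_M.+1})
    F (ncoord b) * (\prod_i (iter (g i) dif (delta (b i)) 0%N * 'C(c i, g i)%:R))); last first.
  apply: eq_bigr => g _; rewrite (mE _ (gM g)) mulr_suml.
  by apply: eq_bigr => b _; rewrite big_split mulrA.
rewrite exchange_big /=; apply: eq_bigr => b _.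
rewrite -mulr_sumr; congr (_ * _).
rewrite -(bigA_distr_bigA (fun i (e : 'I_M.+1) =>
  iter e dif (delta (b i)) 0%N * 'C(c i, e)%:R)) /=.
apply: eq_bigr => i _; rewrite (newton_nat _ (cM i)).
by apply: eq_bigr => e _; rewrite mulrC.
Qed.

End newton_multivariate.

Section interpolation.
Context {R : realFieldType} {I : finType}.
Implicit Types (F G : (I -> nat) -> R) (c o : I -> nat) (xi : I -> R).

(** The polynomial of total degree less than [k] whose mean over the unit cell at [c] is [F c] for
    all [c] of coordinate sum less than [k]: the product of the [phi (g i)] has mean
    [\prod_i 'C(c i, g i)], which vanishes unless [g <= c]. *)
Definition interp k F xi : R :=
  \sum_(g : {ffun I -> 'I_k} | (\sum_i g i < k)%N)
    mdif (ncoord g) F * \prod_i (phi (g i)).[xi i].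

(** Means over blocks with [r] cells in each direction, starting at position [o]. The value [r = 1]
    is a mere translation and serves for a child; [r = 2] coarsens the grid and serves for the
    parent. *)
Definition block r o F c : R :=
  (r%:R^-1) ^+ #|I| *
  \sum_(s : {ffun I -> 'I_r}) F (fun i => o i + r * c i + s i)%N.

Definition binprod (e : I -> nat) c : R := \prod_i 'C(c i, e i)%:R.

Lemma interp_sum (T : Type) (s : seq T) (a : T -> R) (G : T -> (I -> nat) -> R) k xi :
  interp k (fun c => \sum_(t <- s) a t * G t c) xi = \sum_(t <- s) a t * interp k (G t) xi.
Proof.
rewrite /interp.
under [LHS]eq_bigr do rewrite /mdif wdif_sum mulr_suml.
rewrite exchange_big /=; apply: eq_bigr => t _.
by rewrite mulr_sumr; apply: eq_bigr => g _; rewrite mulrA.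
Qed.

Lemma interpB k F G xi : interp k (fun c => F c - G c) xi = interp k F xi - interp k G xi.
Proof.
by rewrite /interp -sumrB; apply: eq_bigr => g _; rewrite /mdif wdifB mulrBl.
Qed.

Lemma block_sum (T : Type) (s : seq T) (a : T -> R) (G : T -> (I -> nat) -> R) r o c :
  block r o (fun c => \sum_(t <- s) a t * G t c) c = \sum_(t <- s) a t * block r o (G t) c.
Proof.
rewrite /block exchange_big /= mulr_sumr; apply: eq_bigr => t _.
by rewrite -mulr_sumr mulrCA.
Qed.

Lemma block1 F : block 1 (fun=> 0%N) F = F.
Proof.
apply/funext => c; rewrite /block invr1 expr1n mul1r.
rewrite (big_pred1 [ffun=> ord0]) => [|s]; last first.
  by apply/esym/eqP/ffunP => i; rewrite ffunE [s i]ord1.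
by congr F; apply/funext => i; rewrite ffunE add0n mul1n addn0.
Qed.

Lemma horner_le (p : {poly R}) (X x : R) : `|x| <= X ->
  `|p.[x]| <= \sum_(j < size p) `|p`_j| * X ^+ j.
Proof.
move=> xX; rewrite horner_coef; apply: le_trans (ler_norm_sum _ _ _) _.
apply: ler_sum => j _; rewrite normrM ler_wpM2l // normrX.
by rewrite lerXn2r // ?nnegrE // (le_trans _ xX).
Qed.

Lemma interp_le k M (X : R) : (k <= M.+1)%N -> 0 <= X ->
  exists2 C : R, 0 <= C & forall F xi (B : R),
  (forall c, (forall i, c i <= M)%N -> `|F c| <= B) -> (forall i, `|xi i| <= X) ->
  `|interp k F xi| <= C * B.
Proof.
move=> kM X0.
pose pb e : R := \sum_(j < size (phi e : {poly R})) `|(phi e)`_j| * X ^+ j.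
have pb0 e : 0 <= pb e by apply: sumr_ge0 => j _; rewrite mulr_ge0 // exprn_ge0.
exists (\sum_(g : {ffun I -> 'I_k} | (\sum_i g i < k)%N)
    2 ^+ (\sum_i g i)%N * \prod_i pb (g i)).
  by apply: sumr_ge0 => g _; rewrite mulr_ge0 ?exprn_ge0 ?prodr_ge0.
move=> F xi B FB xiX; rewrite mulr_suml.
apply: le_trans (ler_norm_sum _ _ _) _; apply: ler_sum => g _.
rewrite normrM mulrAC; apply: ler_pM => //.
  apply: mdif_le => c cg; apply: FB => i.
  by rewrite -ltnS (leq_ltn_trans (cg i)) // (leq_trans (ltn_ord _)).
by rewrite normr_prod; apply: ler_prod => i _; rewrite normr_ge0 horner_le.
Qed.

Lemma interp_eq k M F G xi : (k <= M.+1)%N ->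
  (forall c, (forall i, c i <= M)%N -> F c = G c) -> interp k F xi = interp k G xi.
Proof.
move=> kM FG; apply: eq_bigr => g _; congr (_ * _).
apply: (mdif_eq (M := M)) => // i.
by rewrite -ltnS (leq_trans (ltn_ord (g i))).
Qed.

Lemma block_binprod r o e c :
  block r o (binprod e) c =
  \prod_i block_mean r (o i) (fun n => 'C(n, e i)%:R) (c i).
Proof.
rewrite /block /binprod.
rewrite -(bigA_distr_bigA (fun i (s : 'I_r) => 'C(o i + r * c i + s, e i)%:R)) /=.
by rewrite /block_mean big_split /= prodr_const.
Qed.

(** Multiplying the univariate formulas gives a sum over all [g], whereas [interp] stops at order
    [k]. The other terms vanish: their order exceeds that of [e], so [e i < g i] for some [i], and a
    difference of order [g i] kills a polynomial of degree [e i]. *)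
Lemma interp_block_binprod k r o e xi : (0 < r)%N -> (\sum_i e i < k)%N ->
  interp k (block r o (binprod e)) xi =
  \prod_i (phi (e i)).[(o i)%:R + r%:R * xi i].
Proof.
move=> r0 ek.
have eik i : (e i < k)%N.
  by apply: leq_ltn_trans ek; rewrite (bigD1 i) //= leq_addr.
under [RHS]eq_bigr do rewrite -(block_mean_reproduction _ _ r0 (eik _)).
rewrite bigA_distr_bigA /= /interp big_mkcond /=; apply: eq_bigr => g _.
have -> : block r o (binprod e) =
    fun c => \prod_i block_mean r (o i) (fun n => 'C(n, e i)%:R) (c i).
  by apply/funext => c; rewrite block_binprod.
rewrite (mdif_prod _ (fun i => block_mean r (o i) _)) big_split /=; case: ifPn => // gk.
have [i ig] : exists i, (e i < g i)%N.
  apply/existsP; apply: contraR gk => /existsPn ge.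
  by apply: leq_ltn_trans ek; apply: leq_sum => i _; rewrite leqNgt.
by rewrite (bigD1 i) //= iter_dif_block_mean0 // !mul0r.
Qed.

(** The word is cut before its last [k] letters. These give a difference of order [k], bounded by
    [E] on the box, and each remaining letter at most doubles the bound. *)
Lemma mdif_high_le M k g F (E : R) :
  (forall i, g i <= M)%N -> (k <= \sum_i g i)%N ->
  (forall w c, size w = k -> (forall i, c i <= M)%N -> `|wdif w F c| <= E) ->
  `|mdif g F| <= 2 ^+ (#|I| * M)%N * E.
Proof.
move=> gM kg FE; have E0 : 0 <= E.
  apply: le_trans (normr_ge0 _) (FE (take k (word g)) (fun=> 0%N) _ _) => //.
  by rewrite size_takel // size_word.
pose s := (\sum_i g i - k)%N.
rewrite /mdif -(cat_take_drop s (word g)) wdif_cat.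
apply: le_trans (wdif_le (B := E) _) _ => [c cP|].
  apply: FE => [|i]; first by rewrite size_drop size_word /s subKn.
  have /andP[_ ci] := cP i; apply: leq_trans ci _; rewrite add0n.
  apply: leq_trans _ (gM i); rewrite -(count_word g i).
  by rewrite -[X in (_ <= count_mem _ X)%N](cat_take_drop s) count_cat leq_addr.
apply: ler_wpM2r => //; rewrite ler_eXn2l ?ltr1n //.
rewrite size_takel; last by rewrite size_word leq_subr.
apply: leq_trans (leq_subr _ _) _; rewrite -sum_nat_const.
by apply: leq_sum => i _; exact: gM.
Qed.

Lemma binprod_le M e c : (forall i, c i <= M)%N -> `|binprod e c| <= (2 ^ M)%:R ^+ #|I|.
Proof.
move=> cM; rewrite ger0_norm ?prodr_ge0 // -prodr_const.
apply: ler_prod => i _; rewrite ler0n ler_nat /=.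
have [ec|ce] := leqP (e i) (c i); last by rewrite bin_small.
apply: leq_trans (_ : 2 ^ c i <= _)%N; last by rewrite leq_exp2l.
have /= := expnDn 1 1 (c i); rewrite addn1 => ->.
have ec' : (e i < (c i).+1)%N by [].
by rewrite (bigD1 (Ordinal ec')) //= !exp1n !muln1 leq_addr.
Qed.

Lemma block_le M r o F (B : R) : (0 < r)%N ->
  (forall c, (forall i, c i <= M)%N -> `|F c| <= B) ->
  forall c, (forall i, o i + r * c i + r.-1 <= M)%N -> `|block r o F c| <= B.
Proof.
move=> r0 FB c cM; rewrite /block normrM.
rewrite ger0_norm ?exprn_ge0 ?invr_ge0 // exprVn mulrC ler_pdivrMr ?exprn_gt0 ?ltr0n //.
rewrite (_ : B * _ = \sum_(s : {ffun I -> 'I_r}) B); last first.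
  by rewrite sumr_const card_ffun card_ord -[RHS]mulr_natr natrX.
apply: le_trans (ler_norm_sum _ _ _) _; apply: ler_sum => s _; apply: FB => i.
apply: leq_trans (cM i); rewrite leq_add2l -ltnS prednK //; exact: ltn_ord.
Qed.

(* Both sides reproduce polynomials of degree less than [k], so only the terms
   of order at least [k] of the Newton expansion of [F] contribute. *)
Lemma interp_block_close k M r (X : R) : (k <= M.+1)%N -> (0 < r)%N -> 0 <= X ->
  exists2 C : R, 0 <= C & forall F (E : R) o xi, 0 <= E ->
  (forall w c, size w = k -> (forall i, c i <= M)%N -> `|wdif w F c| <= E) ->
  (forall i, o i + r * k.-1 + r.-1 <= M)%N ->
  (forall i, `|xi i| <= X) -> (forall i, `|(o i)%:R + r%:R * xi i| <= X) ->
  `|interp k (block r o F) xi - interp k F (fun i => (o i)%:R + r%:R * xi i)|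
    <= C * E.
Proof.
move=> kM r0 X0.
have [C1 C10 C1P] := interp_le (leqSpred k) X0.
have [C2 C20 C2P] := interp_le kM X0.
pose P2 : R := (2 ^ M)%:R ^+ #|I|.
have P20 : 0 <= P2 by rewrite exprn_ge0.
exists (\sum_(g : {ffun I -> 'I_M.+1}) 2 ^+ (#|I| * M)%N * (C1 * P2 + C2 * P2)).
  by apply: sumr_ge0 => g _; rewrite !mulr_ge0 ?exprn_ge0 ?addr_ge0 ?mulr_ge0.
move=> F E o xi E0 FE oM xiX oxiX.
set zeta := fun i => _ + _.
pose F' c := \sum_(g : {ffun I -> 'I_M.+1}) mdif (ncoord g) F * binprod (ncoord g) c.
have FF' c : (forall i, c i <= M)%N -> F c = F' c by exact: newton_expansion.
rewrite (interp_eq _ kM FF').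
rewrite (interp_eq (G := block r o F') (M := k.-1) _ (leqSpred k)); last first.
  move=> c ck; rewrite /block; congr (_ * _); apply: eq_bigr => s _; apply: FF' => i.
  apply: leq_trans (oM i); apply: leq_add; first by rewrite leq_add2l leq_mul2l ck orbT.
  by rewrite -ltnS prednK.
rewrite (_ : block r o F' = fun c => \sum_(g : {ffun I -> 'I_M.+1})
    mdif (ncoord g) F * block r o (binprod (ncoord g)) c); last first.
  by apply/funext => c; rewrite block_sum.
rewrite !interp_sum -sumrB mulr_suml.
apply: le_trans (ler_norm_sum _ _ _) _; apply: ler_sum => g _.
rewrite -mulrBr normrM.
have gM i : (ncoord g i <= M)%N by exact: (ltn_ord (g i)).
have [gk|kg] := ltnP (\sum_i ncoord g i) k.
  (* The second interpolant is seen as one of blocks with [r = 1] and offset zero, so that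
     reproduction yields the same product on both sides. *)
  rewrite interp_block_binprod // -[X in _ - interp _ X _]block1 interp_block_binprod //.
  rewrite (_ : _ - _ = 0) ?normr0 ?mulr0; last first.
    apply/eqP; rewrite subr_eq0; apply/eqP. apply: eq_bigr => i _.
    by rewrite add0r mul1r.
  by rewrite !mulr_ge0 ?exprn_ge0 ?addr_ge0 ?mulr_ge0.
rewrite mulrAC; apply: ler_pM => //; first exact: (mdif_high_le gM kg FE).
apply: le_trans (ler_normB _ _) _; apply: lerD.
  apply: C1P => // c ck; apply: (block_le r0 (M := M)) => [c' c'M|i].
    exact: binprod_le.
  by apply: leq_trans (oM i); rewrite leq_add2r leq_add2l leq_mul2l ck orbT.
by apply: C2P => // c cM; exact: binprod_le.
Qed.

End interpolation.

(** * Mixed differences by pure differences *)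

Section kemperman.
Context {R : realFieldType} {V : lmodType R}.
Implicit Types (Phi : V -> R) (x : V) (hs : seq V) (s : seq bool).

Fixpoint vdif hs Phi : V -> R :=
  if hs is h :: hs' then fun x => vdif hs' Phi (x + h) - vdif hs' Phi x else Phi.

Fixpoint bits n : seq (seq bool) :=
  if n is n'.+1 then map (cons true) (bits n') ++ map (cons false) (bits n')
  else [:: [::]].

Fixpoint osum s hs : V :=
  match s, hs with
  | b :: s', h :: hs' => (if b then h else 0) + osum s' hs'
  | _, _ => 0
  end.

Lemma vdif_expand hs Phi x :
  vdif hs Phi x =
  \sum_(s <- bits (size hs)) (-1) ^+ (count negb s) * Phi (x + osum s hs).
Proof.
elim: hs x => [|h hs IH] x /=; first by rewrite big_seq1 /= mul1r addr0.
rewrite !IH big_cat !big_map -sumrN /=; congr (_ + _); apply: eq_bigr => s _ /=.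
  by rewrite add0n addrA.
by rewrite add0r exprS mulN1r mulNr.
Qed.

Lemma vdif_zero hs Phi x : 0 \in hs -> vdif hs Phi x = 0.
Proof.
elim: hs x => //= h hs IH x; rewrite inE => /predU1P[<-|h0].
  by rewrite addr0 subrr.
by rewrite !IH // subrr.
Qed.

Lemma osum_map_lin (T : Type) (t : seq T) (a b : T -> V) (j : R) s :
  osum s [seq a i - j *: b i | i <- t] =
  osum s [seq a i | i <- t] - j *: osum s [seq b i | i <- t].
Proof.
elim: s t => [|e s IH] [|u t] /=; rewrite ?scaler0 ?subr0 // IH.
case: e; rewrite ?add0r // scalerDr; set A := osum _ _; set B := osum _ _.
by rewrite opprD addrACA.
Qed.

(** The vectors [h_i / i], with [i] counted from 1. In Kemperman's identity the pure step attached
    to a subset [s] is minus the sum of those selected by [s]. *)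
Definition harmonic hs := [seq i.+1%:R^-1 *: nth 0 hs i | i <- iota 0 (size hs)].

(* Replacing each [h_i] by [(1 - j/i) h_i] in the expanded mixed difference
   leaves only the term [j = 0]: the other ones contain a zero step. *)
Lemma kemperman hs Phi x (k := size hs) :
  (-1) ^+ k * vdif hs Phi x =
  \sum_(s <- bits k) (-1) ^+ (count negb s) *
    \sum_(j < k.+1) (-1) ^+ (k - j) * 'C(k, j)%:R *
      Phi (x + osum s hs + j%:R *: - osum s (harmonic hs)).
Proof.
pose hsj (j : nat) :=
  [seq nth 0 hs i - j%:R *: (i.+1%:R^-1 *: nth 0 hs i) | i <- iota 0 k].
have szj j : size (hsj j) = k by rewrite size_map size_iota.
have hs0 : hsj 0%N = hs.
  rewrite /hsj -[RHS](mkseq_nth 0); apply: eq_map => i.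
  by rewrite scale0r subr0.
transitivity (\sum_(j < k.+1) (-1) ^+ (k - j) * 'C(k, j)%:R * vdif (hsj j) Phi x).
  rewrite big_ord_recl big1 ?addr0 => [|j _]; first by rewrite subn0 bin0 mulr1 hs0.
  rewrite vdif_zero ?mulr0 //; apply/mapP; exists (j : nat).
    by rewrite mem_iota /= add0n.
  by rewrite lift0 scalerA mulfV ?pnatr_eq0 // scale1r subrr.
under eq_bigr => j _ do rewrite vdif_expand szj mulr_sumr.
rewrite exchange_big /=; apply: eq_bigr => s _.
rewrite mulr_sumr; apply: eq_bigr => j _.
rewrite osum_map_lin -/(harmonic hs) mulrCA scalerN addrA.
by rewrite (_ : [seq nth 0 hs i | i <- iota 0 k] = hs) // -[RHS](mkseq_nth 0).
Qed.

Lemma wdif_vdif (I : finType) (w : seq I) (e : I -> V) (iota : (I -> nat) -> V) Phi c :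
  (forall i c, iota (step i c) = iota c + e i) ->
  wdif w (fun c => Phi (iota c)) c = vdif (map e w) Phi (iota c).
Proof. by move=> iotaE; elim: w c => //= i w IH c; rewrite !IH iotaE. Qed.

End kemperman.

(** * Greedy marking of a weighted tree *)

Section weighted_tree.
Context {R : realFieldType} {T : eqType} {C : finType}.
Variables (child : T -> C -> T) (root : T) (k0 : C) (w : T -> R) (theta : R).
Hypothesis child_inj : forall K K' a b, child K a = child K' b -> K = K' /\ a = b.
Hypothesis theta0 : 0 <= theta.

Fixpoint level j : seq T :=
  if j is j'.+1 then [seq child K a | K <- level j', a <- enum C] else [:: root].

Lemma uniq_level j : uniq (level j).
Proof.
elim: j => //= j IH; apply: allpairs_uniq => //; first exact: enum_uniq.
by move=> [K a] [K' b] _ _ /= /child_inj[-> ->].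
Qed.

Definition cut (r : R) := if theta < r then 0 else r.

Lemma cut_le r : cut r <= theta.
Proof. by rewrite /cut; case: ltP. Qed.

(* The largest weight of a descending path of length [h] from [K] that stops
   above the first node whose own residual exceeds [theta]. *)
Fixpoint residual h K : R :=
  if h is h'.+1 then
    let r a := cut (residual h' (child K a)) in
    w K + r [arg max_(a > k0) r a]%O
  else 0.

Definition best h K : C := [arg max_(a > k0) cut (residual h (child K a))]%O.

Lemma residualS h K :
  residual h.+1 K = w K + cut (residual h (child K (best h K))).
Proof. by []. Qed.

Lemma residual_ge h K a : w K + cut (residual h (child K a)) <= residual h.+1 K.
Proof.
rewrite residualS lerD2l /best.
by case: arg_maxP => // b _; apply.
Qed.

Variable n : nat.

Definition bad j K := theta < residual (n - j) K.

Definition count_bad : nat := \sum_(j < n) size (seq.filter (bad j) (level j)).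

(** The nodes of generation [j] on the paths issued from marked nodes. Marked nodes open new paths;
    the other paths are prolonged by the best child, and end when this child is marked. The height
    given to [best] is that of the child. *)
Fixpoint heavy_nodes j : seq T :=
  seq.filter (bad j) (level j) ++
  if j is j'.+1 then
    seq.filter (predC (bad j)) [seq child L (best (n - j) L) | L <- heavy_nodes j']
  else [::].

Lemma heavy_nodes0 : heavy_nodes 0 = seq.filter (bad 0) (level 0).
Proof. exact: cats0. Qed.

Lemma heavy_nodesS j : heavy_nodes j.+1 = seq.filter (bad j.+1) (level j.+1) ++
  seq.filter (predC (bad j.+1)) [seq child L (best (n - j.+1) L) | L <- heavy_nodes j].
Proof. by []. Qed.

Lemma heavy_nodes_level j : {subset heavy_nodes j <= level j}.
Proof.
elim: j => [|j IH] K; first by rewrite heavy_nodes0 mem_filter => /andP[].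
rewrite heavy_nodesS mem_cat.
case/orP; rewrite mem_filter => /andP[_] //.
case/mapP => L /IH Lj ->; apply/allpairsP; exists (L, best (n - j.+1) L).
by rewrite mem_enum.
Qed.

(** Paths never merge: distinct nodes have distinct children, and on reaching a marked node a path
    ends while a new one begins. *)
Lemma heavy_nodes_uniq j : uniq (heavy_nodes j).
Proof.
elim: j => [|j IH]; first by rewrite heavy_nodes0 filter_uniq ?uniq_level.
rewrite heavy_nodesS cat_uniq !filter_uniq ?uniq_level //.
  rewrite andbT; apply/hasPn => K; rewrite !mem_filter => /andP[/= /negPf -> _].
  by [].
by rewrite map_inj_uniq // => K K' /child_inj[].
Qed.

Lemma size_heavy_nodes j :
  (size (heavy_nodes j) <= \sum_(i < j.+1) size (seq.filter (bad i) (level i)))%N.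
Proof.
elim: j => [|j IH]; first by rewrite big_ord1 heavy_nodes0.
rewrite big_ord_recr heavy_nodesS size_cat addnC leq_add2r.
by apply: leq_trans IH; rewrite size_filter (leq_trans (count_size _ _)) ?size_map.
Qed.

(** Conservation law: the residuals of the marked nodes met so far equal the weight already
    collected along the paths plus the residuals of the current nodes. It persists because a
    residual is the weight of the node plus the residual of its best child, the latter replaced by
    zero when that child is marked. *)
Lemma heavy_nodes_sum m : (m <= n)%N ->
  \sum_(L <- heavy_nodes m) residual (n - m) L + \sum_(j < m) \sum_(L <- heavy_nodes j) w L =
  \sum_(j < m.+1) \sum_(L <- level j | bad j L) residual (n - j) L.
Proof.
elim: m => [|m IH] mn.
  by rewrite big_ord0 addr0 big_ord1 heavy_nodes0 big_filter.
have E : \sum_(L <- heavy_nodes m) residual (n - m) L = \sum_(L <- heavy_nodes m) w L +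
    \sum_(L <- heavy_nodes m | ~~ bad m.+1 (child L (best (n - m.+1) L)))
      residual (n - m.+1) (child L (best (n - m.+1) L)).
  rewrite -(subnSK mn) [X in _ + X]big_mkcond -big_split; apply: eq_bigr => L _.
  by rewrite residualS /cut /bad; case: ltP.
move/(_ (ltnW mn)): IH; rewrite E => IH.
rewrite [in RHS]big_ord_recr [X in _ + X = _]big_ord_recr heavy_nodesS big_cat /=.
rewrite -IH !big_filter big_map /=; ring.
Qed.

(** At generation [n] every residual is zero, so the marked residuals have all turned into collected
    weight. The inequality is strict since each of them exceeds [theta] and there is at least
    one. *)
Lemma heavy_nodes_weight : (0 < count_bad)%N ->
  theta * count_bad%:R < \sum_(j < n) \sum_(L <- heavy_nodes j) w L.
Proof.
move=> c0; have := heavy_nodes_sum (leqnn n).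
rewrite big1_seq ?add0r => [->|L _]; last by rewrite subnn.
rewrite big_ord_recr /= [X in _ + X]big_pred0 ?addr0; last first.
  by move=> L; rewrite /bad subnn /= ltNge theta0.
have le_sum j : theta * (size (seq.filter (bad j) (level j)))%:R <=
    \sum_(L <- level j | bad j L) residual (n - j) L.
  rewrite -big_filter -sum1_size natr_sum mulr_sumr !big_filter.
  by apply: ler_sum => L bL; rewrite mulr1 ltW.
rewrite /count_bad natr_sum mulr_sumr.
have [j cj] : exists j : 'I_n, (0 < size (seq.filter (bad j) (level j)))%N.
  apply/existsP; apply: contraLR c0 => /existsPn cj.
  rewrite -leqNgt leqn0 /count_bad big1 // => j _.
  by apply/eqP; rewrite -leqn0 leqNgt.
rewrite (bigD1 j) //= [ltRHS](bigD1 j) //=; apply: ltr_leD; last exact: ler_sum.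
rewrite -[ltRHS]big_filter; move: cj.
have : all (bad j) (seq.filter (bad j) (level j)) by exact: filter_all.
case: (seq.filter _ _) => //= L s /andP[bL bs] _.
rewrite big_cons mulrS; rewrite mulrDr mulr1; apply: ltr_leD => //.
rewrite -sum1_size natr_sum mulr_sumr !big_seq; apply: ler_sum => L' L's.
by rewrite mulr1 ltW //; exact: (allP bs).
Qed.

End weighted_tree.

(** * Dyadic cubes and Lebesgue measure *)

Section dyadic.
Context {R : realType} {d : nat}.
Implicit Types (x y : euclid R d) (K : dyadic_code (d := d)).

Definition loc j x : dyadic_code (d := d) :=
  (j, [tuple Num.floor (2 ^+ j * (tnth x i : R)) | i < d]).

Definition dchild K (s : {ffun 'I_d -> bool}) : dyadic_code (d := d) :=
  (K.1.+1, [tuple 2 * tnth K.2 i + (s i)%:Z | i < d]).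

Definition dparent K : dyadic_code (d := d) :=
  (K.1.-1, [tuple (tnth K.2 i %/ 2)%Z | i < d]).

Definition droot : dyadic_code (d := d) := (0%N, [tuple 0 | i < d]).

Lemma code_eqP K K' : K.1 = K'.1 -> (forall i, tnth K.2 i = tnth K'.2 i) -> K = K'.
Proof. by case: K K' => [j a] [j' a'] /= -> aa'; congr pair; apply: eq_from_tnth. Qed.

Lemma dyadic_cubeE K x : dyadic_cube K x <->
  forall i, 2 ^- K.1 * (tnth K.2 i)%:~R <= (tnth x i : R) < 2 ^- K.1 * (tnth K.2 i + 1)%:~R.
Proof.
have p : (0 : R) < 2 ^+ K.1 by rewrite exprn_gt0.
split=> [[y yQ <-] i|xK].
  have /andP[y0 y1] := yQ i.
  by rewrite tnth_mktuple intrD ler_pM2l ?invr_gt0 // ltr_pM2l ?invr_gt0 // lerDr y0 addrC ltrD2l.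
exists [tuple 2 ^+ K.1 * (tnth x i : R) - (tnth K.2 i)%:~R | i < d].
  move=> i; have /andP[h1 h2] := xK i; rewrite tnth_mktuple subr_ge0 ltrBlDr.
  move: h1 h2; rewrite mulrC ler_pdivrMr // mulrC => ->.
  by rewrite mulrC ltr_pdivlMr // mulrC intrD addrC.
apply: eq_from_tnth => i; rewrite !tnth_mktuple subrK mulrA mulVf ?mul1r //.
Qed.

(** Membership as an equation between codes: disjointness and nesting of cubes then reduce to
    rewriting. *)
Lemma dyadic_cubeP K x : dyadic_cube K x <-> loc K.1 x = K.
Proof.
have p : (0 : R) < 2 ^+ K.1 by rewrite exprn_gt0.
rewrite dyadic_cubeE; split=> [xK|<- i].
  apply: code_eqP => // i; rewrite tnth_mktuple; apply: floor_def.
  have /andP[h1 h2] := xK i.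
  move: h1 h2; rewrite mulrC ler_pdivrMr // mulrC => ->.
  by rewrite mulrC ltr_pdivlMr // mulrC.
rewrite tnth_mktuple /=.
rewrite mulrC ler_pdivrMr // (mulrC (tnth x i : R)) floor_le /=.
by rewrite mulrC ltr_pdivlMr // mulrC floorD1_gt.
Qed.

Lemma loc_cube j x : dyadic_cube (loc j x) x.
Proof. exact/dyadic_cubeP. Qed.

Lemma dchildK K s : dparent (dchild K s) = K.
Proof.
apply: code_eqP => //= i; rewrite !tnth_mktuple.
by case: (s i) => /=; lia.
Qed.

Lemma dchild_inj K K' a b : dchild K a = dchild K' b -> K = K' /\ a = b.
Proof.
move=> E; have KK : K = K' by rewrite -(dchildK K a) E dchildK.
split=> //; apply/ffunP => i; move: E => /(congr1 (fun L : dyadic_code (d := d) => tnth L.2 i)).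
by rewrite KK !tnth_mktuple => /addrI; case: (a i); case: (b i).
Qed.

Lemma loc_child j x : exists s, loc j.+1 x = dchild (loc j x) s.
Proof.
exists [ffun i => Num.floor (2 ^+ j.+1 * (tnth x i : R)) != 2 * Num.floor (2 ^+ j * (tnth x i : R))].
apply: code_eqP => //= i; rewrite !tnth_mktuple ffunE exprS -mulrA.
set z := 2 ^+ j * _; have h1 := floor_le z; have h2 := floorD1_gt z.
have h3 := floor_le (2 * z); have h4 := floorD1_gt (2 * z).
set m := Num.floor z in h1 h2 *; set n := Num.floor (2 * z) in h3 h4 *.
have a1 : 2 * m < n + 1 by rewrite -(ltr_int R) intrM; lra.
have a2 : n < 2 * (m + 1) by rewrite -(ltr_int R) intrM; lra.
by case: eqP => /=; lia.
Qed.

Lemma dparent_loc j x : dparent (loc j.+1 x) = loc j x.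
Proof. by have [s ->] := loc_child j x; rewrite dchildK. Qed.

Lemma unit_cubeE x : unit_cube x <-> loc 0 x = droot.
Proof.
rewrite -(dyadic_cubeP droot) dyadic_cubeE; split=> + i => /(_ i).
  by rewrite tnth_mktuple expr0 invr1 !mul1r.
by rewrite tnth_mktuple expr0 invr1 !mul1r.
Qed.

Definition dlevel := level dchild droot.

Lemma dlevel1 j K : K \in dlevel j -> K.1 = j.
Proof.
case: j => [|j]; first by rewrite inE => /eqP ->.
elim: j K => [|j IH] K /allpairsP[[L s] [/= Lj _ ->]] /=.
  by move: Lj; rewrite inE => /eqP ->.
by rewrite (IH L).
Qed.

Lemma loc_dlevel j x : unit_cube x -> loc j x \in dlevel j.
Proof.
move=> /unit_cubeE x0; elim: j => [|j IH]; first by rewrite x0 inE.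
have [s ->] := loc_child j x; apply/allpairsP; exists (loc j x, s).
by rewrite mem_enum.
Qed.

Lemma dlevel_bounds j K i : K \in dlevel j -> 0 <= tnth K.2 i < 2 ^+ j.
Proof.
elim: j K => [|j IH] K; first by rewrite inE => /eqP ->; rewrite tnth_mktuple.
move=> /allpairsP[[L s] [/= Lj _ ->]] /=; rewrite tnth_mktuple.
have := IH _ Lj; rewrite exprS; case: (s i) => /=; lia.
Qed.

Lemma dlevel_sub j K : K \in dlevel j -> dyadic_cube K `<=` (unit_cube : set (euclid R d)).
Proof.
move=> Kj x /dyadic_cubeE xK i; have /andP[h1 h2] := xK i.
have p : (0 : R) < 2 ^+ j by rewrite exprn_gt0.
have /andP[b0 b1] := dlevel_bounds i Kj; move: h1 h2; rewrite (dlevel1 Kj) => h1 h2.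
apply/andP; split; first by apply: le_trans h1; rewrite mulr_ge0 ?invr_ge0 ?(ltW p) // ler0z.
apply: lt_le_trans h2 _; rewrite mulrC ler_pdivrMr // mul1r.
have -> : (2 : R) ^+ j = ((2 : int) ^+ j)%:~R by rewrite rmorphXn.
by rewrite ler_int; lia.
Qed.

Definition dyadic_side K (i : 'I_d) : set (measurableTypeR R) :=
  [set` `[2 ^- K.1 * (tnth K.2 i)%:~R, 2 ^- K.1 * (tnth K.2 i + 1)%:~R[].

Lemma measurable_dyadic_side K i : measurable (dyadic_side K i).
Proof. exact: measurable_itv. Qed.

Lemma dyadic_cube_box K :
  dyadic_cube K = [set x : euclid R d | forall i, dyadic_side K i (tnth x i)].
Proof.
rewrite /dyadic_side.
apply/seteqP; split=> x /=; rewrite dyadic_cubeE => xK i.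
  by rewrite /= in_itv /=; exact: xK.
by move: (xK i); rewrite /= in_itv.
Qed.

Lemma measurable_box (A : 'I_d -> set (measurableTypeR R)) :
  (forall i, measurable (A i)) -> measurable [set x : euclid R d | forall i, A i (tnth x i)].
Proof.
move=> mA; rewrite (_ : [set _ | _] =
    \bigcap_(i in [set: 'I_d]) ((@tnth _ _)^~ i @^-1` A i)); last first.
  by apply/seteqP; split => x /= xA i; [move=> _; exact: xA|exact: xA].
apply: fin_bigcap_measurable; first exact: finite_finset.
by move=> i _; rewrite -[_ @^-1` _]setTI; exact: measurable_tnth.
Qed.

Lemma measurable_dyadic_cube K : measurable (dyadic_cube K : set (euclid R d)).
Proof.
rewrite dyadic_cube_box; apply: measurable_box => i; exact: measurable_dyadic_side.
Qed.

Lemma unit_cube_root : unit_cube = dyadic_cube droot :> set (euclid R d).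
Proof. by apply/seteqP; split=> x; rewrite dyadic_cubeP unit_cubeE. Qed.

Lemma measurable_unit_cube : measurable (unit_cube : set (euclid R d)).
Proof. rewrite unit_cube_root; exact: measurable_dyadic_cube. Qed.

Lemma lebesgue_dyadic_cube K :
  lebesgue d (dyadic_cube K : set (euclid R d)) = (2 ^- (K.1 * d))%:E.
Proof.
rewrite dyadic_cube_box lebesgue_box; last exact: measurable_dyadic_side.
under eq_bigr => i _.
  rewrite /dyadic_side lebesgue_measure_itv /= lte_fin ltr_pM2l ?invr_gt0 ?exprn_gt0 // ltr_int ltrDl ltr01.
  rewrite -EFinB -mulrBr -intrB addrAC subrr add0r mulr1; over.
by rewrite prodEFin prodr_const card_ord exprVn exprM.
Qed.

End dyadic.

(** * Translation invariance of the Lebesgue measure *)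

Section translation.
Context {R : realType}.

Definition shift d (v x : euclid R d) : euclid R d :=
  [tuple (tnth x i : R) + (tnth v i : R) | i < d].

Lemma measurable_shift d (v : euclid R d) : measurable_fun setT (shift v).
Proof.
apply/measurable_fun_tnthP => i.
rewrite (_ : _ \o _ = fun x : euclid R d => (tnth x i : R) + tnth v i); last first.
  by apply/funext => x /=; rewrite tnth_mktuple.
apply: measurable_funD => //; exact: measurable_tnth.
Qed.

Lemma measurable_addr (a : R) : measurable_fun setT (fun x : measurableTypeR R => x + a : measurableTypeR R).
Proof. by apply: measurable_funD. Qed.

Lemma lebesgue_measure_addr (a : R) (A : set (measurableTypeR R)) : measurable A ->
  lebesgue_measure ((fun x : measurableTypeR R => x + a) @^-1` A) = lebesgue_measure A.
Proof.
move=> mA; apply/esym.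
apply: (lebesgue_measure_unique (mu := pushforward lebesgue_measure (fun x : measurableTypeR R => x + a : measurableTypeR R))) => //.
  exact: measurable_addr.
move=> ? X [x _ <-]; rewrite [in RHS]/= /pushforward.
rewrite (_ : _ @^-1` _ = [set` `]x.1 - a, x.2 - a]]); last first.
  by apply/seteqP; split=> y /=; rewrite !in_itv /= ltrBlDr lerBrDr.
rewrite !lebesgue_measure_itv /= !lte_fin ltrD2r.
by case: ifP => // _; rewrite -!EFinB; congr (_%:E); lra.
Qed.

Definition cons_shift n (v : euclid R n.+1) (x : measurableTypeR R * euclid R n) :
    measurableTypeR R * euclid R n :=
  (x.1 + thead v, shift [tuple of behead v] x.2).

Lemma measurable_cons_shift n (v : euclid R n.+1) : measurable_fun setT (cons_shift v).
Proof.
apply: measurable_fun_pair => /=.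
  exact: (measurableT_comp (measurable_addr _) (@measurable_fst _ _ _ _)).
exact: (measurableT_comp (measurable_shift _) (@measurable_snd _ _ _ _)).
Qed.

Lemma shift_cons n (v : euclid R n.+1) z :
  shift v (Defs.cons_tuple z) = Defs.cons_tuple (cons_shift v z).
Proof.
apply: eq_from_tnth => i; rewrite tnth_mktuple.
case: (unliftP ord0 i) => [j ->|-> //]; rewrite !tnthS.
rewrite tnth_mktuple tnth_behead.
by congr (_ + tnth _ _); apply: val_inj; rewrite /= inordK // ltnS.
Qed.

(** Induction on the dimension: a translation acts separately on the first coordinate and on the
    others, and a measure with the right values on rectangles is the product measure. *)
Lemma lebesgue_shift d (v : euclid R d) A : measurable A ->
  lebesgue d (shift v @^-1` A) = lebesgue d A.
Proof.
elim: d v A => [|n IH] v A mA.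
  by congr (lebesgue 0 _); apply/seteqP; split=> x; rewrite /= [shift v x]tuple0 [x]tuple0.
rewrite /= /lebesgue_cons /pushforward.
rewrite (_ : _ @^-1` _ = cons_shift v @^-1` (@Defs.cons_tuple _ _ @^-1` A)); last first.
  by apply/seteqP; split=> z; rewrite /= shift_cons.
apply/esym.
apply: (product_measure_unique (m' := pushforward (lebesgue_measure \x lebesgue n)%E (cons_shift v))).
- exact: measurable_cons_shift.
- move=> ? B C mB mC; rewrite [in LHS]/= /pushforward.
  rewrite (_ : _ @^-1` _ = ((fun x : measurableTypeR R => x + thead v) @^-1` B) `*`
    (shift [tuple of behead v] @^-1` C)) // product_measure1E; last 2 first.
  + by rewrite -[X in measurable X]setTI; exact: measurable_addr.
  + by rewrite -[X in measurable X]setTI; exact: measurable_shift.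
  by congr (_ * _)%E; [exact: lebesgue_measure_addr|exact: IH].
- by rewrite -[X in measurable X]setTI; exact: Defs.measurable_cons_tuple.
Qed.

Lemma ge0_integral_shift d (v : euclid R d) (D : set (euclid R d)) (g : euclid R d -> \bar R) :
  measurable D -> measurable_fun [set: euclid R d] g -> (forall x, (0 <= g x)%E) ->
  (\int[lebesgue d]_(x in shift v @^-1` D) g (shift v x) =
   \int[lebesgue d]_(x in D) g x)%E.
Proof.
move=> mD mg g0.
rewrite -(ge0_integral_pushforward (measurable_shift v) (lebesgue d)) //; last first.
  exact: measurable_funTS.
apply: eq_measure_integral => [|? A mA _].
  exact: measurable_shift.
exact: (lebesgue_shift _ mA).
Qed.

Lemma integral_shift d (v : euclid R d) (D : set (euclid R d)) (g : euclid R d -> \bar R) :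
  measurable D -> measurable_fun [set: euclid R d] g ->
  (\int[lebesgue d]_(x in shift v @^-1` D) g (shift v x) =
   \int[lebesgue d]_(x in D) g x)%E.
Proof.
move=> mD mg; rewrite integralE [RHS]integralE; congr (_ - _)%E.
- have <- := @ge0_integral_shift _ v D g^\+%E mD (measurable_funepos mg) (funepos_ge0 g).
  by apply: eq_integral => x _; rewrite !funeposE.
- have <- := @ge0_integral_shift _ v D g^\-%E mD (measurable_funeneg mg) (funeneg_ge0 g).
  by apply: eq_integral => x _; rewrite !funenegE.
Qed.

End translation.

(** * Density of dyadic step functions in the mean *)

Section step_density.
Context {R : realType} {d : nat}.
Local Notation mu := (lebesgue d : {sigma_finite_measure set (euclid R d) -> \bar R}).
Local Notation U := (unit_cube : set (euclid R d)).
Local Notation code := (dyadic_code (d := d)).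
Implicit Types (f g h : euclid R d -> R) (c : code -> R) (A B : set (euclid R d)).

Let mU : measurable U := measurable_unit_cube.

Lemma dlevel_uniq j : uniq (dlevel j : seq code).
Proof. exact/uniq_level/dchild_inj. Qed.

Lemma sum_dlevel_cube m (x : euclid R d) (F : code -> R) : U x ->
  \sum_(K <- dlevel m) F K * \1_(dyadic_cube K) x = F (loc m x).
Proof.
move=> Ux; rewrite (bigD1_seq (loc m x)) /= ?loc_dlevel ?dlevel_uniq //.
rewrite indicE mem_set ?mulr1; last exact: loc_cube.
rewrite big_seq_cond big1 ?addr0 // => K /andP[Km Kx].
rewrite indicE memNset ?mulr0 // => /dyadic_cubeP; rewrite (dlevel1 Km) => xK.
by rewrite xK eqxx in Kx.
Qed.

Lemma measurable_step m c : measurable_fun U (fun x => c (loc m x)).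
Proof.
apply: (eq_measurable_fun (fun x => \sum_(K <- dlevel m) c K * \1_(dyadic_cube K) x)).
  by move=> x /set_mem Ux; exact: sum_dlevel_cube.
apply: measurable_sum => K; apply: measurable_funM => //.
by apply: measurable_funTS; apply/measurable_indicP; exact: measurable_dyadic_cube.
Qed.

Lemma step_refine m n c : (m <= n)%N ->
  exists c', forall x : euclid R d, c (loc m x) = c' (loc n x).
Proof.
move=> mn; exists (c \o iter (n - m) dparent) => x /=; congr c.
rewrite -{2}(subnK mn); elim: (n - m)%N => // j IH.
by rewrite iterSr addSn dparent_loc.
Qed.

Definition L1dist f g : \bar R := (\int[mu]_(x in U) `|f x - g x|%:E)%E.

Lemma measurable_L1dist f g : measurable_fun U f -> measurable_fun U g ->
  measurable_fun U (fun x => `|f x - g x|%:E).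
Proof.
move=> mf mg; apply/measurable_EFinP.
by apply: measurableT_comp => //; exact: measurable_funB.
Qed.

Lemma L1dist_ge0 f g x : U x -> (0 <= `|f x - g x|%:E)%E.
Proof. by move=> _; rewrite lee_fin. Qed.

Definition step_approximable f := forall e : R, 0 < e ->
  exists m c, (L1dist f (fun x => c (loc m x)) <= e%:E)%E.

Lemma L1dist_triangle f g h : measurable_fun U f -> measurable_fun U g -> measurable_fun U h ->
  (L1dist f h <= L1dist f g + L1dist g h)%E.
Proof.
move=> mf mg mh;
rewrite /L1dist -(ge0_integralD mu mU (@L1dist_ge0 f g) (measurable_L1dist mf mg)
  (@L1dist_ge0 g h) (measurable_L1dist mg mh)).
apply: (ge0_le_integral mu mU (@L1dist_ge0 f h) (measurable_L1dist mf mh)) => [|x _].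
  by apply: emeasurable_funD; exact: measurable_L1dist.
by rewrite -EFinD lee_fin; apply: ler_distD.
Qed.

Lemma step_approximable_closed f : measurable_fun U f ->
  (forall e : R, 0 < e -> exists g,
     [/\ measurable_fun U g, step_approximable g & (L1dist f g <= e%:E)%E]) ->
  step_approximable f.
Proof.
move=> mf fg e e0; have e20 : 0 < e / 2 by rewrite divr_gt0.
have [g [mg ag fge]] := fg _ e20; have [m [c gc]] := ag _ e20.
exists m, c; apply: le_trans (L1dist_triangle mf mg _) _; first exact: measurable_step.
by rewrite [e]splitr EFinD; exact: leeD.
Qed.

(** Two step functions are constant on the cubes of a common generation, where [Phi] of them is
    again a step function. Complements, unions and linear combinations are all instances. *)
Lemma step_approximable_lip (Phi : R -> R -> R) (C : R) f g :
  measurable_fun U f -> measurable_fun U g ->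
  measurable_fun U (fun x => Phi (f x) (g x)) ->
  0 < C -> (forall a b a' b', `|Phi a b - Phi a' b'| <= C * (`|a - a'| + `|b - b'|)) ->
  step_approximable f -> step_approximable g ->
  step_approximable (fun x => Phi (f x) (g x)).
Proof.
move=> mf mg mPhi C0 lip af ag e e0.
have eC : 0 < e / (2 * C) by rewrite divr_gt0 // mulr_gt0.
have [m1 [c1 fc]] := af _ eC; have [m2 [c2 gc]] := ag _ eC.
have [c1' c1E] := step_refine c1 (leq_maxl m1 m2).
have [c2' c2E] := step_refine c2 (leq_maxr m1 m2).
exists (maxn m1 m2), (fun K => Phi (c1' K) (c2' K)).
have ms1 := measurable_step m1 c1; have ms2 := measurable_step m2 c2.
apply: (@le_trans _ _ (C%:E * (L1dist f (fun x => c1 (loc m1 x)) +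
    L1dist g (fun x => c2 (loc m2 x))))%E); last first.
  apply: (@le_trans _ _ (C%:E * ((e / (2 * C))%:E + (e / (2 * C))%:E))%E).
    by rewrite lee_pmul2l //; exact: leeD.
  rewrite -EFinD -EFinM lee_fin le_eqVlt; apply/orP; left; apply/eqP; field.
  by rewrite gt_eqF.
rewrite /L1dist -(ge0_integralD mu mU (@L1dist_ge0 f _) (measurable_L1dist mf ms1)
  (@L1dist_ge0 g _) (measurable_L1dist mg ms2)).
have mD := emeasurable_funD (measurable_L1dist mf ms1) (measurable_L1dist mg ms2).
have D0 x : U x -> (0 <= `|f x - c1 (loc m1 x)|%:E + `|g x - c2 (loc m2 x)|%:E)%E.
  by move=> _; rewrite adde_ge0 // lee_fin.
rewrite -(ge0_integralZl_EFin mu mU D0 mD (ltW C0)).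
apply: (ge0_le_integral mu mU) => [x _||| x _].
- by rewrite lee_fin.
- exact: (measurable_L1dist mPhi (measurable_step _ (fun K => Phi (c1' K) (c2' K)))).
- exact: measurable_funeM.
- by rewrite -EFinD -EFinM lee_fin -c1E -c2E lip.
Qed.

Definition step_set A := measurable A /\ step_approximable (\1_A : euclid R d -> R).

Lemma measurable_indic_on A : measurable A -> measurable_fun U (\1_A : _ -> R).
Proof. by move=> mA; apply: measurable_funTS; apply/measurable_indicP. Qed.

Lemma L1dist_indic A B : measurable A -> measurable B -> B `<=` A ->
  L1dist \1_A \1_B = mu ((A `\` B) `&` U).
Proof.
move=> mA mB BA; rewrite /L1dist -integral_indic //; last exact: measurableD.
apply: eq_integral => x _; congr (_%:E); rewrite !indicE in_setD.
have [xB|xB] := boolP (x \in B); last by rewrite subr0 andbT normr_nat.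
by rewrite andbF (mem_set (BA _ (set_mem xB))) subrr normr0.
Qed.

Lemma step_setC A : step_set A -> step_set (~` A).
Proof.
move=> [mA aA]; split; first exact: measurableC.
have mA1 := measurable_indic_on mA.
rewrite (_ : \1_(~` A) = fun x => 1 - \1_A x); last first.
  by apply/funext => x; rewrite !indicE in_setC; case: (x \in A); rewrite ?subrr ?subr0.
apply: (@step_approximable_lip (fun a _ => 1 - a) 1 \1_A \1_A) => //.
  by apply: measurable_funB.
by move=> a b a' b'; rewrite opprB addrC addrA subrK mul1r distrC lerDl.
Qed.

Lemma step_setU A B : step_set A -> step_set B -> step_set (A `|` B).
Proof.
move=> [mA aA] [mB aB]; split; first exact: measurableU.
have mA1 := measurable_indic_on mA; have mB1 := measurable_indic_on mB.
rewrite (_ : \1_(A `|` B) = fun x => Num.max (\1_A x) (\1_B x)); last first.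
  apply/funext => x; rewrite !indicE in_setU.
  by case: (x \in A); case: (x \in B); rewrite /= ?maxxx ?(max_l ler01) ?(max_r ler01).
apply: (@step_approximable_lip Num.max 1 \1_A \1_B) => //.
  exact: measurable_maxr.
move=> a b a' b'; rewrite mul1r ler_norml.
have := ler_norm (a - a'); have := ler_norm (b - b').
have := ler_norm (a' - a); have := ler_norm (b' - b).
rewrite (distrC a' a) (distrC b' b).
by case: (leP a b) => ?; case: (leP a' b') => ? *; apply/andP; split; lra.
Qed.

Lemma ex_exp2V_lt (e : R) : 0 < e -> exists m : nat, 2 ^- m < e.
Proof.
move=> e0; exists (Num.bound e^-1); rewrite invf_plt ?posrE ?exprn_gt0 //.
apply: lt_trans (archi_boundP _) _; first by rewrite invr_ge0 ltW.
by rewrite -natrX ltr_nat ltn_expl.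
Qed.

Lemma step_set0 : step_set set0.
Proof.
split=> // e e0; exists 0%N, (fun=> 0); rewrite /L1dist.
by rewrite integral0_eq ?lee_fin ?ltW // => x _; rewrite indic0 subrr normr0.
Qed.

(** Finite unions come from [step_setU]; what they miss inside the unit cube has measure tending to
    zero by continuity from above, the cube having finite measure. *)
Lemma step_set_bigcup (F : (set (euclid R d))^nat) :
  (forall n, step_set (F n)) -> step_set (\bigcup_n F n).
Proof.
move=> sF; have mF : measurable (\bigcup_n F n).
  by apply: bigcupT_measurable => n; case: (sF n).
split=> //; apply: step_approximable_closed; first exact: measurable_indic_on.
move=> e e0; pose B n := \big[setU/set0]_(i < n) F i.
have sB n : step_set (B n).
  by apply: big_ind => //; [exact: step_set0|exact: step_setU].
pose G n := ((\bigcup_n F n) `\` B n) `&` U.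
have mG n : measurable (G n) by apply: measurableI => //; apply: measurableD => //; case: (sB n).
have G0 : \bigcap_n G n = set0.
  apply/seteqP; split=> // x Gx; have [[[n _ Fnx] _] _] := Gx 0%N I.
  have [[_ +] _] := Gx n.+1 I; apply.
  by rewrite /B big_ord_recr; right.
have : mu \o G @ \oo --> mu (\bigcap_n G n).
  apply: nonincreasing_cvg_mu => //; last 2 first.
  - by rewrite G0.
  - move=> m n mn; apply/subsetPset => x [[Fx nB] Ux]; split=> //; split=> // Bx.
    apply: nB; move: Bx; rewrite /B -!bigcup_mkord => -[i /= im Fix].
    by exists i => //=; exact: leq_trans mn.
  apply: (@le_lt_trans _ _ (mu U)); first by apply: le_measure; rewrite ?inE //; move=> x [].
  by rewrite unit_cube_root lebesgue_dyadic_cube ltry.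
rewrite G0 measure0 => /fine_cvgP[+ /cvgrPdist_lt /(_ _ e0)].
move=> h1 h2; near \oo => n; exists \1_(B n); split.
- by apply: measurable_indic_on; case: (sB n).
- by case: (sB n).
rewrite L1dist_indic //; last 2 first.
- by case: (sB n).
- by rewrite /B -bigcup_mkord; apply: bigcup_sub => i _; exact: bigcup_sup.
have f1 : mu (G n) \is a fin_num by near: n.
have f2 : `|0 - fine (mu (G n))| < e by near: n.
rewrite -/(G n) -(fineK f1) lee_fin ltW //.
by apply: le_lt_trans f2; rewrite sub0r normrN ler_norm.
Unshelve. all: by end_near. Qed.

(** An error occurs only in the cubes of generation [m] met by the hyperplane; they lie in a slab of
    width [2 ^- m]. *)
Lemma step_set_halfspace (i : 'I_d) (a : R) :
  step_set [set x : euclid R d | (tnth x i : R) < a].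
Proof.
have mA : measurable [set x : euclid R d | (tnth x i : R) < a].
  rewrite (_ : [set _ | _] = (@tnth _ _)^~ i @^-1` `]-oo, a[); last first.
    by apply/seteqP; split=> x; rewrite /= in_itv.
  by rewrite -[_ @^-1` _]setTI; apply: measurable_tnth => //; exact: measurable_itv.
split=> // e e0; have [m me] := ex_exp2V_lt e0.
pose n := Num.floor (2 ^+ m * a).
exists m, (fun K => ((tnth K.2 i < n)%R)%:R).
pose S (j : 'I_d) : set (measurableTypeR R) := if j == i
  then [set` `[2 ^- m * n%:~R, 2 ^- m * (n + 1)%:~R[] else [set` `[0, 1[].
have mS j : measurable (S j) by rewrite /S; case: ifP => _; exact: measurable_itv.
pose SS := [set x : euclid R d | forall j, S j (tnth x j)].
have mSS : measurable SS by exact: measurable_box.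
apply: (@le_trans _ _ (mu SS)); last first.
  rewrite lebesgue_box // (bigD1 i) //= big1 ?mule1; last first.
    move=> j /negPf ji; rewrite /S ji lebesgue_measure_itv /= lte_fin ltr01.
    by rewrite -EFinB subr0.
  rewrite /S eqxx lebesgue_measure_itv /= lte_fin ltr_pM2l ?invr_gt0 ?exprn_gt0 //.
  rewrite ltr_int ltrDl ltr01 -EFinB -mulrBr -intrB addrAC subrr add0r mulr1.
  by rewrite lee_fin ltW.
have -> : mu SS = (\int[mu]_(x in [set: euclid R d]) (\1_SS x)%:E)%E.
  by rewrite integral_indic // setIT.
rewrite /L1dist integral_mkcond; apply: ge0_le_integral => //.
- by move=> x _; rewrite erestrict_ge0 // => y _; rewrite lee_fin.
- apply/(measurable_restrictT _ mU); apply: measurable_L1dist.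
    exact: measurable_indic_on.
  exact: (measurable_step m (fun K => ((tnth K.2 i < n)%R)%:R)).
- by apply/measurable_EFinP/measurable_indicP.
move=> x _; rewrite patchE; case: ifPn => [/set_mem Ux|_]; last by rewrite lee_fin.
rewrite lee_fin [in leRHS]indicE.
have [xS|xS] := boolP (x \in SS).
  rewrite indicE; case: (x \in _); case: (_ < _)%R; rewrite ?subrr ?normr0 //.
    by rewrite subr0 normr1.
  by rewrite sub0r normrN normr1.
suff -> : \1_[set x : euclid R d | (tnth x i : R) < a] x =
    (tnth (loc m x).2 i < n)%R%:R :> R by rewrite subrr normr0.
rewrite indicE; congr ((nat_of_bool _)%:R); rewrite tnth_mktuple.
have p : (0 : R) < 2 ^+ m by rewrite exprn_gt0.
set y := 2 ^+ m * _.
have yn : Num.floor y != n.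
  apply: contra xS => /eqP yn; apply/mem_set => j; rewrite /S.
  case: eqP => [->|_]; last by rewrite /= in_itv /=; exact: Ux.
  have h1 := floor_le y; have h2 := floorD1_gt y; rewrite yn in h1 h2.
  rewrite /= in_itv /= mulrC ler_pdivrMr // [X in _ <= X]mulrC h1 /=.
  by rewrite mulrC ltr_pdivlMr // mulrC.
have E : ((tnth x i : R) < a) = (y < 2 ^+ m * a) by rewrite ltr_pM2l.
apply/idP/idP => [/set_mem /=|ly].
  rewrite E => ya; rewrite lt_neqAle yn /=; apply: le_floor; exact: ltW.
apply/mem_set; rewrite /= E; rewrite ltNge; apply/negP => ya.
by move: ly; rewrite ltNge (le_floor ya).
Qed.

(** The sets with approximable indicator form a sigma-algebra, and it contains the coordinate
    half-spaces, which generate the measurable sets. *)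
Lemma step_set_measurable A : measurable A -> step_set A.
Proof.
have sa : sigma_algebra setT step_set.
  split; [exact: step_set0| |exact: step_set_bigcup].
  by move=> B sB; rewrite setTD; exact: step_setC.
apply: smallest_sub => //.
apply: (big_ind (fun X => X `<=` step_set)) => //.
  by move=> X Y Xs Ys B [/Xs|/Ys].
move=> i _ _ [C mC <-]; rewrite setTI.
suff : measurable `<=` [set D : set (measurableTypeR R) | step_set ((@tnth _ _)^~ i @^-1` D)].
  by apply.
rewrite [X in X `<=` _](RGenInftyO.measurableE R); apply: smallest_sub.
  split.
  - by rewrite /= preimage_set0; exact: step_set0.
  - by move=> D sD; rewrite /= setTD preimage_setC; exact: step_setC.
  - by move=> F sF; rewrite /= preimage_bigcup; exact: step_set_bigcup.
move=> _ [x ->] /=.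
rewrite (_ : _ @^-1` _ = [set y : euclid R d | (tnth y i : R) < x]); last first.
  by apply/seteqP; split=> y; rewrite /= in_itv.
exact: step_set_halfspace.
Qed.

Import HBSimple.

Lemma step_dense f : mu.-integrable U (EFin \o f) -> step_approximable f.
Proof.
move=> fi; have mf : measurable_fun U f by apply/measurable_EFinP; exact: measurable_int fi.
have [g [gi _ gf]] := approximation_sfun_integrable mU fi.
apply: step_approximable_closed => // e e0.
move: gf => /fine_cvgP[h1 /cvgrPdist_lt /(_ _ e0) h2].
near \oo => n; exists (g n); split.
- by apply: measurable_funTS.
- pose s := fset_set (g n @` setT).
  have E : g n = (fun x => \sum_(y <- s) (y * \1_(g n @^-1` [set y]) x)) :> (_ -> _).
    by apply/funext => x; rewrite [LHS]fimfunE fsbig_finite.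
  have mg y : measurable (g n @^-1` [set y]).
    by rewrite -[_ @^-1` _]setTI; apply: (@measurable_funPT _ _ _ _ (g n)).
  rewrite E; elim: (s : seq _) => [|y t IH].
    have [_ a0] := step_set0; rewrite indic0 in a0.
    by under eq_fun do rewrite big_nil.
  under eq_fun do rewrite big_cons.
  have my := measurable_indic_on (mg y).
  have mt : measurable_fun U (fun x => \sum_(y <- t) (y * \1_(g n @^-1` [set y]) x)).
    by apply: measurable_sum => z; apply: measurable_funM => //; exact: measurable_indic_on.
  apply: (@step_approximable_lip (fun a b => y * a + b) (1 + `|y|)) => //.
  + by apply: measurable_funD => //; exact: measurable_funM.
  + move=> a b a' b'; rewrite (_ : _ - _ = y * (a - a') + (b - b')); last by ring.
    apply: le_trans (ler_normD _ _) _; rewrite normrM.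
    have : 0 <= `|a - a'| by []. have : 0 <= `|b - b'| * `|y| by rewrite mulr_ge0.
    lra.
  + by case: (step_set_measurable (mg y)).
have f1 : (\int[mu]_(z in U) `|(f z)%:E - (g n z)%:E|)%E \is a fin_num by near: n.
have f2 : `|0 - fine (\int[mu]_(z in U) `|(f z)%:E - (g n z)%:E|)%E| < e by near: n.
rewrite /L1dist -[X in (X <= _)%E]fineK; last exact: f1.
by rewrite lee_fin ltW //; apply: le_lt_trans f2; rewrite sub0r normrN ler_norm.
Unshelve. all: by end_near. Qed.

End step_density.

(** * Local polynomials and their increments *)

Section local_polynomials.
Context {R : realType} {d : nat}.
Local Notation mu := (lebesgue d : {sigma_finite_measure set (euclid R d) -> \bar R}).
Local Notation code := (dyadic_code (d := d)).
Variables (k r b : nat).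
Implicit Types (K L : code) (c : 'I_d -> nat) (x : euclid R d).

(** The cube in position [c] of the grid [q] generations finer than [K], counted from the corner of
    [K]. It lies in [K] only if every [c i] is below [2 ^ q]. *)
Definition cell q K c : code :=
  ((K.1 + q)%N, [tuple 2 ^+ q * tnth K.2 i + (c i)%:Z | i < d]).

Definition avg (f : euclid R d -> R) L : R :=
  2 ^+ (L.1 * d) * Rintegral mu (dyadic_cube L) f.

(* The offset [b] leaves room for the pure steps, whose coordinates are negative. *)
Definition cell_data q f K c : R := avg f (cell q K (fun i => b + c i)%N).

(** The argument of [interp] is [x] in the coordinates in which cells have side 1 and the cell in
    position [(b, ..., b)] starts at the origin. *)
Definition lpoly f K x : R :=
  interp k (cell_data r f K)
    (fun i => 2 ^+ (K.1 + r) * (tnth x i : R) - (2 ^+ r * tnth K.2 i)%:~R - b%:R).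

Lemma dyadic_cube_children L :
  dyadic_cube L = \big[setU/set0]_(s : {ffun 'I_d -> bool}) dyadic_cube (dchild L s) :> set (euclid R d).
Proof.
apply/seteqP; split=> x.
  move=> /dyadic_cubeP xL; have [s xs] := loc_child L.1 x.
  rewrite (bigD1 s) //=; left; apply/dyadic_cubeP; rewrite [(dchild L s).1]/= xs.
  by rewrite xL.
have H : (\big[setU/set0]_(s : {ffun 'I_d -> bool}) dyadic_cube (dchild L s)) `<=`
    (dyadic_cube L : set (euclid R d)).
  apply: (big_ind (fun X => X `<=` dyadic_cube L)) => //.
    by move=> X Y XL YL y [/XL|/YL].
  move=> s _ y /dyadic_cubeP /= ys; apply/dyadic_cubeP.
  by rewrite -dparent_loc ys dchildK.
exact: H.
Qed.

Lemma trivIset_dyadic_cube (T : choiceType) (F : T -> code) (D : set T) :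
  injective F -> (forall s t, D s -> D t -> (F s).1 = (F t).1) ->
  trivIset D (fun t => dyadic_cube (F t) : set (euclid R d)).
Proof.
move=> Finj lev s t Ds Dt [x [/dyadic_cubeP xs /dyadic_cubeP xt]].
by apply: Finj; rewrite -xs -xt (lev s t).
Qed.

Lemma avg_children f L : mu.-integrable setT (EFin \o f) ->
  avg f L = 2 ^- d * \sum_(s : {ffun 'I_d -> bool}) avg f (dchild L s).
Proof.
move=> fi; have mf : measurable_fun setT f.
  by apply/measurable_EFinP; exact: measurable_int fi.
have -> : \sum_(s : {ffun 'I_d -> bool}) avg f (dchild L s) = 2 ^+ d * (2 ^+ (L.1 * d) *
    \sum_(s : {ffun 'I_d -> bool}) Rintegral mu (dyadic_cube (dchild L s)) f).
  rewrite !mulr_sumr; apply: eq_bigr => s _.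
  by rewrite /avg mulrA -exprD (_ : (dchild L s).1 * d = d + L.1 * d)%N // -mulSn.
rewrite mulKf; last by rewrite gt_eqF ?exprn_gt0.
congr (_ * _); rewrite {1}dyadic_cube_children /Rintegral integral_bigsetU_EFin //=.
- apply/esym; rewrite sum_fine // => s _; apply: integrable_fin_num; first exact: measurable_dyadic_cube.
  by apply: integrableS fi => //; exact: measurable_dyadic_cube.
- by move=> s; exact: measurable_dyadic_cube.
- exact: index_enum_uniq.
- by apply: trivIset_dyadic_cube => // s t /dchild_inj[].
- by apply/measurable_EFinP; apply: measurable_funTS.
Qed.

(** The cells of the child belong to the grid of [K] one generation finer; a child occupies half of
    it in each direction, whence the translation by [2 ^ r]. *)
Lemma cell_data_child f K s : cell_data r f (dchild K s) =
  block 1 (fun i => s i * 2 ^ r)%N (cell_data r.+1 f K).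
Proof.
apply/funext => c; rewrite /block invr1 expr1n mul1r.
rewrite (big_pred1 [ffun=> ord0]) => [|t]; last first.
  by apply/esym/eqP/ffunP => i; rewrite ffunE [t i]ord1.
rewrite /cell_data; congr (avg f _); apply: code_eqP => /=; first by rewrite addnS.
move=> i; rewrite !tnth_mktuple ffunE /= mul1n addn0 exprS mulrDr !PoszD PoszM.
have -> : ((2 ^ r)%N : int) = 2 ^+ r by rewrite -natz natrX.
by rewrite mulrA (mulrC 2) -addrA; congr (_ + _); ring.
Qed.

(** The mean over a cell is the mean of the means over its children. The offset of the blocks comes
    from [2 * (b + c) + s = b + (b + 2 * c + s)]. *)
Lemma cell_data_parent f K : mu.-integrable setT (EFin \o f) -> cell_data r f K =
  block 2 (fun=> b) (cell_data r.+1 f K).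
Proof.
move=> fi; apply/funext => c; rewrite /block {1}/cell_data avg_children // card_ord exprVn.
congr (_ * _).
pose h (s : {ffun 'I_d -> bool}) : {ffun 'I_d -> 'I_2} := [ffun i => inord (s i)].
pose h' (s : {ffun 'I_d -> 'I_2}) : {ffun 'I_d -> bool} := [ffun i => s i == 1%N :> nat].
have hv s i : h s i = s i :> nat by rewrite ffunE inordK //; case: (s i).
rewrite (reindex h); last first.
  exists h' => s _; apply/ffunP => i; first by rewrite !ffunE inordK; case: (s i).
  apply: val_inj; rewrite /= hv ffunE; case: (s i) => -[|[|]] //.
apply: eq_bigr => s _; congr (avg f _); apply: code_eqP => /=; first by rewrite addnS.
move=> i; rewrite !tnth_mktuple hv exprS -mulrA; case: (s i) => /=; lia.
Qed.

(** Both polynomials are compared with the interpolant of the parent's data one generation finer, of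
    which the data of the child and of the parent are blocks of size 1 and 2. *)
Lemma lpoly_child : (0 < k)%N ->
  exists2 C : R, 0 <= C & forall f K s x E, mu.-integrable setT (EFin \o f) ->
  dyadic_cube K x -> 0 <= E ->
  (forall w c, size w = k -> (forall i, c i <= 2 ^ r + b + 2 * k)%N ->
    `|wdif w (cell_data r.+1 f K) c| <= E) ->
  `|lpoly f (dchild K s) x - lpoly f K x| <= C * E.
Proof.
(* [M] bounds the grid positions that are read, and [X] the coordinates of the points of [K] in all
   grids involved; [x] may lie outside the child. *)
move=> k0; pose M := (2 ^ r + b + 2 * k)%N; pose X : R := 2 ^+ r.+1 + b%:R.
have X0 : 0 <= X by rewrite addr_ge0 ?exprn_ge0.
have kM : (k <= M.+1)%N by rewrite /M; lia.
have [C1 C10 H1] := interp_block_close (R := R) (I := 'I_d) kM (ltn0Sn 0) X0.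
have [C2 C20 H2] := interp_block_close (R := R) (I := 'I_d) kM (ltn0Sn 1) X0.
exists (C1 + C2); first by rewrite addr_ge0.
move=> f K s x E fi /dyadic_cubeE xK E0 wE.
set F := cell_data r.+1 f K.
pose zeta i : R := 2 ^+ (K.1 + r.+1) * (tnth x i : R) - (2 ^+ r.+1 * tnth K.2 i)%:~R - b%:R.
have p : (0 : R) < 2 ^+ K.1 by rewrite exprn_gt0.
have pr : (1 : R) <= 2 ^+ r by rewrite exprn_ege1 // ler1n.
have x2 i : 0 <= 2 ^+ K.1 * (tnth x i : R) - (tnth K.2 i)%:~R <= 1.
  have /andP[h1 h2] := xK i; move: h1 h2.
  rewrite mulrC ler_pdivrMr // => h1; rewrite mulrC ltr_pdivlMr // intrD => h2.
  by apply/andP; split; lra.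
have i2 q i : (2 ^+ q * tnth K.2 i)%:~R = 2 ^+ q * (tnth K.2 i)%:~R :> R.
  by rewrite intrM rmorphXn.
set u := fun i => 2 ^+ K.1 * (tnth x i : R) - (tnth K.2 i)%:~R in x2.
have zE i : zeta i = 2 ^+ r.+1 * u i - b%:R by rewrite /zeta i2 exprD /u; ring.
have b0 : 0 <= b%:R :> R by [].
have qu i : 0 <= 2 ^+ r * u i <= 2 ^+ r.
  have /andP[u0 u1] := x2 i; rewrite mulr_ge0 ?exprn_ge0 //=.
  by rewrite ler_piMr // exprn_ge0.
have zX i : `|zeta i| <= X.
  have /andP[u0 u1] := qu i.
  rewrite zE /X ler_norml exprS; apply/andP; split; lra.
have HC : `|lpoly f (dchild K s) x - interp k F zeta| <= C1 * E.
  rewrite /lpoly cell_data_child; set xi := (fun i => _ - _).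
  have xiE i : xi i = 2 ^+ r.+1 * u i - (s i * 2 ^ r)%:R - b%:R.
    rewrite /xi /= tnth_mktuple natrM natrX.
    have -> : (2 ^+ r * (2 * tnth K.2 i + s i))%:~R =
        2 ^+ r * (2 * (tnth K.2 i)%:~R + (s i)%:R) :> R.
      by rewrite intrM rmorphXn intrD intrM.
    rewrite /u !exprD !exprS; case: (s i) => /=; ring.
  have zxi : zeta = (fun i => (s i * 2 ^ r)%:R + 1%:R * xi i).
    by apply/funext => i; rewrite xiE zE; ring.
  rewrite zxi; apply: H1 => // i; last by move/(congr1 (@^~ i)): zxi => /= <-.
    by rewrite mul1n addn0 /M; case: (s i); lia.
  have /andP[u0 u1] := qu i.
  rewrite xiE /X ler_norml exprS natrM natrX.
  by case: (s i) => /=; apply/andP; split; lra.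
have HP : `|lpoly f K x - interp k F zeta| <= C2 * E.
  rewrite /lpoly cell_data_parent //; set xi := (fun i => _ - _).
  have xiE i : xi i = 2 ^+ r * u i - b%:R by rewrite /xi /= i2 exprD /u; ring.
  have zxi : zeta = (fun i => b%:R + 2%:R * xi i).
    by apply/funext => i; rewrite xiE zE exprS; ring.
  rewrite zxi; apply: H2 => // i; last by move/(congr1 (@^~ i)): zxi => /= <-.
    by rewrite /M; lia.
  have /andP[u0 u1] := qu i.
  by rewrite xiE /X ler_norml exprS; apply/andP; split; lra.
rewrite mulrDl; apply: le_trans (lerD HC HP); rewrite (distrC (lpoly f K x)).
exact: ler_distD.
Qed.

End local_polynomials.

Section weights.
Context {R : realType} {d : nat}.
Local Notation mu := (lebesgue d : {sigma_finite_measure set (euclid R d) -> \bar R}).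
Local Notation U := (unit_cube : set (euclid R d)).
Local Notation code := (dyadic_code (d := d)).
Implicit Types (K L : code) (c : 'I_d -> nat) (x y : euclid R d) (f : euclid R d -> R).

Lemma wdif_Rintegral (D : set (euclid R d)) (G : ('I_d -> nat) -> euclid R d -> R) w c :
  measurable D -> (forall c, mu.-integrable D (EFin \o G c)) ->
  mu.-integrable D (EFin \o (fun y => wdif w (G ^~ y) c)) /\
  wdif w (fun c => Rintegral mu D (G c)) c = Rintegral mu D (fun y => wdif w (G ^~ y) c).
Proof.
move=> mD iG; elim: w c => [|i w IH] c //=.
have [i1 e1] := IH (step i c); have [i2 e2] := IH c.
split; last by rewrite e1 e2 RintegralB.
rewrite (_ : EFin \o _ = (EFin \o (fun y => wdif w (G ^~ y) (step i c))) \-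
  (EFin \o (fun y => wdif w (G ^~ y) c)))%E; last by apply/funext => y; rewrite /= EFinB.
exact: integrableB.
Qed.

Lemma Rintegral_sum (D : set (euclid R d)) (T : Type) (s : seq T) (H : T -> euclid R d -> R) :
  measurable D -> (forall t, mu.-integrable D (EFin \o H t)) ->
  mu.-integrable D (EFin \o (fun y => \sum_(t <- s) H t y)) /\
  Rintegral mu D (fun y => \sum_(t <- s) H t y) = \sum_(t <- s) Rintegral mu D (H t).
Proof.
move=> mD iH; split.
  rewrite (_ : EFin \o _ = fun y => (\sum_(t <- s) (EFin \o H t) y)%E).
    exact: integrable_sum.
  by apply/funext => y; rewrite /= sumEFin.
elim: s => [|t s IH].
  rewrite big_nil; under eq_Rintegral do rewrite big_nil.
  by rewrite Rintegral_cst // mul0r.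
under eq_Rintegral do rewrite big_cons.
rewrite big_cons -IH RintegralD //.
rewrite (_ : EFin \o _ = fun y => (\sum_(t <- s) (EFin \o H t) y)%E).
  exact: integrable_sum.
by apply/funext => y; rewrite /= sumEFin.
Qed.

Definition tup (v : 'rV[R]_d) : euclid R d := [tuple v ord0 i | i < d].

Definition unit_step J (i : 'I_d) : 'rV[R]_d := 2 ^- J *: delta_mx ord0 i.

Definition lattice_vec J c : 'rV[R]_d := \row_i (2 ^- J * (c i)%:R).

Fixpoint ocnt (s : seq bool) (w : seq 'I_d) : 'I_d -> nat :=
  match s, w with
  | e :: s', i :: w' => fun t => ((e && (t == i)) + ocnt s' w' t)%N
  | _, _ => fun=> 0%N
  end.

Lemma ocnt_le s w t : (ocnt s w t <= size w)%N.
Proof.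
elim: s w => [|e s IH] [|i w] //=; have := IH w.
by case: (e && _) => /=; lia.
Qed.

Lemma lattice_vec_step J i c : lattice_vec J (step i c) = lattice_vec J c + unit_step J i.
Proof.
apply/rowP => t; rewrite !mxE eqxx /= natrD mulrDr; congr (_ + _).
Qed.

Lemma osum_unit_step J s w : osum s (map (unit_step J) w) = lattice_vec J (ocnt s w).
Proof.
elim: s w => [|e s IH] [|i w] /=; try by apply/rowP => t; rewrite !mxE mulr0.
rewrite IH; apply/rowP => t; rewrite !mxE natrD mulrDr; congr (_ + _).
case: e; rewrite !mxE ?eqxx /= ?mulr0 //.
Qed.

Lemma osum_bounds (l : seq 'rV[R]_d) s (B : R) i : 0 <= B ->
  (forall v, v \in l -> 0 <= v ord0 i <= B) ->
  0 <= osum s l ord0 i <= (size l)%:R * B.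
Proof.
move=> B0; elim: s l => [|e s IH] [|v l] lB /=; rewrite ?mxE ?lexx ?mul0r ?mulr_ge0 ?lexx //.
have /andP[h1 h2] : 0 <= osum s l ord0 i <= (size l)%:R * B.
  by apply: IH => u ul; apply: lB; rewrite inE ul orbT.
have /andP[v1 v2] := lB v (mem_head _ _).
have -> : (size l).+1%:R * B = B + (size l)%:R * B by rewrite mulrS mulrDl mul1r.
case: e; rewrite ?mxE; apply/andP; split; lra.
Qed.

Definition pure_step J (w : seq 'I_d) s : euclid R d :=
  tup (- osum s (harmonic (map (unit_step J) w))).

(** Every vector of the harmonic list has coordinates between 0 and [2 ^- J]. The sign of the step
    decides that room is needed only on the lower sides of the cells. *)
Lemma pure_step_bounds J w s i :
  - ((size w)%:R * 2 ^- J) <= (tnth (pure_step J w s) i : R) <= 0.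
Proof.
rewrite tnth_mktuple mxE oppr_le0 lerN2 andbC.
have -> : size w = size (harmonic (map (unit_step J) w)) by rewrite size_map size_iota size_map.
have p : (0 : R) <= 2 ^- J by rewrite invr_ge0 exprn_ge0.
apply: osum_bounds => // v /mapP[t]; rewrite mem_iota size_map add0n => /= tw ->.
case: w tw => // i0 w tw.
rewrite !mxE (nth_map i0) // !mxE eqxx /=.
case: eqP => _; rewrite ?mulr0 ?lexx // mulr1.
rewrite mulr_ge0 ?invr_ge0 //= ler_piMl // invf_le1 ?ltr0n // ler1n //.
Qed.

Lemma shift_cube J (a : d.-tuple int) c v :
  (forall i, (tnth v i : R) = 2 ^- J * (c i)%:R) ->
  shift v @^-1` dyadic_cube (J, [tuple tnth a i + (c i)%:Z | i < d]) =
  (dyadic_cube (J, a) : set (euclid R d)).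
Proof.
move=> vc; apply/seteqP; split=> x /=; rewrite !dyadic_cubeE /= => + i => /(_ i).
  rewrite !tnth_mktuple vc !intrD !mulrDr => /andP[h1 h2]; apply/andP; split; lra.
by rewrite !tnth_mktuple vc !intrD !mulrDr => /andP[h1 h2]; apply/andP; split; lra.
Qed.

Lemma integrable_shift f v : mu.-integrable setT (EFin \o f) ->
  mu.-integrable setT (EFin \o (f \o shift v)).
Proof.
move=> /integrableP[mf fi]; apply/integrableP; split.
  exact: (measurableT_comp mf (measurable_shift v)).
apply: le_lt_trans fi.
by rewrite -[X in (_ <= X)%E](ge0_integral_shift v) //; exact: measurableT_comp.
Qed.

Lemma translate_shift x j h :
  translate x j h = shift [tuple j%:R * (tnth h i : R) | i < d] x.
Proof. by apply: eq_from_tnth => i; rewrite !tnth_mktuple. Qed.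

Lemma integrable_difference k h f : mu.-integrable setT (EFin \o f) ->
  mu.-integrable setT (EFin \o difference k h f).
Proof.
move=> fi.
rewrite (_ : EFin \o _ = fun x => (\sum_(j < k.+1) ((-1) ^+ (k - j) * 'C(k, j)%:R)%:E *
    (EFin \o (f \o shift [tuple ((j : nat)%:R * (tnth h i : R))%R | i < d])) x)%E); last first.
  apply/funext => x; rewrite /= /difference -sumEFin; apply: eq_bigr => j _.
  by rewrite EFinM translate_shift.
apply: integrable_sum => // j _; apply: integrableZl => //.
exact: integrable_shift.
Qed.

(** By translation all the means become integrals over the single cube [L0] of translates of [f];
    the difference passes under the integral, where Kemperman's identity applies pointwise. Each
    term is then translated back to its own cell. *)
Lemma wdif_cell_data_le q b k f K w c : mu.-integrable setT (EFin \o f) -> size w = k ->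
  `|wdif w (cell_data b q f K) c| <=
  \sum_(s <- bits k) 2 ^+ ((K.1 + q) * d) *
    Rintegral mu (dyadic_cube (cell q K (fun i => b + c i + ocnt s w i)%N))
      (fun x => `|difference k (pure_step (K.1 + q) w s) f x|).
Proof.
move=> fi wk; set J := (K.1 + q)%N.
have mf : measurable_fun setT f by apply/measurable_EFinP; exact: measurable_int fi.
pose L0 := cell q K (fun=> b).
pose G c' y := f (shift (tup (lattice_vec J c')) y).
have mL0 : measurable (dyadic_cube L0 : set (euclid R d)) by exact: measurable_dyadic_cube.
have cubeE c' : shift (tup (lattice_vec J c')) @^-1` dyadic_cube (cell q K (fun i => b + c' i)%N) =
    (dyadic_cube L0 : set (euclid R d)).
  rewrite -(@shift_cube J L0.2 c' (tup (lattice_vec J c'))); last first.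
    by move=> i; rewrite tnth_mktuple mxE.
  congr (_ @^-1` dyadic_cube (_, _)); apply: eq_from_tnth => i; rewrite !tnth_mktuple.
  by rewrite PoszD addrA.
have GE c' : cell_data b q f K c' = 2 ^+ (J * d) * Rintegral mu (dyadic_cube L0) (G c').
  rewrite /cell_data /avg; congr (_ * fine _).
  rewrite -(integral_shift (tup (lattice_vec J c'))) ?cubeE //.
    exact: measurable_dyadic_cube.
  exact/measurable_EFinP.
have Gi c' : mu.-integrable (dyadic_cube L0) (EFin \o G c').
  by apply: integrableS (integrable_shift _ fi).
have wE : wdif w (cell_data b q f K) c =
    2 ^+ (J * d) * Rintegral mu (dyadic_cube L0) (fun y => wdif w (G ^~ y) c).
  have [_ <-] := wdif_Rintegral w c mL0 Gi.
  elim: (w) c => [|i w' IH] c' /=; first by rewrite GE.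
  by rewrite !IH mulrBr.
have kemp y : (-1) ^+ k * wdif w (G ^~ y) c = \sum_(s <- bits k) (-1) ^+ (count negb s) *
    difference k (pure_step J w s) f (shift (tup (lattice_vec J (fun i => c i + ocnt s w i)%N)) y).
  pose Phi v := f (shift (tup v) y).
  rewrite -[G ^~ y]/(fun c => Phi (lattice_vec J c)).
  rewrite (wdif_vdif w Phi (e := unit_step J)); last exact: lattice_vec_step.
  have := kemperman (map (unit_step J) w) Phi (lattice_vec J c).
  rewrite size_map wk => ->; apply: eq_bigr => s _; congr (_ * _).
  apply: eq_bigr => j _; congr (_ * f _); apply: eq_from_tnth => i.
  rewrite !tnth_mktuple !mxE osum_unit_step !mxE natrD; ring.
have mD s : measurable_fun setT (difference k (pure_step J w s) f).
  by apply/measurable_EFinP; exact: measurable_int (integrable_difference _ _ fi).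
rewrite wE normrM ger0_norm ?exprn_ge0 // -mulr_sumr ler_wpM2l ?exprn_ge0 //.
apply: le_trans (le_normr_Rintegral mL0 (wdif_Rintegral w c mL0 Gi).1) _.
pose H s y := `|difference k (pure_step J w s) f
   (shift (tup (lattice_vec J (fun i => c i + ocnt s w i)%N)) y)|.
have Hi s : mu.-integrable (dyadic_cube L0) (EFin \o H s).
  have := integrable_shift (tup (lattice_vec J (fun i => c i + ocnt s w i)%N))
    (integrable_difference k (pure_step J w s) fi).
  by move=> /(integrableS measurableT mL0 (@subsetT _ _)) /integrable_norm.
have HE s : Rintegral mu (dyadic_cube (cell q K (fun i => b + c i + ocnt s w i)%N))
      (fun x => `|difference k (pure_step J w s) f x|) =
    Rintegral mu (dyadic_cube L0) (H s).
  rewrite /Rintegral; congr fine.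
  rewrite -(integral_shift (tup (lattice_vec J (fun i => c i + ocnt s w i)%N))).
  - rewrite -(cubeE (fun i => c i + ocnt s w i)%N); congr (integral _ (_ @^-1` dyadic_cube (_, _)) _).
    by apply: eq_from_tnth => i; rewrite !tnth_mktuple addnA.
  - exact: measurable_dyadic_cube.
  - by apply/measurable_EFinP; exact: measurableT_comp.
under [leRHS]eq_bigr do rewrite HE.
have Wi := (wdif_Rintegral w c mL0 Gi).1.
have [Si <-] := Rintegral_sum (bits k) mL0 Hi.
apply: (le_Rintegral mL0 (integrable_norm Wi) Si) => y _ /=.
rewrite -[leLHS]mul1r -[X in X * _](expr1n R k) -(normrN1 R) -normrX -normrM.
rewrite kemp; apply: le_trans (ler_norm_sum _ _ _) _; apply: ler_sum => s _.
by rewrite normrM normrX normrN1 expr1n mul1r.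
Qed.

End weights.

(** * Weights summed over one generation *)

Section weight_sum.
Context {R : realType} {d : nat}.
Local Notation mu := (lebesgue d : {sigma_finite_measure set (euclid R d) -> \bar R}).
Local Notation U := (unit_cube : set (euclid R d)).
Local Notation code := (dyadic_code (d := d)).
Implicit Types (K L : code) (c : 'I_d -> nat) (x y : euclid R d) (f g : euclid R d -> R).

Lemma measurable_difference_dom k (h : euclid R d) : measurable (difference_dom k h).
Proof.
rewrite (_ : difference_dom k h = \bigcap_(j in `I_k.+1)
    (shift [tuple j%:R * (tnth h i : R) | i < d] @^-1` U)); last first.
  by apply/seteqP; split=> x xk j jk; move: (xk j jk); rewrite translate_shift.
apply: fin_bigcap_measurable => // j _; rewrite -[_ @^-1` _]setTI.
by apply: measurable_shift => //; exact: measurable_unit_cube.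
Qed.

(** If [a > s] then [a / s <= (a / s) ^ p]. Integrated with a suitable [s], this yields Hoelder's
    inequality up to a factor 2. *)
Lemma le_add_powR (a s p : R) : 0 <= a -> 0 < s -> 1 <= p ->
  a <= s + s / s `^ p * a `^ p.
Proof.
move=> a0 s0 p1; have [as_|sa] := leP a s.
  by rewrite ler_wpDr // mulr_ge0 ?divr_ge0 ?powR_ge0 // ltW.
rewrite ler_wpDl ?(ltW s0) //.
rewrite -mulrA -ler_pdivrMl // mulrC [leRHS]mulrC.
have -> : a `^ p / s `^ p = (a / s) `^ p.
  have -> : a `^ p = (a / s) `^ p * s `^ p.
    by rewrite -powRM ?divr_ge0 ?(ltW s0) // divfK // gt_eqF.
  by rewrite mulfK // gt_eqF // powR_gt0.
rewrite -[leLHS]powRr1 ?divr_ge0 // ?(ltW s0) //; apply: ler_powR => //.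
by rewrite ler_pdivlMr // mul1r ltW.
Qed.

Lemma integral_le_Lnorm (V D : set (euclid R d)) g (p m w : R) :
  measurable V -> measurable D -> V `<=` D -> measurable_fun setT g ->
  1 <= p -> 0 < m -> 0 < w -> mu V = m%:E -> (Lnorm_on D p%:E g <= w%:E)%E ->
  (\int[mu]_(x in V) `|g x|%:E <= (2 * (w * (m * m `^ (- p^-1))))%:E)%E.
Proof.
move=> mV mD VD mg p1 m0 w0 Vm gw.
have p0 : 0 < p by exact: lt_le_trans p1.
have G : (\int[mu]_(x in V) (`|g x| `^ p)%:E <= (w `^ p)%:E)%E.
  have : (Lnorm_on D p%:E g `^ p <= w%:E `^ p)%E.
    apply: (gt0_ler_poweR (ltW p0)) gw.
      by rewrite in_itv /= leey Lnorm_ge0.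
    by rewrite in_itv /= leey lee_fin ltW.
  rewrite /Lnorm_on poweR_Lnorm ?(lt0r_neq0 p0) // poweR_EFin; apply: le_trans.
  rewrite [leLHS]integral_mkcond.
apply: ge0_le_integral => //.
  - by move=> x _; rewrite erestrict_ge0 // => y _; rewrite lee_fin powR_ge0.
  - apply/(measurable_restrictT _ mV); apply: measurable_funTS; apply/measurable_EFinP.
    exact: (measurableT_comp (measurable_powR _) (measurableT_comp (@normr_measurable R setT) mg)).
  - apply: (measurableT_comp (measurable_poweR _)); apply: measurableT_comp => //.
    apply/measurable_EFinP; apply/(measurable_restrictT _ mD); exact: measurable_funTS.
  move=> x _; rewrite !patchE /=; case: ifPn => [/set_mem /VD xD|_].
    by rewrite patchE mem_set //= poweR_EFin.
  by rewrite [point]/(0%E) lee_fin powR_ge0.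
(* For this [s] the two integrated terms [s * m] and [s / s ^ p * w ^ p] coincide, whence the factor
   2. *)
pose s := w * m `^ (- p^-1).
have s0 : 0 < s by rewrite mulr_gt0 // powR_gt0.
have sp : s / s `^ p * w `^ p = s * m.
  rewrite /s powRM ?powR_ge0 ?(ltW w0) // -powRrM mulNr mulVf ?gt_eqF // powR_inv1 ?(ltW m0) //.
  by field; rewrite !gt_eqF ?powR_gt0 // .
have mgV : measurable_fun V (fun x => `|g x|).
  by apply: measurable_funTS; exact: (measurableT_comp (@normr_measurable R setT) mg).
have mgp : measurable_fun V (fun x => `|g x| `^ p).
  exact: (measurableT_comp (measurable_powR _) mgV).
apply: (@le_trans _ _ (\int[mu]_(x in V) (s%:E + (s / s `^ p)%:E * (`|g x| `^ p)%:E))%E).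
  apply: ge0_le_integral => //.
  - exact/measurable_EFinP.
  - apply: emeasurable_funD => //; apply: measurable_funeM; exact/measurable_EFinP.
  - by move=> x _; rewrite -EFinM -EFinD lee_fin le_add_powR.
have c0 : 0 <= s / s `^ p by rewrite divr_ge0 ?powR_ge0 // ltW.
rewrite ge0_integralD //; last 3 first.
- by move=> x _; rewrite lee_fin ltW.
- by move=> x _; rewrite mule_ge0 ?lee_fin ?powR_ge0.
- by apply: measurable_funeM; exact/measurable_EFinP.
rewrite integral_cst // ge0_integralZl_EFin //; last first.
  exact/measurable_EFinP.
apply: (@le_trans _ _ (s%:E * m%:E + (s / s `^ p)%:E * (w `^ p)%:E)%E).
  have Vm' : (mu V <= m%:E)%E by rewrite Vm.
  apply: leeD; apply: lee_wpmul2l => //; first by rewrite lee_fin ltW.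
rewrite -!EFinM -EFinD lee_fin sp le_eqVlt; apply/orP; left; apply/eqP.
by rewrite /s; ring.
Qed.

Lemma lattice_bounds (j q b n : nat) (a : int) : 0 <= a < 2 ^+ j -> (b <= n < 2 ^ q)%N ->
  b%:Z <= 2 ^+ q * a + n%:Z < 2 ^+ (j + q).
Proof.
move=> /andP[a0 aj] /andP[bn nq]; have q0 : (0 : int) <= 2 ^+ q by rewrite exprn_ge0.
apply/andP; split; first by rewrite ler_wpDl ?mulr_ge0.
apply: (@lt_le_trans _ _ (2 ^+ q * (a + 1))).
  by rewrite mulrDr mulr1 ltrD2l -(_ : ((2 ^ q)%N : int) = 2 ^+ q) // -natz natrX.
by rewrite addnC exprD ler_wpM2l // lezD1.
Qed.

(** The points [x + l h] with [l <= k] never move up, and move down by at most [k * k] cell sides,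
    which the offset [b] allows; the bound by [2 ^ q] keeps the cell itself inside the unit cube. *)
Lemma cell_sub_difference_dom q b k K c w s j : K \in dlevel j -> size w = k ->
  (k * k <= b)%N -> (forall i, b + c i + k < 2 ^ q)%N ->
  dyadic_cube (cell q K (fun i => b + c i + ocnt s w i)%N) `<=`
  difference_dom k (pure_step (j + q) w s : euclid R d).
Proof.
move=> Kj wk kb cq x /dyadic_cubeE xL l lk i.
have Kb := dlevel_bounds i Kj.
have /andP[x1 x2] := xL i; rewrite /= tnth_mktuple (dlevel1 Kj) in x1 x2.
have /andP[h1 h2] := pure_step_bounds (j + q) w s i (R := R).
rewrite tnth_mktuple; rewrite wk in h1.
set h := tnth (pure_step _ _ _) i in h1 h2 *.
have p : (0 : R) < 2 ^+ (j + q) by rewrite exprn_gt0.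
set e : R := 2 ^- (j + q) in x1 x2 h1.
have e0 : 0 < e by rewrite invr_gt0.
have l0 : (0 : R) <= l%:R by [].
have lk' : (l%:R : R) <= k%:R by rewrite ler_nat.
have lh1 : - (k%:R * (k%:R * e)) <= l%:R * h.
  have : l%:R * - h <= k%:R * (k%:R * e) by apply: ler_pM => //; lra.
  by rewrite mulrN; lra.
have lh2 : l%:R * h <= 0 by rewrite mulr_ge0_le0.
have kbR : (k%:R * k%:R : R) <= b%:R by rewrite -natrM ler_nat.
have oc := ocnt_le s w i; rewrite wk in oc.
set z : int := (2 ^+ q * tnth K.2 i + (b + c i + ocnt s w i)%N) in x1 x2.
have zb : (b%:Z <= z < 2 ^+ (j + q)).
  by apply: lattice_bounds => //; rewrite -addnA leq_addr (leq_ltn_trans _ (cq i)) // addnA leq_add2l.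
move: zb => /andP[z1 z2].
have z1R : (b%:R : R) <= z%:~R by rewrite -[b%:R]/(b%:Z%:~R) ler_int.
have z2R : ((z + 1)%:~R : R) <= 2 ^+ (j + q).
  have -> : (2 : R) ^+ (j + q) = ((2 : int) ^+ (j + q))%:~R by rewrite rmorphXn.
  by rewrite ler_int lezD1.
have ex : e * 2 ^+ (j + q) = 1 by rewrite mulVf // gt_eqF.
have a1 : e * b%:R <= e * z%:~R by rewrite ler_pM2l.
have a2 : e * (z + 1)%:~R <= 1 by rewrite -[leRHS]ex ler_pM2l.
have a3 : e * (k%:R * k%:R) <= e * b%:R by rewrite ler_pM2l.
apply/andP; split; last by lra.
have : k%:R * (k%:R * e) = e * (k%:R * k%:R) :> R by ring.
by move=> ?; lra.
Qed.

(** Each coordinate is at most [k] cell sides in absolute value, hence the norm at most [d * k] of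
    them, which fit into [2 ^- j.+1]. *)
Lemma enorm_pure_step q k w s j : size w = k -> (d * k * 2 <= 2 ^ q)%N ->
  enorm (pure_step (j + q) w s : euclid R d) <= 2 ^- j.+1.
Proof.
move=> wk dk; set B : R := k%:R * 2 ^- (j + q).
have B0 : 0 <= B by rewrite mulr_ge0 // invr_ge0 exprn_ge0.
apply: (@le_trans _ _ (Num.sqrt ((d%:R * B) ^+ 2))).
  rewrite ler_wsqrtr // exprMn.
  apply: (@le_trans _ _ (\sum_(i < d) B ^+ 2)).
    apply: ler_sum => i _; have /andP[h1 h2] := pure_step_bounds (j + q) w s i (R := R).
    rewrite -[X in X <= _]sqrrN; apply: lerXn2r; rewrite ?nnegrE ?oppr_ge0 //.
    by rewrite wk in h1; rewrite /B; lra.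
  rewrite sumr_const card_ord -[leLHS]mulr_natl ler_wpM2r ?exprn_ge0 //.
  by rewrite -natrX ler_nat; case: (d) => // n; rewrite leq_pmulr.
rewrite sqrtr_sqr ger0_norm ?mulr_ge0 // /B mulrA -natrM.
rewrite ler_pdivrMr ?exprn_gt0 //.
have -> : 2 ^- j.+1 * 2 ^+ (j + q) = 2 ^+ q / 2 :> R.
  by rewrite exprS exprD; field; rewrite gt_eqF ?exprn_gt0.
by rewrite ler_pdivlMr // -natrX -natrM ler_nat.
Qed.

End weight_sum.

Section modulus_weights.
Context {R : realType} {d : nat}.
Local Notation mu := (lebesgue d : {sigma_finite_measure set (euclid R d) -> \bar R}).
Local Notation code := (dyadic_code (d := d)).
Variables (k q b M : nat) (p : R).
Hypotheses (p1 : 1 <= p) (kb : (k * k <= b)%N) (bM : (b + M + k < 2 ^ q)%N)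
  (dk : (d * k * 2 <= 2 ^ q)%N).
Implicit Types (K L : code) (f : euclid R d -> R) (S : seq code).

Lemma cell_inj c : injective (@cell d q ^~ c).
Proof.
move=> K K' E; apply: code_eqP; first by move: (congr1 fst E) => /= /addIn.
move=> i; move: (congr1 (fun L : code => tnth L.2 i) E); rewrite !tnth_mktuple.
by move=> /addIr /mulfI; apply; rewrite expf_neq0.
Qed.

Lemma measure_bigsetU_seq (T : choiceType) (s : seq T) (F : T -> set (euclid R d)) :
  (forall t, measurable (F t)) -> uniq s -> trivIset [set` s] F ->
  mu (\big[setU/set0]_(t <- s) F t) = (\sum_(t <- s) mu (F t))%E.
Proof.
move=> mF us tF; have mV : measurable (\big[setU/set0]_(t <- s) F t).
  by apply: bigsetU_measurable.
rewrite -[LHS]mul1e -integral_cst // ge0_integral_bigsetU //.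
by apply: eq_bigr => t _; rewrite integral_cst // mul1e.
Qed.

(** For fixed [w], [c] and [s] the cells attached to the cubes of [S] are disjoint and of equal
    size, so the sum is one integral over a set of measure [size S * 2 ^- ((j + q) * d)]. Hoelder's
    inequality on it gives the power of [size S]; the cell volume and the normalising factor combine
    to the power [1/p] of [2 ^ ((j + q) * d)]. *)
Lemma cell_sum f j S (w : seq 'I_d) (c : 'I_d -> nat) s (om : R) :
  mu.-integrable setT (EFin \o f) -> uniq S -> {subset S <= dlevel j} ->
  size w = k -> (forall i, c i <= M)%N -> 0 < om ->
  (modulus_of_continuity k p (2 ^- j.+1) f <= om%:E)%E ->
  2 ^+ ((j + q) * d) *
    \sum_(K <- S) Rintegral mu (dyadic_cube (cell q K (fun i => b + c i + ocnt s w i)%N))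
      (fun x => `|difference k (pure_step (j + q) w s) f x|) <=
  2 * om * ((size S)%:R * (size S)%:R `^ (- p^-1)) * (2 ^+ ((j + q) * d)) `^ p^-1.
Proof.
move=> fi uS Sj wk cM om0 mo.
have p0 : 0 < p by exact: lt_le_trans p1.
have [S0|Sn0] := posnP (size S).
  by rewrite (size0nil S0) big_nil mulr0 !mulr_ge0 ?powR_ge0 // ltW.
pose g := difference k (pure_step (j + q) w s) f.
have gi : mu.-integrable setT (EFin \o g) by exact: integrable_difference.
have mg : measurable_fun setT g by apply/measurable_EFinP; exact: measurable_int gi.
pose L K := cell q K (fun i => b + c i + ocnt s w i)%N.
pose V : set (euclid R d) := \big[setU/set0]_(K <- S) dyadic_cube (L K).
have mL K : measurable (dyadic_cube (L K) : set (euclid R d)) by exact: measurable_dyadic_cube.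
have mV : measurable V by exact: bigsetU_measurable.
have tL : trivIset [set` S] (fun K => dyadic_cube (L K) : set (euclid R d)).
  apply: trivIset_dyadic_cube; first exact: cell_inj.
  by move=> K K' /= /Sj /dlevel1 -> /Sj /dlevel1 ->.
have muV : mu V = ((size S)%:R * 2 ^- ((j + q) * d))%:E.
  rewrite /V measure_bigsetU_seq //.
  rewrite big_seq (eq_bigr (fun=> (2 ^- ((j + q) * d))%:E)); last first.
    by move=> K KS; rewrite [LHS]lebesgue_dyadic_cube /= (dlevel1 (Sj _ KS)).
  by rewrite -big_seq sumEFin big_const_seq count_predT iter_addr addr0 mulr_natl.
have VD : V `<=` difference_dom k (pure_step (j + q) w s).
  rewrite /V big_seq; apply: (big_ind (fun X => X `<=` _)) => //.
    by move=> X Y XD YD x [/XD|/YD].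
  move=> K KS; apply: cell_sub_difference_dom => //; first exact: Sj.
  by move=> i; have := cM i; move: bM; lia.
have gom : (Lnorm_on (difference_dom k (pure_step (j + q) w s)) p%:E g <= om%:E)%E.
  apply: le_trans mo; apply: ereal_sup_ubound; exists (pure_step (j + q) w s) => //=.
  by apply: enorm_pure_step wk _.
pose m : R := (size S)%:R * 2 ^- ((j + q) * d).
have m0 : 0 < m by rewrite mulr_gt0 ?ltr0n ?invr_gt0 ?exprn_gt0.
have := integral_le_Lnorm mV (measurable_difference_dom _ _) VD mg p1 m0 om0 muV gom.
have mgn (A : set (euclid R d)) : measurable A -> measurable_fun A (fun x => `|g x|%:E).
  move=> mA; apply/measurable_EFinP; apply: measurable_funTS.
  exact: (measurableT_comp (@normr_measurable R setT) mg).
rewrite ge0_integral_bigsetU //; last exact: mgn.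
have Lf K : (\int[mu]_(x in dyadic_cube (L K)) `|g x|%:E)%E \is a fin_num.
  apply: integrable_fin_num => //; apply: integrable_norm.
  by apply: integrableS gi.
rewrite -(@EFin_sum_fine _ _ _ predT) => [|K _]; last exact: Lf.
rewrite lee_fin => H.
apply: (@le_trans _ _ (2 ^+ ((j + q) * d) * (2 * (om * (m * m `^ (- p^-1)))))).
  by rewrite ler_wpM2l ?exprn_ge0.
have P0 : (0 : R) < 2 ^+ ((j + q) * d) by rewrite exprn_gt0.
have E : m `^ (- p^-1) = (size S)%:R `^ (- p^-1) * (2 ^+ ((j + q) * d)) `^ p^-1.
  rewrite /m powRM ?invr_ge0 ?(ltW P0) //; congr (_ * _).
  rewrite -powR_inv1 ?(ltW P0) // -powRrM mulrNN mul1r //.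
rewrite E /m le_eqVlt; apply/orP; left; apply/eqP; field.
by rewrite gt_eqF.
Qed.

(** All differences of order [k] in the box, added up: a sum, in place of a maximum, can be
    exchanged with the sum over the cubes. *)
Definition weight (C : R) f K : R :=
  C * \sum_(w : k.-tuple 'I_d) \sum_(c : {ffun 'I_d -> 'I_M.+1})
    `|wdif w (cell_data b q f K) (ncoord c)|.

Lemma weight_ge0 C f K : 0 <= C -> 0 <= weight C f K.
Proof. by move=> C0; rewrite mulr_ge0 // !sumr_ge0 // => w _; rewrite sumr_ge0. Qed.

Lemma wdif_le_weight f K w c : size w = k -> (forall i, c i <= M)%N ->
  `|wdif w (cell_data b q f K) c| <= weight 1 f K.
Proof.
move=> wk cM; rewrite /weight mul1r.
have wkb : size w == k by rewrite wk.
pose c0 : {ffun 'I_d -> 'I_M.+1} := [ffun i => inord (c i)].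
have cE : ncoord c0 = c by apply/funext => i; rewrite /ncoord ffunE inordK // ltnS.
rewrite (bigD1 (Tuple wkb)) //= (bigD1 c0) //= cE -addrA lerDl addr_ge0 // !sumr_ge0 //.
by move=> t _; rewrite sumr_ge0.
Qed.

Definition weight_const : R :=
  \sum_(w : k.-tuple 'I_d) \sum_(c : {ffun 'I_d -> 'I_M.+1}) \sum_(s <- bits k) 2.

Lemma weight_sum C f j S (om : R) :
  0 <= C -> mu.-integrable setT (EFin \o f) -> uniq S -> {subset S <= dlevel j} -> 0 <= om ->
  (modulus_of_continuity k p (2 ^- j.+1) f <= om%:E)%E ->
  \sum_(K <- S) weight C f K <=
  C * weight_const * (om * ((size S)%:R * (size S)%:R `^ (- p^-1)) *
    (2 ^+ ((j + q) * d)) `^ p^-1).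
Proof.
move=> C0 fi uS Sj om0 mo; rewrite -mulr_sumr -mulrA ler_wpM2l //.
set n := (size S)%:R * _; set P := _ `^ p^-1.
have n0 : 0 <= n by rewrite mulr_ge0 ?powR_ge0.
have P0 : 0 <= P by rewrite powR_ge0.
have key o : 0 < o -> (modulus_of_continuity k p (2 ^- j.+1) f <= o%:E)%E ->
    \sum_(K <- S) \sum_(w : k.-tuple 'I_d) \sum_(c : {ffun 'I_d -> 'I_M.+1})
      `|wdif w (cell_data b q f K) (ncoord c)| <= weight_const * (o * n * P).
  move=> o0 fo; rewrite exchange_big mulr_suml; apply: ler_sum => w _.
  rewrite exchange_big mulr_suml; apply: ler_sum => c _.
  have cM i : (ncoord c i <= M)%N by exact: (ltn_ord (c i)).
  apply: (@le_trans _ _ (\sum_(K <- S) \sum_(s <- bits k) 2 ^+ ((j + q) * d) *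
    Rintegral mu (dyadic_cube (cell q K (fun i => b + ncoord c i + ocnt s w i)%N))
      (fun x => `|difference k (pure_step (j + q) w s) f x|))).
    rewrite !big_seq; apply: ler_sum => K KS.
    have := wdif_cell_data_le q b K (w := w) (ncoord c) fi (size_tuple w).
    by rewrite (dlevel1 (Sj _ KS)).
  rewrite exchange_big mulr_suml; apply: ler_sum => s _.
  rewrite -mulr_sumr !mulrA.
  by have := cell_sum s fi uS Sj (size_tuple w) cM o0 fo; rewrite -/n -/P mulrA.
have W0 : 0 <= weight_const by rewrite !sumr_ge0 // => w _; rewrite !sumr_ge0 // => c _; rewrite sumr_ge0.
(* The bound for a positive modulus is applied to [om + e / D], since [om] may be zero; [D] is
   chosen so that the excess is at most [e]. *)
apply/ler_addgt0Pr => e e0.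
pose D := weight_const * n * P + 1.
have D0 : 0 < D by rewrite ltr_wpDl // !mulr_ge0.
have oe : 0 < om + e / D by rewrite ltr_wpDl // divr_gt0.
apply: le_trans (key _ oe _) _.
  by apply: le_trans mo _; rewrite lee_fin lerDl divr_ge0 // ltW.
rewrite (_ : weight_const * _ = weight_const * (om * n * P) + (D - 1) * (e / D)); last first.
  by rewrite /D; ring.
rewrite lerD2l mulrBl mul1r mulrCA mulfV ?gt_eqF // mulr1 gerBl divr_ge0 // ltW //.
Qed.

End modulus_weights.

(** * Convergence in the mean *)

Section convergence.
Context {R : realType} {d : nat}.
Local Notation mu := (lebesgue d : {sigma_finite_measure set (euclid R d) -> \bar R}).
Local Notation U := (unit_cube : set (euclid R d)).
Local Notation code := (dyadic_code (d := d)).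
Variables (k r b : nat).
Hypotheses (k0 : (0 < k)%N) (bk : (b + k <= 2 ^ r)%N).
Implicit Types (K L : code) (f g : euclid R d -> R) (x : euclid R d).

Lemma interp_cst (a : R) (xi : 'I_d -> R) : interp k (fun=> a) xi = a.
Proof.
have E : interp k (binprod (fun=> 0%N)) xi = 1.
  rewrite -[X in interp _ X]block1 interp_block_binprod //; last by rewrite big1.
  rewrite big1 // => i _; rewrite add0r mul1r /phi.
  suff -> : binp 1 = 'X :> {poly R} by rewrite derivX hornerC.
  apply: (@poly_eq_nat _ 2); rewrite ?size_polyX ?size_binp // => c _.
  by rewrite binp_nat bin1 hornerX.
have -> : (fun=> a) = (fun c : 'I_d -> nat => \sum_(t <- [:: tt]) a * binprod (fun=> 0%N) c).
  by apply/funext => c; rewrite big_seq1 /binprod big1 ?mulr1 // => i _; rewrite bin0.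
by rewrite (interp_sum _ (fun=> a) (fun=> binprod (fun=> 0%N))) big_seq1 E mulr1.
Qed.

Lemma cell_sub q K (c : 'I_d -> nat) : (forall i, c i < 2 ^ q)%N ->
  dyadic_cube (cell q K c) `<=` (dyadic_cube K : set (euclid R d)).
Proof.
move=> cq x /dyadic_cubeE xL; apply/dyadic_cubeE => i.
have /andP[] := xL i; rewrite /= tnth_mktuple; set z := _ + _.
have p1 : (0 : R) < 2 ^+ K.1 by rewrite exprn_gt0.
have p2 : (0 : R) < 2 ^+ q by rewrite exprn_gt0.
have e (t : R) : 2 ^- K.1 * t = 2 ^- (K.1 + q) * (2 ^+ q * t).
  by rewrite exprD; field; rewrite !gt_eqF.
have p : (0 : R) < 2 ^- (K.1 + q) by rewrite invr_gt0 exprn_gt0.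
have q2 : ((2 ^ q)%N : int) = 2 ^+ q by rewrite -natz natrX.
have q2R : (2 : R) ^+ q = (2 ^+ q : int)%:~R by rewrite rmorphXn.
have ci := cq i.
move=> h1 h2; apply/andP; split.
  by apply: le_trans h1; rewrite e ler_pM2l // q2R -intrM ler_int /z; lia.
apply: lt_le_trans h2 _; rewrite e ler_pM2l // q2R -intrM ler_int /z -q2; nia.
Qed.

Lemma integrable_cube_cst K (a : R) :
  mu.-integrable (dyadic_cube K) (EFin \o (fun=> a)).
Proof.
have mK : measurable (dyadic_cube K : set (euclid R d)) by exact: measurable_dyadic_cube.
apply/integrableP; split; first exact/measurable_EFinP.
rewrite /= integral_cst // [X in (_ * X)%E](_ : _ = (2 ^- (K.1 * d))%:E) ?ltry //.
exact: lebesgue_dyadic_cube.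
Qed.

(** A constant is its own interpolant, so the difference interpolates the means of [f - a] over
    cells of [K]; each is at most [2 ^ (r * d)] times the mean of [|f - a|] over [K]. *)
Lemma lpoly_sub_cst : exists2 C : R, 0 <= C & forall f K x a,
  mu.-integrable setT (EFin \o f) -> dyadic_cube K x ->
  `|lpoly k r b f K x - a| <=
    C * (2 ^+ (K.1 * d) * Rintegral mu (dyadic_cube K) (fun y => `|f y - a|)).
Proof.
pose X : R := 2 ^+ r + b%:R.
have X0 : 0 <= X by rewrite addr_ge0 ?exprn_ge0.
have [C C0 CP] := interp_le (R := R) (I := 'I_d) (leqSpred k) X0.
exists (C * 2 ^+ (r * d)); first by rewrite mulr_ge0 ?exprn_ge0.
move=> f K x a fi /dyadic_cubeE xK.
have mK : measurable (dyadic_cube K : set (euclid R d)) by exact: measurable_dyadic_cube.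
rewrite -[X in `|_ - X| <= _](interp_cst a (fun i => 2 ^+ (K.1 + r) * (tnth x i : R) - (2 ^+ r * tnth K.2 i)%:~R - b%:R)).
rewrite /lpoly -interpB -mulrA (mulrA (2 ^+ (r * d))) -exprD -mulnDl (addnC r).
apply: CP => [c ck|i].
  have cr i : (b + c i < 2 ^ r)%N.
    by apply: leq_trans bk; rewrite ltn_add2l -(prednK k0) ltnS; exact: ck.
  set L := cell r K (fun i => b + c i)%N.
  have LK : dyadic_cube L `<=` (dyadic_cube K : set (euclid R d)) by exact: cell_sub.
  have mL : measurable (dyadic_cube L : set (euclid R d)) by exact: measurable_dyadic_cube.
  have muL : mu (dyadic_cube L) = (2 ^- ((K.1 + r) * d))%:E by exact: lebesgue_dyadic_cube.
  have muK : mu (dyadic_cube K) = (2 ^- (K.1 * d))%:E by exact: lebesgue_dyadic_cube.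
  have P0 : (0 : R) < 2 ^+ ((K.1 + r) * d) by rewrite exprn_gt0.
  have cK : mu.-integrable (dyadic_cube K) (EFin \o (fun=> a)).
    exact: integrable_cube_cst.
  have iK : mu.-integrable (dyadic_cube K) (EFin \o (fun y => f y - a)).
    rewrite (_ : EFin \o _ = (EFin \o f) \- (EFin \o (fun=> a)))%E; last first.
      by apply/funext => y; rewrite /= EFinB.
    by apply: integrableB => //; apply: integrableS fi.
  have iL : mu.-integrable (dyadic_cube L) (EFin \o (fun y => f y - a)).
    exact: integrableS iK.
  have -> : cell_data b r f K c - a = 2 ^+ ((K.1 + r) * d) *
      Rintegral mu (dyadic_cube L) (fun y => f y - a).
    rewrite RintegralB //; last 2 first.
    - by apply: integrableS fi.
    - by apply: integrableS cK.
    rewrite mulrBr Rintegral_cst // [fine _](_ : _ = 2 ^- ((K.1 + r) * d)); last first.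
      by rewrite -[RHS]/(fine (2 ^- ((K.1 + r) * d))%:E) -muL.
    by rewrite mulrCA mulfV ?mulr1 // gt_eqF.
  rewrite normrM ger0_norm ?(ltW P0) // ler_wpM2l ?(ltW P0) //.
  apply: le_trans (le_normr_Rintegral mL iL) _; rewrite /Rintegral; apply: fine_le.
  - exact: (integrable_fin_num mL (integrable_norm iL)).
  - exact: (integrable_fin_num mK (integrable_norm iK)).
  apply: ge0_subset_integral => //; first exact: measurable_int (integrable_norm iK).
have p : (0 : R) < 2 ^+ K.1 by rewrite exprn_gt0.
have pr : (1 : R) <= 2 ^+ r by rewrite exprn_ege1 // ler1n.
have /andP[] := xK i.
rewrite mulrC ler_pdivrMr // => h1; rewrite mulrC ltr_pdivlMr // intrD => h2.
have -> : 2 ^+ (K.1 + r) * (tnth x i : R) - (2 ^+ r * tnth K.2 i)%:~R - b%:R =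
    2 ^+ r * ((tnth x i : R) * 2 ^+ K.1 - (tnth K.2 i)%:~R) - b%:R.
  by rewrite intrM rmorphXn exprD /=; ring.
have u0 : 0 <= 2 ^+ r * ((tnth x i : R) * 2 ^+ K.1 - (tnth K.2 i)%:~R).
  by rewrite mulr_ge0 ?exprn_ge0 //; lra.
have u1 : 2 ^+ r * ((tnth x i : R) * 2 ^+ K.1 - (tnth K.2 i)%:~R) <= 2 ^+ r.
  by rewrite ler_piMr ?exprn_ge0 //; lra.
have b0 : 0 <= b%:R :> R by [].
by rewrite /X ler_norml; apply/andP; split; lra.
Qed.

Lemma measurable_horner (q : {poly R}) (h : euclid R d -> R) :
  measurable_fun setT h -> measurable_fun setT (fun x => q.[h x]).
Proof.
move=> mh; under eq_fun do rewrite horner_coef.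
apply: measurable_sum => i; apply: measurable_funM => //; exact: measurable_funX.
Qed.

Lemma measurable_lpoly f K : measurable_fun setT (lpoly k r b f K).
Proof.
rewrite (_ : lpoly k r b f K = fun x => \sum_(g : {ffun 'I_d -> 'I_k})
    if (\sum_i g i < k)%N then mdif (ncoord g) (cell_data b r f K) * \prod_i (phi (g i)).[
      2 ^+ (K.1 + r) * (tnth x i : R) - (2 ^+ r * tnth K.2 i)%:~R - b%:R] else 0); last first.
  by apply/funext => x; rewrite /lpoly /interp big_mkcond.
apply: measurable_sum => g; case: (\sum_i g i < k)%N; last exact: measurable_cst.
apply: measurable_funM => //; apply: measurable_prod => i _.
apply: measurable_horner; apply: measurable_funB => //; apply: measurable_funB => //.
by apply: measurable_funM => //; exact: measurable_tnth.
Qed.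

Definition lproj f j x : R := lpoly k r b f (loc j x) x.

Lemma lproj_sum f j x : U x -> lproj f j x =
  \sum_(K <- dlevel j) lpoly k r b f K x * \1_(dyadic_cube K) x.
Proof. by move=> Ux; rewrite (sum_dlevel_cube _ (fun K => lpoly k r b f K x)). Qed.

Lemma measurable_lproj f j : measurable_fun U (lproj f j).
Proof.
apply: (eq_measurable_fun (fun x => \sum_(K <- dlevel j)
    lpoly k r b f K x * \1_(dyadic_cube K) x)).
  by move=> x /set_mem Ux; rewrite lproj_sum.
apply: measurable_sum => K; apply: measurable_funM.
  by apply: measurable_funTS; exact: measurable_lpoly.
by apply: measurable_funTS; apply/measurable_indicP; exact: measurable_dyadic_cube.
Qed.

Lemma unit_cube_dlevel j : U = \big[setU/set0]_(K <- dlevel j) dyadic_cube K.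
Proof.
apply/seteqP; split=> x.
  move=> Ux; rewrite (bigD1_seq (loc j x)) /= ?loc_dlevel ?dlevel_uniq //.
  by left; exact: loc_cube.
have H : \big[setU/set0]_(K <- dlevel j) dyadic_cube K `<=` U.
  rewrite big_seq; apply: (big_ind (fun X => X `<=` U)) => //.
    by move=> X Y XU YU y [/XU|/YU].
  by move=> K; exact: dlevel_sub.
exact: H.
Qed.

Lemma ge0_integral_dlevel j (h : euclid R d -> \bar R) : measurable_fun U h ->
  (forall x, U x -> (0 <= h x)%E) ->
  (\int[mu]_(x in U) h x = \sum_(K <- dlevel j) \int[mu]_(x in dyadic_cube K) h x)%E.
Proof.
move=> mh h0; rewrite (unit_cube_dlevel j) ge0_integral_bigsetU -?unit_cube_dlevel //.
- by move=> K; exact: measurable_dyadic_cube.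
- exact: dlevel_uniq.
- move=> K K' /= /dlevel1 Kj /dlevel1 K'j [x [/dyadic_cubeP <- /dyadic_cubeP <-]].
  by rewrite Kj K'j.
Qed.

(** A step function close to [f] in the mean is constant on the cubes of some generation [j >= n];
    there the polynomial differs from this constant by at most [C] times the mean of the error, so
    the total error grows by a factor [1 + C]. *)
Lemma lproj_cvg f (e : R) n : mu.-integrable setT (EFin \o f) -> 0 < e ->
  exists2 j, (n <= j)%N & (L1dist f (lproj f j) <= e%:E)%E.
Proof.
move=> fi e0; have [C C0 CP] := lpoly_sub_cst.
have mU : measurable U by exact: measurable_unit_cube.
have fU : mu.-integrable U (EFin \o f) by apply: integrableS fi.
have mf : measurable_fun setT f by apply/measurable_EFinP; exact: measurable_int fi.
have eC : 0 < e / (1 + C) by rewrite divr_gt0 // ltr_pwDl.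
have [m [c cP]] := step_dense fU eC.
have [c' c'E] := step_refine c (leq_maxr n m).
exists (maxn n m); first exact: leq_maxl.
set j := maxn n m in c'E *.
have cE : (fun x => c (loc m x)) = (fun x => c' (loc j x)) by apply/funext => x.
rewrite cE in cP.
have ms := measurable_step (R := R) j c'.
have mUf : measurable_fun U f by exact: measurable_funTS.
pose I K := (\int[mu]_(x in dyadic_cube K) `|f x - c' K|%:E)%E.
have mI K (a : R) : measurable_fun (dyadic_cube K) (fun x => `|f x - a|%:E).
  apply/measurable_EFinP; apply: measurableT_comp => //; apply: measurable_funB => //.
  exact: measurable_funTS.
have IE : L1dist f (fun x => c' (loc j x)) = (\sum_(K <- dlevel j) I K)%E.
  rewrite /L1dist (ge0_integral_dlevel j); last 2 first.
  - exact: measurable_L1dist.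
  - exact: L1dist_ge0.
  rewrite !big_seq; apply: eq_bigr => K Kj; apply: eq_integral => x /set_mem /dyadic_cubeP.
  by rewrite (dlevel1 Kj) => ->.
have H : (L1dist f (lproj f j) <= (1 + C)%:E * L1dist f (fun x => c' (loc j x)))%E.
  rewrite IE /L1dist (ge0_integral_dlevel j); last 2 first.
  - by apply: measurable_L1dist => //; exact: measurable_lproj.
  - exact: L1dist_ge0.
  rewrite ge0_sume_distrr; last by move=> K _; apply: integral_ge0 => x _; rewrite lee_fin.
  rewrite !big_seq; apply: lee_sum => K Kj.
  have mK : measurable (dyadic_cube K : set (euclid R d)) by exact: measurable_dyadic_cube.
  have muK : mu (dyadic_cube K) = (2 ^- (K.1 * d))%:E by exact: lebesgue_dyadic_cube.
  have IKf : I K \is a fin_num.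
    apply: integrable_fin_num => //; apply: (integrable_norm (f := fun x => f x - c' K)).
    rewrite (_ : EFin \o _ = (EFin \o f) \- (EFin \o (fun=> c' K)))%E; last first.
      by apply/funext => y; rewrite /= EFinB.
    apply: integrableB => //; first exact: integrableS fi.
    exact: integrable_cube_cst.
  have P0 : (0 : R) < 2 ^+ (K.1 * d) by rewrite exprn_gt0.
  pose a := C * (2 ^+ (K.1 * d) * fine (I K)).
  have a0 : 0 <= a.
    by rewrite !mulr_ge0 ?(ltW P0) ?fine_ge0 ?integral_ge0 // => x _; rewrite lee_fin.
  apply: (@le_trans _ _ (\int[mu]_(x in dyadic_cube K) (`|f x - c' K|%:E + a%:E))%E).
    apply: ge0_le_integral => //.
    - exact: (measurable_funS mU (dlevel_sub Kj) (measurable_L1dist mUf (measurable_lproj f j))).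
    - by apply: emeasurable_funD => //; exact: mI.
    - move=> x xK; rewrite -EFinD lee_fin.
      apply: le_trans (ler_distD (c' K) _ _) _; rewrite lerD2l distrC /lproj.
      have /dyadic_cubeP := xK; rewrite (dlevel1 Kj) => ->.
      exact: CP.
  rewrite ge0_integralD //.
  rewrite integral_cst // [X in (_ + _ * X)%E](_ : _ = (2 ^- (K.1 * d))%:E) //.
  rewrite -/(I K) -(fineK IKf) -EFinM -EFinD -EFinM lee_fin le_eqVlt; apply/orP; left.
  by apply/eqP; rewrite /a; field; rewrite gt_eqF.
apply: le_trans H _.
apply: (@le_trans _ _ ((1 + C)%:E * (e / (1 + C))%:E)%E).
  by apply: lee_wpmul2l => //; rewrite lee_fin addr_ge0.
by rewrite -EFinM mulrC divfK // gt_eqF // ltr_pwDl.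
Qed.

End convergence.

(** * Polynomial functions and their degrees *)

Section polynomial_functions.
Context {R : realType} {d : nat}.
Implicit Types (P Q : euclid R d -> R) (l : nat).

Lemma polynomials_le l l' P : (l <= l')%N -> polynomials l P -> polynomials l' P.
Proof. by move=> ll [q ql PE]; exists q => //; exact: leq_trans ql _. Qed.

Lemma polynomials_cst l (a : R) : polynomials (d := d) l (fun=> a).
Proof.
exists (mpoly.mpolyC d a); first by rewrite mpoly.msizeC; case: (a != 0).
by apply/funext => x; rewrite mpoly.mevalC.
Qed.

Lemma polynomialsD l P Q : polynomials l P -> polynomials l Q ->
  polynomials l (fun x => P x + Q x).
Proof.
move=> [p pl ->] [q ql ->]; exists (p + q).
  by apply: leq_trans (mpoly.msizeD_le _ _) _; rewrite geq_max pl.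
by apply/funext => x; rewrite mpoly.mevalD.
Qed.

Lemma polynomialsM l l' P Q : polynomials l P -> polynomials l' Q ->
  polynomials (l + l') (fun x => P x * Q x).
Proof.
move=> [p pl ->] [q ql ->]; exists (p * q); last first.
  by apply/funext => x; rewrite mpoly.mevalM.
have [->|p0] := eqVneq p 0; first by rewrite mul0r mpoly.msize0.
have [->|q0] := eqVneq q 0; first by rewrite mulr0 mpoly.msize0.
rewrite mpoly.msizeM // -subn1 leq_subLR; apply: leq_trans (leq_add pl ql) _; lia.
Qed.

Lemma polynomials_coord i : polynomials 1 (fun x : euclid R d => tnth x i : R).
Proof.
exists (mpoly.mpolyX R (mpoly.mnm1 i)); first by rewrite mpoly.msizeX mpoly.mdeg1.
by apply/funext => x; rewrite mpoly.mevalXU.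
Qed.

Lemma polynomials_sum (T : Type) (s : seq T) l (F : T -> euclid R d -> R) :
  (forall t, polynomials l (F t)) -> polynomials l (fun x => \sum_(t <- s) F t x).
Proof.
move=> Fl; elim: s => [|t s IH].
  by under eq_fun do rewrite big_nil; exact: polynomials_cst.
by under eq_fun do rewrite big_cons; exact: polynomialsD.
Qed.

Lemma polynomialsX l P n : polynomials l P -> polynomials (l * n) (fun x => P x ^+ n).
Proof.
move=> Pl; elim: n => [|n IH]; first by rewrite muln0; exact: polynomials_cst.
by under eq_fun do rewrite exprS; rewrite mulnS; exact: polynomialsM.
Qed.

Lemma polynomials_horner (p : {poly R}) P e : (size p <= e.+1)%N -> polynomials 1 P ->
  polynomials e (fun x => p.[P x]).
Proof.
move=> pe P1; under eq_fun do rewrite horner_coef.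
apply: polynomials_sum => j; apply: (@polynomials_le (0 + 1 * j)).
  by rewrite add0n mul1n -ltnS (leq_trans (ltn_ord j)).
by apply: polynomialsM; [exact: polynomials_cst|exact: polynomialsX].
Qed.

Lemma polynomials_prod (T : Type) (s : seq T) (l : T -> nat) (F : T -> euclid R d -> R) :
  (forall t, polynomials (l t) (F t)) ->
  polynomials (\sum_(t <- s) l t) (fun x => \prod_(t <- s) F t x).
Proof.
move=> Fl; elim: s => [|t s IH].
  rewrite (_ : (fun x => _) = fun=> 1); first exact: polynomials_cst.
  by apply/funext => x; rewrite big_nil.
rewrite (_ : (fun x => _) = fun x => F t x * \prod_(u <- s) F u x).
  by rewrite big_cons; exact: polynomialsM.
by apply/funext => x; rewrite big_cons.
Qed.

Lemma polynomials_lpoly k r b f K : polynomials k.-1 (@lpoly R d k r b f K).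
Proof.
rewrite (_ : lpoly k r b f K = fun x => \sum_(g : {ffun 'I_d -> 'I_k})
    if (\sum_i g i < k)%N then mdif (ncoord g) (cell_data b r f K) * \prod_i (phi (g i)).[
      2 ^+ (K.1 + r) * (tnth x i : R) - (2 ^+ r * tnth K.2 i)%:~R - b%:R] else 0); last first.
  by apply/funext => x; rewrite /lpoly /interp big_mkcond.
apply: polynomials_sum => g; have [gk|gk] := boolP (\sum_i g i < k)%N; last exact: polynomials_cst.
apply: (@polynomials_le (0 + \sum_i g i)); first by rewrite add0n; lia.
apply: polynomialsM; first exact: polynomials_cst.
apply: polynomials_prod => i; apply: polynomials_horner; first exact: size_phi.
under eq_fun do rewrite -addrA.
apply: polynomialsD; last exact: polynomials_cst.
by apply: (@polynomialsM 0 1); [exact: polynomials_cst|exact: polynomials_coord].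
Qed.

End polynomial_functions.

(** * The Besov seminorm *)

(** Superlevel sets of a monotone function are intervals. This serves for the modulus of continuity,
    a supremum over uncountably many steps. *)
Lemma nondecreasing_emeasurable (R : realType) (D : set R) (g : R -> \bar R) :
  measurable D -> {homo g : s t / s <= t >-> (s <= t)%E} -> measurable_fun D g.
Proof.
move=> mD g_nd; apply: (measurability (@ErealGenOInfty.G R)) => [|/= _ [_] [r] -> <-].
  exact: ErealGenOInfty.measurableE.
apply: measurableI => //; apply: is_interval_measurable => s t /=.
rewrite !in_itv /= !andbT => gs gt u /andP[su ut].
by rewrite in_itv /= andbT (lt_le_trans gs) // g_nd.
Qed.

Section seminorm.
Context {R : realType} {d : nat}.
Variables (p lambda : R) (f : euclid R d -> R).
Hypothesis lambda0 : 0 <= lambda.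
Let k := smoothness_order lambda.
Let om t := modulus_of_continuity k p t f.

Lemma modulus_homo : {homo om : s t / s <= t >-> (s <= t)%E}.
Proof.
move=> s t st; apply: le_ereal_sup => _ [h hs <-]; exists h => //=.
exact: le_trans hs st.
Qed.

Lemma modulus_ge0 t : 0 <= t -> (0 <= om t)%E.
Proof.
move=> t0; pose h : euclid R d := [tuple 0 | i < d].
apply: (@le_trans _ _ (Lnorm_on (difference_dom k h) p%:E (difference k h f))).
  exact: Lnorm_ge0.
apply: ereal_sup_ubound; exists h => //=; rewrite /enorm big1 ?sqrtr0 // => i _.
by rewrite tnth_mktuple expr0n.
Qed.

Let F t := (om t * ((t `^ lambda)^-1 * t^-1)%:E)%E.
Let J (j : nat) := `]2 ^- j.+1 : R, 2 ^- j[%classic.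
Let I01 := `]0%R : R, 1%R[%classic.

Let pw j : (0 : R) < 2 ^- j.
Proof. by rewrite invr_gt0 exprn_gt0. Qed.

Let J_sub j : J j `<=` I01.
Proof.
move=> t; rewrite /J /I01 /= !in_itv /= => /andP[h1 h2].
rewrite (lt_trans (pw j.+1)) //= (lt_le_trans h2) // invf_le1 ?exprn_gt0 //.
by rewrite exprn_ege1 // ler1n.
Qed.

Let F0 t : I01 t -> (0 <= F t)%E.
Proof.
rewrite /I01 /= in_itv /= => /andP[t0 _].
by rewrite mule_ge0 ?modulus_ge0 ?lee_fin ?mulr_ge0 ?invr_ge0 ?powR_ge0 ?(ltW t0).
Qed.

Let mF : measurable_fun I01 F.
Proof.
apply: emeasurable_funM.
  by apply: (nondecreasing_emeasurable (g := om)); [exact: measurable_itv|exact: modulus_homo].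
apply/measurable_EFinP.
apply: (eq_measurable_fun (fun t => t `^ (- lambda) * t `^ (-1))).
  move=> t /set_mem; rewrite /I01 /= in_itv /= => /andP[t0 _].
  by rewrite powRN powR_inv1 // ltW.
by apply: measurable_funTS; apply: measurable_funM; exact: measurable_powR.
Qed.

(** On the interval the modulus is at least its value at the left end, and the remaining factor at
    least its value [2 ^ (j * lambda) * 2 ^ j] at the right end; the length [2 ^- j.+1] leaves the
    factor 1/2. *)
Lemma integral_dyadic_ge j :
  ((2 `^ (j%:R * lambda) / 2)%:E * om (2 ^- j.+1) <= \int[lebesgue_measure]_(t in J j) F t)%E.
Proof.
have mJ : measurable (J j) by exact: measurable_itv.
pose c := ((2 `^ (j%:R * lambda) * 2 ^+ j)%:E * om (2 ^- j.+1))%E.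
have lJ : lebesgue_measure (J j) = (2 ^- j.+1)%:E.
  rewrite lebesgue_measure_itv /= lte_fin ltf_pV2 ?posrE ?exprn_gt0 //.
  rewrite ltr_eXn2l ?ltr1n // ltnSn -EFinB; congr (_%:E).
  by rewrite exprS; field; rewrite gt_eqF ?exprn_gt0.
have c0 : (0 <= c)%E by rewrite mule_ge0 ?modulus_ge0 ?lee_fin ?mulr_ge0 ?powR_ge0 ?exprn_ge0 ?(ltW (pw _)).
apply: (@le_trans _ _ (\int[lebesgue_measure]_(t in J j) c)%E).
  have -> : (\int[lebesgue_measure]_(t in J j) c = c * lebesgue_measure (J j))%E.
    exact: integral_cst.
  rewrite lJ /c muleAC -EFinM le_eqVlt; apply/orP; left.
  apply/eqP; congr ((_%:E) * _)%E; rewrite exprS; field.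
  by rewrite gt_eqF ?exprn_gt0.
apply: ge0_le_integral => //.
- by apply: measurable_funS mF; [exact: measurable_itv|exact: J_sub].
- move=> t; rewrite /J /= in_itv /= => /andP[h1 h2].
  have t0 : 0 < t by exact: lt_trans h1.
  rewrite /F muleC /c; apply: lee_pmul.
  + by rewrite lee_fin mulr_ge0 ?powR_ge0 ?exprn_ge0.
  + by rewrite modulus_ge0 // ltW.
  + rewrite lee_fin; apply: ler_pM; rewrite ?powR_ge0 ?exprn_ge0 //.
      rewrite -[leLHS]invrK lef_pV2 ?posrE ?powR_gt0 ?invr_gt0 ?powR_gt0 //.
      rewrite -powRN -mulNr powRrM; apply: ge0_ler_powR; rewrite ?nnegrE ?powR_ge0 ?(ltW t0) //.
      by rewrite powRN powR_mulrn // ltW.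
    by rewrite -[leLHS]invrK lef_pV2 ?posrE ?invr_gt0 ?exprn_gt0 // ltW.
  + by apply: modulus_homo; rewrite ltW.
Qed.

Lemma sum_modulus_le n :
  (\sum_(j < n) (2 `^ (j%:R * lambda))%:E * om (2 ^- j.+1) <= 2%:E * besov_seminorm p lambda f)%E.
Proof.
rewrite -[leLHS]mul1e -(_ : (2 * 2^-1 : R)%:E = 1%E); last by rewrite mulfV.
rewrite EFinM -muleA lee_pmul2l //.
rewrite ge0_sume_distrr; last first.
  by move=> j _; rewrite mule_ge0 ?lee_fin ?powR_ge0 ?modulus_ge0 ?(ltW (pw _)).
have mJ j : measurable (J j) by exact: measurable_itv.
apply: (@le_trans _ _ (\sum_(j < n) \int[lebesgue_measure]_(t in J j) F t)%E).
  apply: lee_sum => j _; apply: le_trans (integral_dyadic_ge j).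
  by rewrite muleA -EFinM mulrC.
pose V := \big[setU/set0]_(j < n) J j.
have VI : V `<=` I01.
  rewrite /V; apply: (big_ind (fun X => X `<=` I01)) => //.
  by move=> X Y XI YI y [/XI|/YI].
have mV : measurable V by exact: bigsetU_measurable.
rewrite -(@ge0_integral_bigsetU _ _ _ lebesgue_measure _ (fun j : 'I_n => J j)) //.
- apply: ge0_subset_integral => //; exact: measurable_itv.
- by move=> j; exact: mJ.
- exact: index_enum_uniq.
- move=> i j _ _ [t []]; rewrite /J /= !in_itv /= => /andP[i1 i2] /andP[j1 j2].
  apply: val_inj => /=; apply/eqP; rewrite eqn_leq; apply/andP; split; rewrite leqNgt; apply/negP.
    move=> ji; have : t < t; last by rewrite ltxx.
    apply: lt_trans i2 _; apply: le_lt_trans j1.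
    by rewrite lef_pV2 ?posrE ?exprn_gt0 // ler_eXn2l ?ltr1n.
  move=> ij; have : t < t; last by rewrite ltxx.
  apply: lt_trans j2 _; apply: le_lt_trans i1.
  by rewrite lef_pV2 ?posrE ?exprn_gt0 // ler_eXn2l ?ltr1n.
- by apply: measurable_funS mF => //; exact: measurable_itv.
- by move=> x /VI /F0.
Qed.

End seminorm.

(** * The adaptive approximant *)

Section marked_approximant.
Context {R : realType} {d : nat}.
Local Notation U := (unit_cube : set (euclid R d)).
Local Notation code := (dyadic_code (d := d)).
Variables (P : code -> euclid R d -> R) (w : code -> R) (theta : R) (n l : nat).
Hypotheses (theta0 : 0 <= theta)
  (Ppoly : forall K, polynomials l (P K))
  (Pw : forall K s x, dyadic_cube K x -> `|P (dchild K s) x - P K x| <= w K).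

Let sgn0 : {ffun 'I_d -> bool} := [ffun=> false].
Let bd := bad (@dchild d) sgn0 w theta n.
Let res := residual (@dchild d) sgn0 w theta.

(** For [K] of generation [j], the smallest cube of [marks] containing it. The list [marks] holds
    the root and the children of the bad cubes, so a cube is tested through its parent. *)
Fixpoint last_mark j K : code :=
  if j is j'.+1 then if bd j' (dparent K) then K else last_mark j' (dparent K)
  else K.

Definition marks : seq code :=
  droot :: flatten [seq [seq dchild K s | K <- [seq L <- dlevel j | bd j L], s <- enum {ffun 'I_d -> bool}]
    | j <- iota 0 n].

Lemma size_marks : size marks =
  (1 + 2 ^ d * count_bad (@dchild d) droot sgn0 w theta n)%N.
Proof.
rewrite /marks /= size_flatten /shape -map_comp sumnE big_map add1n; congr _.+1.
rewrite /count_bad big_distrr /= -[n in iota 0 n]subn0 -/(index_iota 0 n) big_mkord.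
apply: eq_bigr => j _ /=; rewrite size_allpairs -cardT card_ffun card_bool card_ord mulnC.
by congr (_ * _)%N.
Qed.

Lemma marks_root : droot \in marks. Proof. exact: mem_head. Qed.

Lemma marks_loc j x : U x -> (j < n)%N -> (loc j.+1 x \in marks) = bd j (loc j x).
Proof.
move=> Ux jn; rewrite inE; apply/idP/idP.
  case/orP => [/eqP/(congr1 fst) //|/flattenP[_ /mapP[i + ->]]].
  rewrite mem_iota add0n => /= ni /allpairsP[[K s] [/=]].
  rewrite mem_filter => /andP[bK Ki] _ E.
  have KE : K = loc j x by rewrite -dparent_loc E dchildK.
  by move: bK; rewrite KE; have := dlevel1 Ki; rewrite KE /= => ->.
move=> bj; apply/orP; right; apply/flattenP.
exists [seq dchild K s | K <- [seq L <- dlevel j | bd j L], s <- enum {ffun 'I_d -> bool}].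
  by apply/mapP; exists j => //; rewrite mem_iota.
have [s ->] := loc_child j x; apply/allpairsP; exists (loc j x, s) => /=.
by rewrite mem_filter bj loc_dlevel // mem_enum.
Qed.

Lemma marks_level K : K \in marks -> exists2 j, (j <= n)%N & K \in dlevel j.
Proof.
rewrite inE => /orP[/eqP ->|/flattenP[_ /mapP[j + ->]]].
  by exists 0%N => //; rewrite inE.
rewrite mem_iota add0n => /= jn /allpairsP[[L s] [/=]].
rewrite mem_filter => /andP[_ Lj] _ ->; exists j.+1 => //.
by apply/allpairsP; exists (L, s); rewrite mem_enum.
Qed.

(** A function of [piecewise_polynomials] sums over all cubes containing the point, and those of
    [marks] are nested; hence each contributes only the change from the next larger one. *)
Definition increment K : euclid R d -> R :=
  if K == droot then P K
  else fun x => P K x + -1 * P (last_mark K.1.-1 (dparent K)) x.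

Lemma increment_polynomials K : polynomials l (increment K).
Proof.
rewrite /increment; case: ifP => _; first exact: Ppoly.
apply: polynomialsD; first exact: Ppoly.
by apply: (@polynomialsM _ _ 0 l); [exact: polynomials_cst|exact: Ppoly].
Qed.

Lemma increment_sum (s : seq code) x : uniq s -> s =i marks -> U x ->
  \sum_(K <- s) increment K x * \1_(dyadic_cube K) x = P (last_mark n (loc n x)) x.
Proof.
move=> us sm Ux.
transitivity (\sum_(j < n.+1) if loc j x \in marks then increment (loc j x) x else 0).
  transitivity (\sum_(K <- s) \sum_(j < n.+1) if K == loc j x then increment K x else 0).
    rewrite !big_seq; apply: eq_bigr => K Ks.
    have [i ni Ki] := marks_level (etrans (esym (sm K)) Ks).
    have KE (j : 'I_n.+1) : (K == loc j x) = (K == loc K.1 x) && (j == K.1 :> nat).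
      apply/idP/andP => [/eqP E|[/eqP {1}-> /eqP ->] //].
      by have jE : K.1 = j by [rewrite E]; rewrite jE -E !eqxx.
    rewrite (dlevel1 Ki) in KE.
    have ni' : (i < n.+1)%N by [].
    rewrite indicE; have [xK|xK] := boolP (x \in dyadic_cube K).
      have /dyadic_cubeP := set_mem xK; rewrite (dlevel1 Ki) => lK.
      rewrite mulr1 (bigD1 (Ordinal ni')) //= lK eqxx /= big1 ?addr0 // => j ji.
      rewrite KE (_ : (j == i :> nat) = false) ?andbF //; apply/negbTE.
      by apply: contra ji => /eqP ji; apply/eqP; exact: val_inj.
    rewrite mulr0 big1 // => j _; rewrite KE; case: eqP => //= lK.
    exfalso; move/negP: xK; apply; apply/mem_set/dyadic_cubeP.
    by rewrite (dlevel1 Ki).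
  rewrite exchange_big; apply: eq_bigr => j _; rewrite -big_mkcond /=.
  case: ifP => jm.
    by rewrite -big_filter filter_pred1_uniq ?sm // big_seq1.
  rewrite big_seq_cond big1 // => K /andP[Ks /eqP KE].
  by move: Ks; rewrite sm KE jm.
suff H m : (m <= n)%N ->
    \sum_(j < m.+1) (if loc j x \in marks then increment (loc j x) x else 0) =
    P (last_mark m (loc m x)) x by exact: H.
elim: m => [|m IH] mn.
  by rewrite big_ord1 /= (unit_cubeE x).1 // marks_root /increment eqxx.
rewrite big_ord_recr (IH (ltnW mn)) /= marks_loc // dparent_loc; case: ifP => _; last by rewrite addr0.
rewrite /increment (_ : (loc m.+1 x == droot) = false); last first.
  by apply/eqP => /(congr1 fst).
by rewrite [(loc m.+1 x).1.-1]/= dparent_loc; ring.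
Qed.

(** Invariant of the descent: the error made so far plus the weight still ahead is at most [theta].
    At a cube of [marks] the error starts again from zero; otherwise the parent is not bad, and the
    step to the child is paid out of its residual. *)
Lemma last_mark_close m x : U x -> (m <= n)%N ->
  `|P (loc m x) x - P (last_mark m (loc m x)) x| + cut theta (res (n - m) (loc m x)) <= theta.
Proof.
move=> Ux; elim: m => [|m IH] mn; first by rewrite subrr normr0 add0r cut_le.
rewrite /= dparent_loc; case: ifPn => [_|nb]; first by rewrite subrr normr0 add0r cut_le.
have {IH} := IH (ltnW mn).
have cE : cut theta (res (n - m) (loc m x)) = res (n - m) (loc m x).
  by move: nb; rewrite /bd /bad /cut /res => /negPf ->.
rewrite cE; have [s sE] := loc_child m x.
have := residual_ge (@dchild d) sgn0 w theta (n - m.+1) (loc m x) s.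
rewrite -sE subnSK // -/res => h1 h2.
have h3 : `|P (loc m.+1 x) x - P (loc m x) x| <= w (loc m x).
  by rewrite sE; apply: Pw; exact: loc_cube.
have := ler_distD (P (loc m x) x) (P (loc m.+1 x) x) (P (last_mark m (loc m x)) x).
rewrite -/res; lra.
Qed.

Lemma marked_approximation : exists2 Delta : {fset code},
  dyadic_covering (R := R) Delta /\
  (#|` Delta| <= 1 + 2 ^ d * count_bad (@dchild d) droot sgn0 w theta n)%N &
  exists2 g : euclid R d -> R, piecewise_polynomials l Delta g &
    forall x, U x -> `|P (loc n x) x - g x| <= theta.
Proof.
pose Delta : {fset code} := [fset K | K in marks]%fset.
have DE K : (K \in Delta) = (K \in marks) by rewrite in_fset.
exists Delta; first split; first split.
- by move=> K; rewrite DE => /marks_level[j _]; exact: dlevel_sub.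
- by move=> x Ux; exists droot; [rewrite /= DE marks_root|rewrite -unit_cube_root].
- by rewrite -size_marks; apply: uniq_leq_size; [exact: fset_uniq|move=> K; rewrite -DE].
exists (fun x => \sum_(K <- Delta) increment K x * \1_(dyadic_cube K) x).
  by exists increment => // K _; exact: increment_polynomials.
move=> x Ux; rewrite increment_sum //; last exact: fset_uniq.
have := last_mark_close Ux (leqnn n); rewrite subnn.
by rewrite /res /= /cut ltNge theta0 /= addr0.
Qed.

End marked_approximant.

Section marking_count.
Context {R : realType} {d : nat}.
Local Notation code := (dyadic_code (d := d)).
Variables (w : code -> R) (p A : R) (N n : nat) (a : nat -> R) (sgn0 : {ffun 'I_d -> bool}).
Hypotheses (p1 : 1 <= p) (a0 : forall j, 0 <= a j) (N0 : (1 <= N)%N)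
  (aA : \sum_(j < n) a j <= A)
  (wa : forall j S, uniq S -> {subset S <= dlevel j} ->
    \sum_(K <- S) w K <= (size S)%:R * (size S)%:R `^ (- p^-1) * a j).

(** Each marked cube costs its [2 ^ d] children; at this threshold [(A / theta) ^ p] marked cubes
    would cost exactly [N]. *)
Let theta := A * (2 ^+ d / N%:R) `^ p^-1.
Let cnt := count_bad (@dchild d) droot sgn0 w theta n.

(** The strict inequality for the collected weight becomes [2 ^ d * cnt < N], and strictness leaves
    one place for the root. *)
Lemma count_bad_le : (1 + 2 ^ d * cnt <= N)%N.
Proof.
have A0 : 0 <= A by apply: le_trans aA; apply: sumr_ge0.
have p0 : 0 < p by exact: lt_le_trans p1.
have theta0 : 0 <= theta by rewrite mulr_ge0 ?powR_ge0.
have [->|c0] := posnP cnt; first by rewrite muln0 addn0.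
have := heavy_nodes_weight theta0 c0.
set hv := heavy_nodes _ _ _ _ _ _ => H.
have NR : 0 < N%:R :> R by rewrite ltr0n.
have cR : 0 < cnt%:R :> R by rewrite ltr0n.
(* A generation of the paths has at most [cnt] nodes, and [m ^ (1 - 1/p)] is nondecreasing in [m]
   because [p >= 1]. *)
have mono m : (m <= cnt)%N -> m%:R * m%:R `^ (- p^-1) <= cnt%:R * cnt%:R `^ (- p^-1) :> R.
  case: m => [|m] mc; first by rewrite mul0r mulr_ge0 ?powR_ge0.
  have E (t : R) : 0 < t -> t * t `^ (- p^-1) = t `^ (1 - p^-1).
    by move=> t0; rewrite -{1}(powRr1 (ltW t0)) -powRD // (gt_eqF t0) implybT.
  rewrite !E ?ltr0n //; apply: ge0_ler_powR; rewrite ?nnegrE ?ler_nat //.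
  by rewrite subr_ge0 invf_le1.
have szS (j : 'I_n) : (size (hv j) <= cnt)%N.
  apply: leq_trans (size_heavy_nodes _ _ _ _ _ _ _) _.
  rewrite /cnt /count_bad (big_ord_widen n (fun i => size (seq.filter (bad (@dchild d) sgn0 w theta n i) (dlevel i)))) //.
  rewrite big_mkcond; apply: leq_sum => i _; by case: ifP.
have : theta * cnt%:R < cnt%:R * cnt%:R `^ (- p^-1) * A.
  apply: lt_le_trans H _; apply: le_trans (_ : _ <= cnt%:R * cnt%:R `^ (- p^-1) * \sum_(j < n) a j) _.
    rewrite mulr_sumr; apply: ler_sum => j _.
    apply: le_trans (wa (j := j) _ _) _.
    - by apply: heavy_nodes_uniq; exact: dchild_inj.
    - exact: heavy_nodes_level.
    - by rewrite ler_wpM2r // mono.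
  by rewrite ler_wpM2l // mulr_ge0 ?powR_ge0.
have A1 : 0 < A.
  rewrite lt_neqAle A0 andbT; apply/negP => /eqP A00.
  move: H; rewrite /theta -A00 !mul0r => H0.
  have : \sum_(j < n) \sum_(L <- hv j) w L <= 0; last by rewrite leNgt H0.
  apply: sumr_le0 => j _; apply: le_trans (wa (j := j) _ _) _.
  - by apply: heavy_nodes_uniq; exact: dchild_inj.
  - exact: heavy_nodes_level.
  - rewrite (_ : a j = 0) ?mulr0 //; apply/eqP; rewrite eq_le a0 andbT.
    by rewrite A00; apply: le_trans aA; rewrite (bigD1 j) //= lerDl sumr_ge0.
rewrite /theta; set t := _ `^ p^-1; set u := _ `^ (- p^-1) => H1.
have tu : t < u.
  rewrite ltNge; apply/negP => ut.
  have : cnt%:R * A * u <= cnt%:R * A * t by rewrite ler_wpM2l // mulr_ge0.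
  lra.
rewrite add1n ltnNge; apply/negP => Nc; move: tu; rewrite ltNge => /negP; apply.
have -> : u = (cnt%:R^-1) `^ p^-1.
  by rewrite -powR_inv1 // -powRrM mulN1r.
apply: ge0_ler_powR; rewrite ?nnegrE ?invr_ge0 ?divr_ge0 ?exprn_ge0 ?(ltW p0) //.
rewrite ler_pdivlMr // mulrC ler_pdivrMr // -natrX -natrM ler_nat.
by rewrite mulnC in Nc *.
Qed.

End marking_count.

(** * Passage to [L_p] functions and to the essential supremum *)

Section function_spaces.
Context {R : realType} {d : nat}.
Local Notation mu := (lebesgue d : {sigma_finite_measure set (euclid R d) -> \bar R}).
Local Notation U := (unit_cube : set (euclid R d)).
Implicit Types (f g h : euclid R d -> R).

Let mU : measurable U := measurable_unit_cube.

Lemma measurable_polynomials l g : polynomials l g -> measurable_fun setT g.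
Proof.
move=> [q _ ->]; rewrite (_ : (fun x : euclid R d => _) = fun x => \sum_(m <- mpoly.msupp q)
    mpoly.mcoeff m q * \prod_i (tnth x i : R) ^+ m i).
  apply: measurable_sum => m; apply: measurable_funM => //.
  by apply: measurable_prod => i _; apply: measurable_funX; exact: measurable_tnth.
by apply/funext => x; rewrite mpoly.mevalE.
Qed.

Lemma measurable_piecewise_polynomials l Delta g :
  piecewise_polynomials l Delta g -> measurable_fun setT g.
Proof.
move=> [P PP ->].
rewrite (_ : (fun x : euclid R d => _) = fun x =>
    \sum_(K <- Delta) (if K \in Delta then P K x * \1_(dyadic_cube K) x else 0)); last first.
  by apply/funext => x; rewrite !big_seq; apply: eq_bigr => K ->.
apply: measurable_sum => K; case: (boolP (K \in Delta)) => KD; last exact: measurable_cst.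
apply: measurable_funM; first exact: measurable_polynomials (PP _ KD).
by apply/measurable_indicP; exact: measurable_dyadic_cube.
Qed.

Lemma restrict_unit_cube f x : U x -> (f \_ U) x = f x.
Proof. by move=> Ux; rewrite patchE mem_set. Qed.

(** Extended by zero, [f] has means over all dyadic cubes; integrability is the Hoelder bound on the
    unit cube, whose measure is 1. *)
Lemma in_Lp_integrable p f : 1 <= p -> in_Lp p f ->
  mu.-integrable setT (EFin \o (f \_ U)).
Proof.
move=> p1 [mf fp].
have mf0 : measurable_fun setT (f \_ U) by apply/(measurable_restrictT _ mU).
have fE : Lnorm_on U p%:E (f \_ U) = Lnorm_on U p%:E f.
  rewrite /Lnorm_on; congr Lnorm; apply/funext => x /=; congr (_%:E).
  by rewrite !patchE; case: ifP => // ->.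
have [w w0 fw] : exists2 w : R, 0 < w & (Lnorm_on U p%:E (f \_ U) <= w%:E)%E.
  rewrite fE; move: fp (Lnorm_ge0 (lebesgue d) p%:E (EFin \o (f \_ U))).
  rewrite -/(Lnorm_on U p%:E f); case: (Lnorm_on _ _ _) => // s _ s0.
  by exists (s + 1); [rewrite ltr_wpDl|rewrite lee_fin lerDl].
have U1 : mu U = 1%:E by rewrite unit_cube_root [LHS]lebesgue_dyadic_cube mul0n expr0 invr1.
have := integral_le_Lnorm mU mU (@subset_refl _ U) mf0 p1 ltr01 w0 U1 fw => H.
rewrite -restrict_EFin; apply/(integrable_mkcond _ mU); apply/integrableP; split.
  exact/measurable_EFinP.
apply: le_lt_trans (ltry (2 * (w * (1 * 1 `^ (- p^-1))))).
apply: le_trans H; rewrite le_eqVlt; apply/orP; left; apply/eqP.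
by apply: eq_integral => x /set_mem Ux /=; rewrite restrict_unit_cube.
Qed.

(** On the domain of a difference all arguments lie in the cube, where the extension by zero agrees
    with [f]. *)
Lemma modulus_restrict k p t f :
  modulus_of_continuity k p t (f \_ U) = modulus_of_continuity k p t f.
Proof.
rewrite /modulus_of_continuity; congr ereal_sup; apply/seteqP.
suff E (h : euclid R d) : Lnorm_on (difference_dom k h) p%:E (difference k h (f \_ U)) =
    Lnorm_on (difference_dom k h) p%:E (difference k h f).
  by split=> _ [h ht <-]; exists h => //; rewrite E.
rewrite /Lnorm_on; congr Lnorm; apply/funext => x /=; congr (_%:E).
rewrite !patchE; case: ifP => // /set_mem xD; apply: eq_bigr => j _.
by rewrite restrict_unit_cube //; apply: xD; rewrite -ltnS.
Qed.

(** The excess of [|f - g|] over [B] is at most [|f - h|], so its integral is at most every [e > 0],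
    and it vanishes almost everywhere. *)
Lemma Lnorm_oo_le f g (B : R) : measurable_fun U f -> measurable_fun U g -> 0 <= B ->
  (forall e : R, 0 < e -> exists h, [/\ measurable_fun U h, (L1dist f h <= e%:E)%E &
     forall x, U x -> `|h x - g x| <= B]) ->
  (Lnorm_on U +oo (f \- g)%R <= B%:E)%E.
Proof.
move=> mf mg B0 H.
pose F x := Num.max (`|f x - g x| - B) 0.
have F0 x : 0 <= F x by rewrite /F le_max lexx orbT.
have mF : measurable_fun U F.
  apply: measurable_maxr => //; apply: measurable_funB => //.
  by apply: measurableT_comp => //; exact: measurable_funB.
have I0 : (\int[mu]_(x in U) `|(F x)%:E| = 0)%E.
  apply/eqP; rewrite eq_le; apply/andP; split; last first.
    by apply: integral_ge0 => x _; rewrite abse_ge0.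
  apply/lee_addgt0Pr => e e0; rewrite add0e.
  have [h [mh fh hg]] := H e e0.
  apply: le_trans fh; apply: ge0_le_integral => //.
  - by apply/measurable_EFinP; apply: measurableT_comp.
  - exact: measurable_L1dist.
  - move=> x Ux; rewrite /= lee_fin ger0_norm // /F ge_max normr_ge0 andbT.
    by have := ler_distD (h x) (f x) (g x); have := hg x Ux; lra.
have mFE : measurable_fun U (EFin \o F) by exact/measurable_EFinP.
have /(ae_eq_integral_abs mu mU mFE) ae0 := I0.
rewrite /Lnorm_on unlock; case: ifPn => _; last by rewrite lee_fin.
apply/ess_supP; apply: filterS ae0 => x /= xF; rewrite lee_fin patchE.
case: ifPn => [/set_mem Ux|_]; last by rewrite normr0.
have [E] := xF Ux; have : `|f x - g x| - B <= F x by rewrite /F le_max lexx.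
by rewrite E subr_le0.
Qed.

End function_spaces.

(** Some partial sum comes within [A * e] of the supremum. For [A = 0] this margin is not positive,
    but then all partial sums vanish. *)
Lemma small_tail (R : realType) (a : nat -> R) (A e : R) : (forall j, 0 <= a j) ->
  (forall n, \sum_(j < n) a j <= A) -> 0 < e ->
  exists n, forall m, \sum_(n <= j < m) a j <= A * e.
Proof.
move=> a0 aA e0; have A0 : 0 <= A by have := aA 0%N; rewrite big_ord0.
have mE n m : (n <= m)%N -> \sum_(n <= j < m) a j = \sum_(j < m) a j - \sum_(j < n) a j.
  by move=> nm; rewrite -!(big_mkord xpredT) (big_cat_nat (leq0n n) nm) /= addrC addrK.
have tail0 n m : (m <= n)%N -> \sum_(n <= j < m) a j = 0 by move=> mn; rewrite big_geq.
have [A00|A1] := eqVneq A 0.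
  by exists 0%N => m; have := aA m; rewrite A00 mul0r big_mkord.
pose E : set R := range (fun n => \sum_(j < n) a j).
have hE : has_sup E.
  by split; [exists (\sum_(j < 0) a j); exists 0%N|exists A => _ [n _ <-]].
have Ae : 0 < A * e by rewrite mulr_gt0 // lt0r A1.
have [_ [n _ <-] nE] := sup_adherent Ae hE.
exists n => m; have [nm|/ltnW mn] := leqP n m; last by rewrite tail0 // ltW.
have mS : \sum_(j < m) a j <= sup E by apply: sup_ubound; [case: hE|exists m].
by rewrite mE //; move: nE mS; lra.
Qed.

(** * The final estimate *)

Section approximation.
Context {R : realType} {d : nat}.
Local Notation code := (dyadic_code (d := d)).
Local Notation U := (unit_cube : set (euclid R d)).
Variables (P : code -> euclid R d -> R) (w : code -> R) (a : nat -> R) (p A : R) (N l : nat).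
Hypotheses (p1 : 1 <= p) (a0 : forall j, 0 <= a j) (N0 : (1 <= N)%N)
  (aA : forall n, \sum_(j < n) a j <= A)
  (wa : forall j S, uniq S -> {subset S <= dlevel j} ->
    \sum_(K <- S) w K <= (size S)%:R * (size S)%:R `^ (- p^-1) * a j)
  (Ppoly : forall K, polynomials l (P K))
  (Pw : forall K s x, dyadic_cube K x -> `|P (dchild K s) x - P K x| <= w K).

Lemma level_increment j x : U x -> `|P (loc j.+1 x) x - P (loc j x) x| <= a j.
Proof.
move=> Ux; have [s ->] := loc_child j x.
apply: le_trans (Pw _ (loc_cube _ _)) _.
have := @wa j [:: loc j x] isT; rewrite big_seq1 /= powR1 mulr1 mul1r; apply.
by move=> K; rewrite inE => /eqP ->; exact: loc_dlevel.
Qed.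

Lemma level_increments n j x : U x -> (n <= j)%N ->
  `|P (loc j x) x - P (loc n x) x| <= \sum_(n <= i < j) a i.
Proof.
move=> Ux; elim: j => [|j IH]; first by rewrite leqn0 => /eqP ->; rewrite subrr normr0 big_geq.
rewrite leq_eqVlt ltnS => /orP[/eqP ->|nj]; first by rewrite subrr normr0 big_geq.
rewrite big_nat_recr //= addrC; apply: le_trans (ler_distD (P (loc j x) x) _ _) _.
by apply: lerD; [exact: level_increment|exact: IH].
Qed.

(** The depth [n] is chosen after [N] to make the tail at most [A * N ^ (- 1/p)], the order of the
    threshold; the count of marked cubes does not depend on it. The bound is stated for all [j >= n]
    because convergence in the mean provides generations [j] beyond any [n] but not a prescribed
    one. *)
Lemma tree_approximation : exists2 Delta : {fset code},
  dyadic_covering (R := R) Delta /\ (#|` Delta| <= N)%N &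
  exists2 g : euclid R d -> R, piecewise_polynomials l Delta g &
    exists n, forall j x, (n <= j)%N -> U x ->
      `|P (loc j x) x - g x| <= A * ((2 ^+ d / N%:R) `^ p^-1 + N%:R `^ (- p^-1)).
Proof.
have A0 : 0 <= A by have := aA 0%N; rewrite big_ord0.
have e0 : 0 < N%:R `^ (- p^-1) :> R by rewrite powR_gt0 // ltr0n.
have [n nA] := small_tail a0 aA e0.
have theta0 : 0 <= A * (2 ^+ d / N%:R) `^ p^-1 by rewrite mulr_ge0 ?powR_ge0.
have [Delta [Dcov Dcard] [g gD gP]] := marked_approximation n theta0 Ppoly Pw.
exists Delta; first split=> //.
  by apply: leq_trans Dcard _; exact: count_bad_le p1 a0 N0 (aA n) wa.
exists g => //; exists n => j x nj Ux.
apply: le_trans (ler_distD (P (loc n x) x) _ _) _.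
rewrite mulrDr addrC; apply: lerD; first exact: gP.
exact: le_trans (level_increments Ux nj) (nA j).
Qed.

End approximation.

Lemma smoothness_order_gt (R : realType) (lambda : R) : lambda < (smoothness_order lambda)%:R.
Proof. by rewrite /smoothness_order; case: ex_minnP. Qed.

Lemma besov_seminorm_fin (R : realType) d (p lambda : R) (f : euclid R d -> R) : 0 <= lambda ->
  (besov_seminorm p lambda f < +oo)%E ->
  besov_seminorm p lambda f = (fine (besov_seminorm p lambda f))%:E.
Proof.
move=> l0 foo; rewrite fineK // ge0_fin_numE //.
have := sum_modulus_le p f l0 0; rewrite big_ord0 pmule_rge0 ?lte_fin //.
Qed.

(** One infinite value of the modulus would make a dyadic sum, and hence the seminorm, infinite; so
    the moduli can be treated as real numbers. *)
Lemma modulus_besov_sum (R : realType) d (p lambda : R) (f : euclid R d -> R)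
    (om := fun j => modulus_of_continuity (smoothness_order lambda) p (2 ^- j.+1) f) :
  0 <= lambda -> (besov_seminorm p lambda f < +oo)%E ->
  (forall j, om j = (fine (om j))%:E) /\
  forall n, \sum_(j < n) 2 `^ (j%:R * lambda) * fine (om j) <=
    2 * fine (besov_seminorm p lambda f).
Proof.
move=> l0 foo; have sE := besov_seminorm_fin l0 foo.
have t0 j : 0 <= 2 ^- j.+1 :> R by rewrite invr_ge0 exprn_ge0.
have omE j : om j = (fine (om j))%:E.
  rewrite fineK // ge0_fin_numE ?modulus_ge0 // ltNge leye_eq; apply/negP => /eqP oy.
  have := sum_modulus_le p f l0 j.+1; rewrite sE -EFinM big_ord_recr /= -/(om j) oy.
  rewrite gt0_muley ?lte_fin ?powR_gt0 // addey ?leye_eq //.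
  by rewrite gt_eqF // (lt_le_trans (ltNyr 0)) // sume_ge0 // => i _; rewrite mule_ge0 ?lee_fin ?powR_ge0 ?modulus_ge0.
split=> // n; rewrite -lee_fin EFinM -sE -sumEFin.
apply: le_trans (sum_modulus_le p f l0 n).
by apply: lee_sum => j _; rewrite EFinM -omE.
Qed.

Lemma approximation_constant (R : realType) (d : nat) (p lambda : R) :
    (2 <= d)%N -> 1 <= p -> lambda = d%:R / p ->
  exists2 C : R, 0 <= C & forall (f : euclid R d -> R) s N,
    (lebesgue d).-integrable setT (EFin \o f) -> 0 <= s -> (1 <= N)%N ->
    forall om : nat -> R, (forall j, 0 <= om j) ->
    (forall j, modulus_of_continuity (smoothness_order lambda) p (2 ^- j.+1) f <= (om j)%:E)%E ->
    (forall n, \sum_(j < n) 2 `^ (j%:R * lambda) * om j <= s) ->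
  exists2 Delta : {fset dyadic_code (d := d)},
    dyadic_covering (R := R) Delta /\ (#|` Delta| <= N)%N &
    exists2 g : euclid R d -> R, piecewise_polynomials (smoothness_order lambda).-1 Delta g &
      (Lnorm_on unit_cube +oo (f \- g)%R <= (C * s * N%:R `^ (- p^-1))%:E)%E.
Proof.
move=> d2 p1 lE; have p0 : 0 < p by exact: lt_le_trans p1.
have l0 : 0 < lambda by rewrite lE divr_gt0 // ltr0n ltnW.
set k := smoothness_order lambda.
have k0 : (0 < k)%N by rewrite -(ltr0n R) (lt_trans l0) // smoothness_order_gt.
(* [b] is the room for [k] steps of at most [k] cell sides each; [r] satisfies [bk], [bM] and [dk]
   by means of [r < 2 ^ r]; [q] is [r + 1] since parent and child are compared one generation finer;
   [M] is the box of [lpoly_child]. *)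
pose b := (k * k)%N; pose r := (2 * b + 3 * k + 1 + d * k)%N; pose q := r.+1.
pose M := (2 ^ r + b + 2 * k)%N.
have r2 : (r < 2 ^ r)%N by exact: ltn_expl.
have bk : (b + k <= 2 ^ r)%N by rewrite /r in r2 *; lia.
have q2 : (2 ^ q = 2 * 2 ^ r)%N by rewrite /q expnS.
have bM : (b + M + k < 2 ^ q)%N by rewrite q2 /M; rewrite /r in r2 *; lia.
have dk : (d * k * 2 <= 2 ^ q)%N by rewrite q2; rewrite /r in r2 *; lia.
have [C1 C10 HC] := lpoly_child (R := R) (d := d) r b k0.
pose W : R := @weight_const R d k M.
have W0 : 0 <= W.
  by rewrite /W /weight_const sumr_ge0 // => w _; rewrite sumr_ge0 // => c _; rewrite sumr_ge0.
(* The last factor appears because the cells are [q] generations finer than their cube. *)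
pose D := C1 * W * 2 `^ (q%:R * lambda).
have D0 : 0 <= D by rewrite !mulr_ge0 ?powR_ge0.
(* The first term of the sum stems from the threshold, the second from the tail. *)
exists (D * ((2 ^+ d) `^ p^-1 + 1)); first by rewrite mulr_ge0 // addr_ge0 ?powR_ge0.
move=> f s N fi s0 N0 om om0 fom oms.
pose w K := weight k q b M C1 f K.
pose a j := D * (2 `^ (j%:R * lambda) * om j).
have a0 j : 0 <= a j by rewrite !mulr_ge0 ?powR_ge0.
have aA n : \sum_(j < n) a j <= D * s by rewrite -mulr_sumr ler_wpM2l.
have wa j S : uniq S -> {subset S <= dlevel j} ->
    \sum_(K <- S) w K <= (size S)%:R * (size S)%:R `^ (- p^-1) * a j.
  move=> uS Sj; have := weight_sum p1 (leqnn _) bM dk C10 fi uS Sj (om0 j) (fom j).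
  rewrite -/w -/W => H; apply: le_trans H _.
  have -> : (2 ^+ ((j + q) * d) : R) `^ p^-1 = 2 `^ (j%:R * lambda) * 2 `^ (q%:R * lambda).
    rewrite -powR_mulrn // -powRrM -powRD; last by rewrite pnatr_eq0 implybT.
    by rewrite lE natrM natrD; congr (_ `^ _); ring.
  by rewrite le_eqVlt; apply/orP; left; apply/eqP; rewrite /a /D; ring.
have Ppoly K : polynomials k.-1 (lpoly k r b f K) by exact: polynomials_lpoly.
have Pw K sg x : dyadic_cube K x -> `|lpoly k r b f (dchild K sg) x - lpoly k r b f K x| <= w K.
  move=> Kx; have -> : w K = C1 * weight k q b M 1 f K by rewrite /w /weight mul1r.
  apply: HC => //; first exact: weight_ge0.
  by move=> v c vk cM; exact: wdif_le_weight.
have [Delta DN [g gD [n gP]]] := tree_approximation p1 a0 N0 aA wa Ppoly Pw.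
exists Delta => //; exists g => //.
have NR : 0 <= N%:R :> R by [].
have BE : D * s * ((2 ^+ d / N%:R) `^ p^-1 + N%:R `^ (- p^-1)) =
    D * ((2 ^+ d) `^ p^-1 + 1) * s * N%:R `^ (- p^-1).
  by rewrite powRM ?invr_ge0 ?exprn_ge0 // -(powR_inv1 NR) -powRrM mulN1r; ring.
rewrite BE in gP; apply: Lnorm_oo_le.
- by apply: measurable_funTS; apply/measurable_EFinP; exact: measurable_int fi.
- by apply: measurable_funTS; exact: measurable_piecewise_polynomials gD.
- by rewrite !mulr_ge0 ?addr_ge0 ?powR_ge0.
- move=> e e0; have [j nj je] := lproj_cvg k0 bk n fi e0.
  exists (lproj k r b f j); split=> //; first exact: measurable_lproj.
  by move=> x Ux; exact: gP.
Qed.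

Theorem theorem2p4 (R : realType) (d : nat) (p lambda : R)
    (hd : (2 <= d)%N) (hp : 1 <= p) (hlambda : lambda = d%:R / p) :
  exists c : R, 0 < c /\
  forall (f : euclid R d -> R) (N : nat), besov p lambda f -> (1 <= N)%N ->
  exists Delta : {fset dyadic_code (d := d)},
    dyadic_covering (R := R) Delta /\ (#|` Delta| <= N)%N /\
    exists g : euclid R d -> R,
      piecewise_polynomials (smoothness_order lambda).-1 Delta g /\
      (Lnorm_on unit_cube +oo (f \- g)%R
       <= (c * N%:R `^ (- (lambda / d%:R)))%:E * besov_seminorm p lambda f)%E.
Proof.
have p0 : 0 < p by exact: lt_le_trans hp.
have d0 : 0 < d%:R :> R by rewrite ltr0n ltnW.
have l0 : 0 <= lambda by rewrite hlambda divr_ge0 // ltW.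
have [C C0 HC] := approximation_constant hd hp hlambda.
(* The 2 comes from comparing the dyadic sum with the seminorm; the 1 makes the constant
   positive. *)
exists (2 * C + 1); split; first by rewrite ltr_wpDl // mulr_ge0.
move=> f N [fLp foo] N1.
have [omE oms] := modulus_besov_sum l0 foo.
have sE := besov_seminorm_fin l0 foo.
set s := fine (besov_seminorm p lambda f) in oms sE.
have s0 : 0 <= 2 * s by have := oms 0%N; rewrite big_ord0.
have om0 j : 0 <= fine (modulus_of_continuity (smoothness_order lambda) p (2 ^- j.+1) f).
  by rewrite fine_ge0 // modulus_ge0.
have fom j : (modulus_of_continuity (smoothness_order lambda) p (2 ^- j.+1) (f \_ unit_cube) <=
    (fine (modulus_of_continuity (smoothness_order lambda) p (2 ^- j.+1) f))%:E)%E.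
  by rewrite modulus_restrict -omE.
have [Delta [Dcov DN] [g gD gf]] := HC _ _ _ (in_Lp_integrable hp fLp) s0 N1 _ om0 fom oms.
exists Delta; split=> //; split=> //; exists g; split=> //.
have -> : Lnorm_on unit_cube +oo (f \- g)%R = Lnorm_on unit_cube +oo ((f \_ unit_cube) \- g)%R.
  rewrite /Lnorm_on; congr Lnorm; apply/funext => x /=; congr (_%:E).
  by rewrite !patchE; case: ifP => // xU /=; rewrite patchE xU.
apply: le_trans gf _; rewrite sE -EFinM lee_fin hlambda.
have -> : d%:R / p / d%:R = p^-1 by field; rewrite !gt_eqF.
have s1 : 0 <= s by move: s0; rewrite pmulr_rge0.
have NR : 0 <= N%:R `^ (- p^-1) by exact: powR_ge0.
rewrite [leRHS]mulrAC [leLHS](_ : _ = 2 * C * s * N%:R `^ (- p^-1)); last by ring.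
by rewrite ler_wpM2r // ler_wpM2r // lerDl.
Qed.
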